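(* Let $d\ge2$, $p\in\mathbb R\setminus\{-d\}$, and let $\overline K\subset\mathbb R^d$ be a convex body that contains the origin in its interior; if $p<0$, assume that $\overline K$ is of class $\mathcal C^2_+$. For $\lambda>0$ and a fixed point $\mathbf o\in\mathrm{Sp}^d(\lambda)$ consider $\mathbb R^d$ as the projective model of $\mathrm{Sp}^d(\lambda)$ around $\mathbf o$. Then $$\lim_{\lambda\to0^+}\mathrm{as}_p^{\lambda,\mathbf o}(\overline K)=\mathrm{as}_p(\overline K)\qquad\text{and}\qquad\lim_{\lambda\to1}\mathrm{as}_p^{\lambda,\mathbf o}(\overline K)=\Omega_p^s(\overline K).$$
   Context: For $\lambda>0$, $\mathrm{Sp}^d(\lambda)$ is the space form of dimension $d$ and constant curvature $\lambda$, modelled as the sphere $\{\mathbf x\in\mathbb R^{d+1}:\mathbf x\cdot\mathbf x=1/\lambda\}$, with geodesic distance $d_\lambda$; $\mathrm{Sp}^d(1)=\mathbb S^d$. Put $\tan_\lambda t=\frac{\tan(\sqrt\lambda t)}{\sqrt\lambda}$. The gnomonic projection $g_{\mathbf o}^\lambda$ maps the point at distance $r<\frac\pi{2\sqrt\lambda}$ from $\mathbf o$ in unit direction $\mathbf u\in\mathbf o^\perp\cong\mathbb R^d$ to $(\tan_\lambda r)\,\mathbf u$. A functional on convex bodies of $\mathrm{Sp}^d(\lambda)$ evaluated at $\overline K\subset\mathbb R^d$ means its value at the preimage $K=(g_{\mathbf o}^\lambda)^{-1}(\overline K)\subset\mathrm{Sp}^d(\lambda)$ (for $\Omega_p^s$: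 the preimage in $\mathbb S^d$). Class $\mathcal C^2_+$: the boundary is a $\mathcal C^2$-smooth embedded hypersurface with everywhere strictly positive Gauss–Kronecker curvature. $H_{d-1}^\lambda(K,\cdot)\ge0$ is the generalized Gauss–Kronecker curvature of $\partial K$ in $\mathrm{Sp}^d(\lambda)$ (existing almost everywhere, in the sense of Aleksandrov), $\mathrm{vol}_{\partial K}^\lambda$ the $(d-1)$-dimensional Hausdorff measure on $\partial K$, and, with $H(K,\mathbf u)$ the tangent (totally geodesic) hyperplane to $K$ at $\mathbf u\in\partial K$, $$f_{\mathbf o}^\lambda(K,\mathbf u)=\sqrt{\frac{\lambda+(\tan_\lambda d_\lambda(\mathbf o,H(K,\mathbf u)))^2}{1+\lambda(\tan_\lambda d_\lambda(\mathbf o,H(K,\mathbf u)))^2}},$$ $$\mathrm{as}_p^{\lambda,\mathbf o}(K)=\int_{\partial K}\left(\frac{H_{d-1}^\lambda(K,\mathbf u)}{f_{\mathbf o}^\lambda(K,\mathbf u)^{d+1}}\right)^{\frac p{d+p}}f_{\mathbf o}^\lambda(K,\mathbf u)\,\mathrm{vol}_{\partial K}^\lambda(d\mathbf u).$$ $L_p$-floating area: $\Omega_p^s(K)=\int_{\partial K}H_{d-1}^s(K,\mathbf u)^{\frac p{d+p}}\,\mathrm{vol}_{\partial K}^s(d\mathbf u)$ for $K\subset\mathbb S^d$, where $H^s_{d-1}=H^1_{d-1}$, $\mathrm{vol}^s=\mathrm{vol}^1$. $L_p$-affine surface area of $\overline K\subset\mathbb R^d$: $\mathrm{as}_p(\overline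 K)=d\int_{\partial\overline K}\kappa_0(\overline K,\mathbf x)^{\frac p{d+p}}\,V_{\overline K}(d\mathbf x)$ with centro-affine curvature $\kappa_0(\overline K,\mathbf x)=\frac{H_{d-1}^e(\overline K,\mathbf x)}{(\mathbf x\cdot\mathbf n_{\overline K}(\mathbf x))^{d+1}}$ and cone volume measure $V_{\overline K}(d\mathbf x)=\frac1d(\mathbf x\cdot\mathbf n_{\overline K}(\mathbf x))\,\mathrm{vol}_{\partial\overline K}^e(d\mathbf x)$; here $\mathbf n_{\overline K}$ is the outer unit normal, $H_{d-1}^e$ the (generalized) Euclidean Gauss–Kronecker curvature and $\mathrm{vol}_{\partial\overline K}^e$ the Euclidean surface area measure. *)

(* Defs.v *)
From HB Require Import structures.
From mathcomp Require Import all_boot all_order all_algebra.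
From mathcomp Require Import all_classical all_reals all_analysis.

Set Implicit Arguments.
Unset Strict Implicit.
Unset Printing Implicit Defensive.

Import Order.TTheory GRing.Theory Num.Theory.
Import numFieldNormedType.Exports.

Local Open Scope classical_set_scope.
Local Open Scope ring_scope.

(* The library norm on 'rV[R]_m is the sup norm: its topology is the right one,
   but lengths and angles are taken with [dot] and [enorm]. *)
Definition dot {R : realType} {m : nat} (x y : 'rV[R]_m) : R :=
  \sum_i x 0 i * y 0 i.

Definition enorm {R : realType} {m : nat} (x : 'rV[R]_m) : R :=
  Num.sqrt (dot x x).

Definition boundary_in {R : realType} {m : nat} (X K : set 'rV[R]_m) :
    set 'rV[R]_m :=
  [set x | [/\ X x, closure K x & closure (X `\` K) x]].

Fixpoint ball_volume (R : realType) (k : nat) : R :=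
  match k with
  | 0 => 1
  | 1 => 2
  | k'.+2 => 2 * pi / k'.+2%:R * ball_volume R k'
  end.

Section Hausdorff.
Context {R : realType} {m : nat}.
Implicit Types (A : set 'rV[R]_m) (F : (set 'rV[R]_m)^nat).

(* [hausdorff_gauge k A] is omega_k (diam A / 2)^k, and 0 if A is empty; the
   factor makes [hausdorff k] agree with k-dimensional surface area. On a sphere
   the chordal distance used here and the geodesic distance agree to first
   order, so they give the same Hausdorff measure. *)
Definition hausdorff_gauge (k : nat) A : \bar R :=
  ereal_sup ([set 0%E] `|`
    [set r | exists x y, [/\ A x, A y &
       r = (ball_volume R k * (enorm (x - y) / 2) ^+ k)%:E]]).

Definition diam_le (delta : R) A : Prop :=
  forall x y, A x -> A y -> enorm (x - y) <= delta.

Definition fine_cover (delta : R) A : set (set 'rV[R]_m)^nat :=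
  [set F | A `<=` \bigcup_n F n /\ forall n, diam_le delta (F n)].

Definition hausdorff_delta (k : nat) (delta : R) A : \bar R :=
  ereal_inf [set (\sum_(n <oo) hausdorff_gauge k (F n))%E |
              F in fine_cover delta A].

Definition hausdorff (k : nat) A : \bar R :=
  ereal_sup [set hausdorff_delta k delta A | delta in [set r : R | 0 < r]].

Lemma hausdorff_gauge_ge0 k A : (0 <= hausdorff_gauge k A)%E.
Proof. by apply: ereal_sup_ubound; left. Qed.

Lemma hausdorff_gauge0 k : hausdorff_gauge k set0 = 0%E.
Proof.
apply/eqP; rewrite eq_le hausdorff_gauge_ge0 andbT.
by apply: ge_ereal_sup => _ [->//|[x [y [[]]]]].
Qed.

(* The penalised gauge, over the discrete sigma-algebra: it turns
   [hausdorff_delta] into an instance of the library's [mu_ext]. *)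
Let D := g_sigma_algebraType (setT : set (set 'rV[R]_m)).

Let pen k delta (A : set D) : \bar R :=
  if `[< diam_le delta A >] then hausdorff_gauge k A else +oo%E.

Let pen_ge0 k delta (A : set D) : (0 <= pen k delta A)%E.
Proof. by rewrite /pen; case: asboolP => // _; exact: hausdorff_gauge_ge0. Qed.

Let pen0 k delta : pen k delta set0 = 0%E.
Proof.
by rewrite /pen asboolT ?hausdorff_gauge0// => x y [].
Qed.

Let hausdorff_deltaE k delta A :
  hausdorff_delta k delta A = mu_ext (pen k delta) A.
Proof.
apply/eqP; rewrite eq_le; apply/andP; split; last first.
  apply: le_ereal_inf_tmp => _ [F [AF dF] <-]; apply: ereal_inf_lbound.
  exists F; first by split => // i; exact: sub_sigma_algebra.
  by apply: eq_eseriesr => n _; rewrite /pen asboolT.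
apply: le_ereal_inf_tmp => _ [F [_ AF] <-].
have [dF|/existsNP[n dF]] := pselect (forall n, diam_le delta (F n)).
  apply: ereal_inf_lbound; exists F => //.
  by apply: eq_eseriesr => n _; rewrite /pen asboolT.
rewrite (@eseries_pinfty _ _ xpredT n) ?leey// => [i _|].
  by rewrite -ltNye (lt_le_trans _ (pen_ge0 _ _ _)).
by rewrite /pen asboolF.
Qed.

Lemma hausdorff_ge0 k A : (0 <= hausdorff k A)%E.
Proof.
apply: (@le_trans _ _ (hausdorff_delta k 1 A)).
  by rewrite hausdorff_deltaE mu_ext_ge0.
by apply: ereal_sup_ubound; exists 1 => //=; exact: ltr01.
Qed.

Lemma hausdorff0 k : hausdorff k set0 = 0%E.
Proof.
apply/eqP; rewrite eq_le hausdorff_ge0 andbT; apply: ge_ereal_sup => _ [e _ <-].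
by rewrite hausdorff_deltaE mu_ext0.
Qed.

Lemma le_hausdorff k : {homo hausdorff k : A B / A `<=` B >-> (A <= B)%E}.
Proof.
move=> A B AB; apply: ge_ereal_sup => _ [e e0 <-].
apply: (@le_trans _ _ (hausdorff_delta k e B)).
  by rewrite !hausdorff_deltaE; exact: le_mu_ext.
by apply: ereal_sup_ubound; exists e.
Qed.

Lemma hausdorff_sigma_subadditive k :
  sigma_subadditive (hausdorff k : set 'rV[R]_m -> \bar R).
Proof.
move=> F; apply: ge_ereal_sup => _ [e e0 <-].
rewrite hausdorff_deltaE.
apply: (le_trans (mu_ext_sigma_subadditive (pen_ge0 k e) F)).
apply: lee_nneseries => n _.
- by move=> _; apply: mu_ext_ge0 => ?; exact: pen_ge0.
by rewrite -hausdorff_deltaE; apply: ereal_sup_ubound; exists e.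
Qed.

HB.instance Definition _ (k : nat) := isOuterMeasure.Build R 'rV[R]_m
  (hausdorff k) (hausdorff0 k) (hausdorff_ge0 k) (@le_hausdorff k)
  (@hausdorff_sigma_subadditive k).

End Hausdorff.

(* The Hausdorff measure on its Caratheodory sigma-algebra, which contains the
   Borel sets and is complete. *)
Definition hausdorff_measure {R : realType} (m k : nat) :=
  let mu : {outer_measure set 'rV[R]_m -> \bar R} := hausdorff k in
  (mu : set (caratheodory_type mu) -> \bar R) :
    {measure set (caratheodory_type mu) -> \bar R}.

(* Second-order (Aleksandrov) expansion at 0 of a hypersurface C of a Euclidean
   space E containing 0, with unit normal n there: the rows of B are an
   orthonormal basis of the tangent hyperplane, and C is locally the graph
   [height below the tangent hyperplane] = z S z^T / 2 + o(|z|^2) over it. *)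
Definition second_order {R : realType} {k m : nat} (C : set 'rV[R]_m)
    (n : 'rV[R]_m) (B : 'M[R]_(k, m)) (S : 'M[R]_k) : Prop :=
  S^T = S /\
  forall eps : R, 0 < eps -> exists2 delta : R, 0 < delta &
    forall v, C v -> enorm v < delta ->
      `| - dot v n - dot (v *m B^T *m S) (v *m B^T) / 2 | <=
        eps * enorm v ^+ 2.

Section Euclidean.
Context {R : realType} {d : nat}.
Implicit Types (K : set 'rV[R]_d) (x n : 'rV[R]_d).

Definition convex_body K : Prop :=
  [/\ compact K, convex_set K & interior K !=set0].

Definition bdE K : set 'rV[R]_d := boundary_in setT K.

Definition is_normalE K x n : Prop :=
  dot n n = 1 /\ forall y, K y -> dot (y - x) n <= 0.

(* The outer unit normal; at a singular boundary point, one of them. *)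
Definition normalE K x : 'rV[R]_d := get (is_normalE K x).

(* The generalized Gauss-Kronecker curvature, 0 where the second-order
   expansion does not exist. *)
Definition curvatureE K x : R :=
  xget 0 [set k | exists (B : 'M[R]_(d.-1, d)) (S : 'M[R]_d.-1),
    [/\ is_normalE K x (normalE K x),
        B *m B^T = 1%:M /\ normalE K x *m B^T = 0,
        second_order [set v | bdE K (x + v)] (normalE K x) B S
      & k = \det S]].

Definition partial (i : 'I_d) (F : 'rV[R]_d -> R) (x : 'rV[R]_d) : R :=
  'D_(delta_mx 0 i) F x.

Definition C2_on (U : set 'rV[R]_d) (F : 'rV[R]_d -> R) : Prop :=
  forall x, U x ->
    {for x, continuous F} /\
    forall i, [/\ derivable F x (delta_mx 0 i),
                  {for x, continuous (partial i F)}
                & forall j, derivable (partial i F) x (delta_mx 0 j) /\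
                            {for x, continuous (partial j (partial i F))}].

Definition C2_hypersurface (M : set 'rV[R]_d) : Prop :=
  forall x, M x -> exists (U : set 'rV[R]_d) (F : 'rV[R]_d -> R),
    [/\ open U, U x, C2_on U F,
        forall y, U y -> exists i, partial i F y != 0
      & forall y, U y -> (M y <-> F y = 0)].

Definition class_C2plus K : Prop :=
  C2_hypersurface (bdE K) /\ forall x, bdE K x -> 0 < curvatureE K x.

Definition centro_affine_curvature K x : R :=
  curvatureE K x / dot x (normalE K x) ^+ d.+1.

(* Integration against the cone volume measure
   V_K(dx) = (1/d) (x . n_K(x)) H^(d-1)(dx). Since 0 `^ 0 = 1, p = 0 gives
   d times the volume of K. *)
Definition affine_area (p : R) K : \bar R :=
  (d%:R%:E *
   \int[hausdorff_measure d d.-1]_(x in bdE K)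
     (centro_affine_curvature K x `^ (p / (d%:R + p)) *
      (d%:R^-1 * dot x (normalE K x)))%:E)%E.

End Euclidean.

Section SpaceForm.
Context {R : realType} {d : nat}.
Implicit Types (lam r : R) (o u w n : 'rV[R]_d.+1) (K : set 'rV[R]_d.+1).

Definition Sp lam : set 'rV[R]_d.+1 := [set u | dot u u = lam^-1].

Definition distS lam u w : R := acos (lam * dot u w) / Num.sqrt lam.

Definition tanS lam r : R := tan (Num.sqrt lam * r) / Num.sqrt lam.

(* The point at distance r from u in the unit tangent direction w. *)
Definition geodesicS lam u w r : 'rV[R]_d.+1 :=
  cos (Num.sqrt lam * r) *: u +
  (sin (Num.sqrt lam * r) / Num.sqrt lam) *: w.

(* The Riemannian exponential map at u; expS lam u 0 = u. *)
Definition expS lam u (v : 'rV[R]_d.+1) : 'rV[R]_d.+1 :=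
  geodesicS lam u ((enorm v)^-1 *: v) (enorm v).

(* iota is the matrix of a linear isometry from R^d onto the orthogonal
   complement of o. *)
Definition identifies_perp o (iota : 'M[R]_(d, d.+1)) : Prop :=
  iota *m iota^T = 1%:M /\ o *m iota^T = 0.

Definition gnomonic_preimage lam o (iota : 'M[R]_(d, d.+1))
    (Kbar : set 'rV[R]_d) : set 'rV[R]_d.+1 :=
  [set y | exists (r : R) (w : 'rV[R]_d),
    [/\ 0 <= r < pi / (2 * Num.sqrt lam), dot w w = 1,
        y = geodesicS lam o (w *m iota) r & Kbar (tanS lam r *: w)]].

Definition bdS lam K : set 'rV[R]_d.+1 := boundary_in (Sp lam) K.

(* A unit vector n tangent at u such that K lies on the inner side of the
   totally geodesic hyperplane through u orthogonal to n. *)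
Definition is_normalS K u n : Prop :=
  [/\ dot n n = 1, dot u n = 0 & forall y, K y -> dot y n <= 0].

Definition normalS K u : 'rV[R]_d.+1 := get (is_normalS K u).

Definition tangent_hyperplane lam K u : set 'rV[R]_d.+1 :=
  Sp lam `&` [set y | dot y (normalS K u) = 0].

(* As [curvatureE], with the boundary read in normal coordinates at u. *)
Definition curvatureS lam K u : R :=
  xget 0 [set k | exists (B : 'M[R]_(d.-1, d.+1)) (S : 'M[R]_d.-1),
    [/\ is_normalS K u (normalS K u),
        [/\ B *m B^T = 1%:M, u *m B^T = 0 & normalS K u *m B^T = 0],
        second_order [set v | dot v u = 0 /\ bdS lam K (expS lam u v)]
          (normalS K u) B S
      & k = \det S]].

Definition tan_dist_tangent lam o K u : R :=
  tanS lam (inf (distS lam o @` tangent_hyperplane lam K u)).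

Definition fS lam o K u : R :=
  Num.sqrt ((lam + tan_dist_tangent lam o K u ^+ 2) /
            (1 + lam * tan_dist_tangent lam o K u ^+ 2)).

Definition affine_areaS lam o (p : R) K : \bar R :=
  (\int[hausdorff_measure d.+1 d.-1]_(u in bdS lam K)
     ((curvatureS lam K u / fS lam o K u ^+ d.+1) `^ (p / (d%:R + p)) *
      fS lam o K u)%:E)%E.

Definition floating_area (p : R) K : \bar R :=
  (\int[hausdorff_measure d.+1 d.-1]_(u in bdS 1 K)
     (curvatureS 1 K u `^ (p / (d%:R + p)))%:E)%E.

End SpaceForm.

(* Main.v *)
(** Let G_lam x = (o + x iota) / rho x, with rho x = sqrt (1 + lam |x|^2), be the
    inverse of the gnomonic projection. If n is the outer normal of K at x and
    h = x.n, then the tangent hyperplane at G_lam x has tan_lam-distance h from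
    o, and the curvature at G_lam x is that of K at x times
    (rho / sqrt (1 + lam h^2))^(d+1). On the boundary of K, |x| and h are
    bounded and h is bounded away from 0, so the ratio of the integrands at lam
    and at the limit tends to 1 uniformly. On the other hand G_lam for lam -> 0,
    and G_lam o G_1^-1 for lam -> 1, are bi-Lipschitz with constants tending to
    1, hence distort Hausdorff measures by factors tending to 1. These two-sided
    multiplicative bounds give both limits without a Jacobian, a dominating
    function, or the measurability of the curvature: the integral of a
    nonnegative function is a supremum over simple functions, and bi-Lipschitz
    maps transport Caratheodory measurable subsets of sets of finite measure
    because these are Borel up to a null set.

    Boundary points with several normals, where no comparison is available,
    are null: their normal cones meet countably many flats of codimension 2, and
    the nearest-point map onto K is nonexpansive. *)

Require Import Defs.
From mathcomp Require Import all_boot all_order all_algebra finmap.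
From mathcomp Require Import all_classical all_reals all_analysis.
From mathcomp Require Import ring lra.

Set Implicit Arguments.
Unset Strict Implicit.
Unset Printing Implicit Defensive.

Import Order.TTheory GRing.Theory Num.Theory.
Import numFieldNormedType.Exports.

Local Open Scope classical_set_scope.
Local Open Scope ring_scope.

(** * Euclidean space *)

(** The base points [o lam] and the identifications [iota lam] may depend on lam in any way, so no
    map between the spheres converges pointwise; only quantities that reduce to inner products of
    R^d can be compared. Chordal distances ([gno_dist]), the heights x.n and the curvature factor
    are of this kind.

    The curvature is the determinant of a form selected by [xget], with default 0 where no expansion
    exists. Its transformation rule therefore needs more than a computation of determinants: an
    expansion must exist on one side exactly when it does on the other, so expansions and tangent
    frames are carried both ways; and the determinant must be unique, which requires boundary points
    approximating every tangent vector ([tangent_approx]).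

    All errors are measured by one number M >= 1 that tends to 1, and each bound is a fixed integral
    power of M. Exponents p / (d + p) of either sign and infinite areas are thereby treated alike: a
    two-sided ratio bound survives a negative power, and it makes two areas infinite together. *)

Section DotProduct.
Context {R : realType} {m : nat}.
Implicit Types (x y z : 'rV[R]_m) (a b : R).

Lemma dotE x y : dot x y = (x *m y^T) 0 0.
Proof. by rewrite mxE; apply: eq_bigr => i _; rewrite mxE. Qed.

Lemma dotC x y : dot x y = dot y x.
Proof. by apply: eq_bigr => i _; rewrite mulrC. Qed.

Lemma dotDl x y z : dot (x + y) z = dot x z + dot y z.
Proof. by rewrite -big_split; apply: eq_bigr => i _; rewrite mxE mulrDl. Qed.

Lemma dotZl a x y : dot (a *: x) y = a * dot x y.
Proof. by rewrite mulr_sumr; apply: eq_bigr => i _; rewrite mxE mulrA. Qed.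

Lemma dotDr x y z : dot z (x + y) = dot z x + dot z y.
Proof. by rewrite dotC dotDl !(dotC z). Qed.

Lemma dotZr a x y : dot y (a *: x) = a * dot y x.
Proof. by rewrite dotC dotZl dotC. Qed.

Lemma dotNl x y : dot (- x) y = - dot x y.
Proof. by rewrite -scaleN1r dotZl mulN1r. Qed.

Lemma dotNr x y : dot y (- x) = - dot y x.
Proof. by rewrite dotC dotNl dotC. Qed.

Lemma dotBl x y z : dot (x - y) z = dot x z - dot y z.
Proof. by rewrite dotDl dotNl. Qed.

Lemma dotBr x y z : dot z (x - y) = dot z x - dot z y.
Proof. by rewrite dotDr dotNr. Qed.

Lemma dot0l x : dot 0 x = 0.
Proof. by rewrite -(scale0r 0) dotZl mul0r. Qed.

Lemma dot0r x : dot x 0 = 0.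
Proof. by rewrite dotC dot0l. Qed.

Definition dotLE := (dotDl, dotBl, dotZl, dotNl, dotDr, dotBr, dotZr, dotNr,
  dot0l, dot0r).

Lemma dot_addZ a x y :
  dot (x + a *: y) (x + a *: y) = dot x x + 2 * a * dot x y + a ^+ 2 * dot y y.
Proof. by rewrite !dotLE (dotC y x); ring. Qed.

Lemma dot_ge0 x : 0 <= dot x x.
Proof. by apply: sumr_ge0 => i _; rewrite -expr2 sqr_ge0. Qed.

Lemma sqr_coord_le_dot x i : x 0 i ^+ 2 <= dot x x.
Proof.
rewrite /dot (bigD1 i)//= expr2 lerDl; apply: sumr_ge0 => j _.
by rewrite -expr2 sqr_ge0.
Qed.

Lemma dot_eq0 x : (dot x x == 0) = (x == 0).
Proof.
apply/eqP/eqP => [x0|->]; last by rewrite dot0l.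
apply/rowP => i; rewrite mxE; apply/eqP; rewrite -sqrf_eq0 eq_le sqr_ge0 andbT.
by rewrite -x0 sqr_coord_le_dot.
Qed.

Lemma sqr_enorm x : enorm x ^+ 2 = dot x x.
Proof. by rewrite sqr_sqrtr ?dot_ge0. Qed.

Lemma enorm_ge0 x : 0 <= enorm x.
Proof. exact: sqrtr_ge0. Qed.

Lemma enorm0 : enorm (0 : 'rV[R]_m) = 0.
Proof. by rewrite /enorm dot0l sqrtr0. Qed.

Lemma enorm_eq0 x : (enorm x == 0) = (x == 0).
Proof. by rewrite -sqrf_eq0 sqr_enorm dot_eq0. Qed.

Lemma enormZ a x : enorm (a *: x) = `|a| * enorm x.
Proof. by rewrite /enorm !dotLE mulrA -expr2 sqrtrM ?sqr_ge0// sqrtr_sqr. Qed.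

Lemma enormN x : enorm (- x) = enorm x.
Proof. by rewrite -scaleN1r enormZ normrN1 mul1r. Qed.

Lemma enormB x y : enorm (x - y) = enorm (y - x).
Proof. by rewrite -enormN opprB. Qed.

Lemma enorm_gt0 x : (0 < enorm x) = (x != 0).
Proof. by rewrite lt_def enorm_ge0 andbT enorm_eq0. Qed.

Lemma enorm1 x : dot x x = 1 -> enorm x = 1.
Proof. by move=> x1; rewrite /enorm x1 sqrtr1. Qed.

Lemma coord_le_enorm x i : `|x 0 i| <= enorm x.
Proof. by rewrite -sqrtr_sqr ler_wsqrtr// sqr_coord_le_dot. Qed.

(** Cauchy-Schwarz, from the square of |y| x - |x| y. *)
Lemma dot_le_enorm x y : dot x y <= enorm x * enorm y.
Proof.
have [->|x0] := eqVneq x 0; first by rewrite dot0l enorm0 mul0r.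
have [->|y0] := eqVneq y 0; first by rewrite dot0r enorm0 mulr0.
have [X Y] : 0 < enorm x /\ 0 < enorm y by rewrite !enorm_gt0.
have := dot_ge0 (enorm y *: x - enorm x *: y).
rewrite !dotLE (dotC y x) -!sqr_enorm => H.
have {}H : 0 <= (2 * (enorm x * enorm y)) * (enorm x * enorm y - dot x y).
  by move: H; congr (0 <= _); ring.
by move: H; rewrite pmulr_rge0 ?mulr_gt0// subr_ge0.
Qed.

Lemma norm_dot_le x y : `|dot x y| <= enorm x * enorm y.
Proof.
rewrite ler_norml dot_le_enorm andbT lerNl -dotNl -(enormN x).
exact: dot_le_enorm.
Qed.

Lemma enormD x y : enorm (x + y) <= enorm x + enorm y.
Proof.
rewrite -(@ler_pXn2r _ 2) ?nnegrE ?addr_ge0 ?enorm_ge0// sqrrD !sqr_enorm.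
by rewrite !dotLE (dotC y x); have := dot_le_enorm x y; lra.
Qed.

Lemma enorm_triangle y x z : enorm (x - z) <= enorm (x - y) + enorm (y - z).
Proof. by apply: le_trans (enormD _ _); rewrite addrA subrK. Qed.

Lemma enorm_le_sum x : enorm x <= \sum_i `|x 0 i|.
Proof.
have s0 : 0 <= \sum_i `|x 0 i| by apply: sumr_ge0.
rewrite -(@ler_pXn2r _ 2) ?nnegrE ?enorm_ge0// sqr_enorm expr2 mulr_suml.
apply: ler_sum => i _; rewrite (le_trans (ler_norm _))// normrM ler_wpM2l//.
by rewrite (bigD1 i)//= lerDl sumr_ge0.
Qed.

Lemma enorm_le_const x a : 0 <= a -> (forall i, `|x 0 i| <= a) ->
  enorm x <= Num.sqrt m%:R * a.
Proof.
move=> a0 xa; rewrite -(@ler_pXn2r _ 2) ?nnegrE ?enorm_ge0 ?mulr_ge0//.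
rewrite sqr_enorm exprMn sqr_sqrtr// -[m%:R]/(m%:R) mulr_natl.
rewrite -[X in _ *+ X]card_ord -sumr_const; apply: ler_sum => i _.
by rewrite -expr2 -(real_normK (num_real _)) lerXn2r ?nnegrE.
Qed.

(** The supporting height of a ball of radius a, attained at z = (a / |x|) x. *)
Lemma dot_ball_le x y a : 0 <= a -> (forall z, enorm z <= a -> dot z x <= dot y x) ->
  a * enorm x <= dot y x.
Proof.
move=> a0 H; have [->|x0] := eqVneq x 0; first by rewrite enorm0 dot0r mulr0.
have x1 : 0 < enorm x by rewrite enorm_gt0.
apply: le_trans (H ((a / enorm x) *: x) _).
  by rewrite dotZl -sqr_enorm expr2 mulrA divfK ?gt_eqF.
by rewrite enormZ ger0_norm ?divr_ge0 ?enorm_ge0// divfK ?gt_eqF.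
Qed.

End DotProduct.

Section DotMatrix.
Context {R : realType}.

Lemma dot_mulmx m k (x : 'rV[R]_m) (A : 'M[R]_(m, k)) (y : 'rV[R]_k) :
  dot (x *m A) y = dot x (y *m A^T).
Proof. by rewrite !dotE trmx_mul trmxK mulmxA. Qed.

Lemma dot_isometry m k (x y : 'rV[R]_m) (A : 'M[R]_(m, k)) :
  A *m A^T = 1%:M -> dot (x *m A) (y *m A) = dot x y.
Proof. by move=> AA; rewrite dot_mulmx -mulmxA AA mulmx1. Qed.

Lemma mulmx_le m k (A : 'M[R]_(m, k)) :
  exists2 C : R, 0 < C & forall x, enorm (x *m A) <= C * enorm x.
Proof.
exists (1 + \sum_j \sum_i `|A i j|).
  by rewrite ltr_wpDr// sumr_ge0// => j _; rewrite sumr_ge0.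
move=> x; apply: (le_trans (enorm_le_sum _)).
rewrite mulrDl mul1r ler_wpDl ?enorm_ge0// mulr_suml ler_sum// => j _.
rewrite mxE (le_trans (ler_norm_sum _ _ _))// mulr_suml ler_sum// => i _.
by rewrite normrM mulrC ler_wpM2l// coord_le_enorm.
Qed.

Lemma row_outer m k (x y : 'rV[R]_m) (z : 'rV[R]_k) :
  x *m (y^T *m z) = dot x y *: z.
Proof. by rewrite mulmxA [x *m _]mx11_scalar mul_scalar_mx dotE. Qed.

End DotMatrix.

Section EuclideanTopology.
Context {R : realType}.

Lemma nbhs_enormP m (x : 'rV[R]_m) (A : set 'rV[R]_m) :
  nbhs x A <-> exists2 e : R, 0 < e & forall y, enorm (y - x) < e -> A y.
Proof.
split=> [/nbhs_ballP[e /= e0 eA]|[e e0 eA]].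
  exists e => // y yx; apply: eA; split => // i j.
  rewrite /ball/= -normrN opprB ord1; apply: le_lt_trans yx.
  by have := coord_le_enorm (y - x) j; rewrite !mxE.
(* Balls here are those of the sup norm, and [enorm] is at most sqrt m times that norm; the + 1
   keeps the divisor positive when m = 0. *)
have e'0 : 0 < e / (Num.sqrt m%:R + 1).
  by rewrite divr_gt0// ltr_wpDl.
apply/nbhs_ballP; exists (e / (Num.sqrt m%:R + 1)) => //= y yx; apply: eA.
apply: (@le_lt_trans _ _ (Num.sqrt m%:R * (e / (Num.sqrt m%:R + 1)))).
  apply: enorm_le_const; first exact: ltW.
  move=> i; rewrite !mxE -normrN opprB; have := yx.2 0 i.
  by rewrite /ball/= => /ltW.
rewrite mulrCA gtr_pMr// ltr_pdivrMr ?ltr_wpDl// mul1r ltrDl//.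
Qed.

Lemma closure_enormP m (A : set 'rV[R]_m) x :
  closure A x <-> forall e : R, 0 < e -> exists2 y, A y & enorm (y - x) < e.
Proof.
split=> [Ax e e0|H B /nbhs_enormP[e /H[y Ay yx] eB]].
  have /Ax[y [Ay yx]] : nbhs x [set y | enorm (y - x) < e].
    by apply/nbhs_enormP; exists e.
  by exists y.
by exists y; split => //; apply: eB.
Qed.

Lemma lipschitz_continuous m (f : 'rV[R]_m -> R) (C : R) :
  (forall x y, `|f x - f y| <= C * enorm (x - y)) -> continuous f.
Proof.
move=> fC x; apply/cvgrPdist_lt; first exact: nbhs_filter.
move=> e e0.
have C0 : 0 < `|C| + 1 by rewrite ltr_wpDl.
apply: (nbhs_enormP _ _).2; exists (e / (`|C| + 1)); first by rewrite divr_gt0.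
move=> y; rewrite ltr_pdivlMr// => yx; apply: le_lt_trans yx.
rewrite (le_trans (fC _ _))// enormB mulrC ler_wpM2l ?enorm_ge0//.
by rewrite ler_wpDr// ler_norm.
Qed.

Lemma enorm_continuous m : continuous (@enorm R m).
Proof.
apply: (@lipschitz_continuous _ _ 1) => x y; rewrite mul1r ler_norml.
have := enorm_triangle y x 0; have := enorm_triangle x y 0.
by rewrite !subr0 (enormB y x); lra.
Qed.

Lemma dot_continuous m (y : 'rV[R]_m) : continuous (dot^~ y).
Proof.
apply: (@lipschitz_continuous _ _ (enorm y)) => x z.
by rewrite -dotBl mulrC norm_dot_le.
Qed.

Lemma closed_le_continuous m (f : 'rV[R]_m -> R) c : continuous f ->
  closed [set x | f x <= c].
Proof. by move=> cf; apply: (@closed_comp _ _ _ [set y | y <= c]) => //;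
  exact: closed_le. Qed.

Lemma closed_enormP m (A : set 'rV[R]_m) : closed A <->
  (forall x, (forall e : R, 0 < e -> exists2 y, A y & enorm (y - x) < e) -> A x).
Proof.
by split=> H x => [|/closure_enormP]; [move/closure_enormP|]; exact: H.
Qed.

Lemma compact_enorm_le m (A : set 'rV[R]_m) : compact A ->
  exists2 D : R, 0 < D & forall x, A x -> enorm x <= D.
Proof.
move=> cA; have [A0|/set0P/negP/negPn/eqP A0] := pselect (A !=set0).
  have ce : {within A, continuous (@enorm R m)}.
    exact/continuous_subspaceT/enorm_continuous.
  have [c _ H] := EVT_max_rV A0 cA ce; exists (enorm c + 1).
    by rewrite ltr_wpDl// enorm_ge0.
  by move=> x Ax; rewrite ler_wpDr// H// inE.
by exists 1 => // x; rewrite A0.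
Qed.

Lemma closed_bounded_compact m (A : set 'rV[R]_m) (D : R) : closed A ->
  (forall x, A x -> enorm x <= D) -> compact A.
Proof.
move=> cA AD; apply: bounded_closed_compact => //.
exists D; split; first exact: num_real.
move=> M DM x Ax /=; rewrite /Num.norm/= mx_normrE; apply/bigmax_leP; split => /=.
  by apply: le_trans (ltW DM); apply: le_trans (AD _ Ax); exact: enorm_ge0.
move=> [i j] _ /=; rewrite ord1 (le_trans (coord_le_enorm _ _))//.
by rewrite (le_trans (AD _ Ax))// ltW.
Qed.

End EuclideanTopology.

(** * Hausdorff measures *)

Section HausdorffBounds.
Context {R : realType}.
Local Open Scope ereal_scope.

Lemma ball_volume_ge0 k : (0 <= ball_volume R k)%R.
Proof.
elim/ltn_ind: k => -[|[|k]] IH //=.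
by rewrite mulr_ge0 ?IH// divr_ge0// mulr_ge0// pi_ge0.
Qed.

Lemma le_hausdorff_gauge_points m k (A : set 'rV[R]_m) x y : A x -> A y ->
  (ball_volume R k * (enorm (x - y) / 2) ^+ k)%:E <= hausdorff_gauge k A.
Proof. by move=> Ax Ay; apply: ereal_sup_ubound; right; exists x, y. Qed.

Lemma hausdorff_gauge_le m k (A : set 'rV[R]_m) c : 0 <= c ->
  (forall x y, A x -> A y ->
    (ball_volume R k * (enorm (x - y) / 2) ^+ k)%:E <= c) ->
  hausdorff_gauge k A <= c.
Proof.
move=> c0 H; apply: ge_ereal_sup => _ [->//|[x [y [Ax Ay ->]]]].
exact: H.
Qed.

Lemma subset_hausdorff_gauge m k (A B : set 'rV[R]_m) : A `<=` B ->
  hausdorff_gauge k A <= hausdorff_gauge k B.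
Proof.
move=> AB; apply: hausdorff_gauge_le; first exact: hausdorff_gauge_ge0.
by move=> x y /AB Ax /AB; exact: le_hausdorff_gauge_points.
Qed.

Lemma hausdorff_gauge_diam m k (A : set 'rV[R]_m) (r : R) : diam_le r A ->
  hausdorff_gauge k A <= (ball_volume R k * (`|r| / 2) ^+ k)%:E.
Proof.
move=> Ar; apply: hausdorff_gauge_le.
  by rewrite lee_fin mulr_ge0 ?ball_volume_ge0// exprn_ge0// divr_ge0.
move=> x y Ax Ay; rewrite lee_fin ler_wpM2l ?ball_volume_ge0// lerXn2r//.
- by rewrite nnegrE divr_ge0 ?enorm_ge0.
- by rewrite nnegrE divr_ge0.
- by rewrite ler_wpM2r// (le_trans (Ar _ _ Ax Ay))// ler_norm.
Qed.

Lemma hausdorff_gauge_image m m' k (A : set 'rV[R]_m) (B : set 'rV[R]_m')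
    (phi : 'rV[R]_m -> 'rV[R]_m') (L : R) : (0 <= L)%R -> B `<=` phi @` A ->
  (forall x y, A x -> A y -> (enorm (phi x - phi y) <= L * enorm (x - y))%R) ->
  hausdorff_gauge k B <= (L ^+ k)%:E * hausdorff_gauge k A.
Proof.
move=> L0 BA H; apply: hausdorff_gauge_le.
  by rewrite mule_ge0 ?hausdorff_gauge_ge0// lee_fin exprn_ge0.
move=> _ _ /BA[x Ax <-] /BA[y Ay <-].
apply: (@le_trans _ _
    ((L ^+ k)%:E * (ball_volume R k * (enorm (x - y) / 2) ^+ k)%:E)).
  rewrite -EFinM lee_fin mulrCA ler_wpM2l ?ball_volume_ge0// -exprMn lerXn2r//.
  - by rewrite nnegrE divr_ge0 ?enorm_ge0.
  - by rewrite nnegrE mulr_ge0// divr_ge0 ?enorm_ge0.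
  - by rewrite mulrA ler_wpM2r// H.
by rewrite lee_wpmul2l ?lee_fin ?exprn_ge0// le_hausdorff_gauge_points.
Qed.

Lemma hausdorff_delta_ge0 m k (d : R) (A : set 'rV[R]_m) :
  0 <= hausdorff_delta k d A.
Proof.
apply: le_ereal_inf_tmp => _ [F _ <-]; apply: nneseries_ge0 => n _ _.
exact: hausdorff_gauge_ge0.
Qed.

Lemma hausdorff_delta_le_cover m k (d : R) (A : set 'rV[R]_m) F :
  fine_cover d A F ->
  hausdorff_delta k d A <= \sum_(n <oo) hausdorff_gauge k (F n).
Proof. by move=> AF; apply: ereal_inf_lbound; exists F. Qed.

Lemma hausdorff_delta_le m k (d : R) (A : set 'rV[R]_m) : (0 < d)%R ->
  hausdorff_delta k d A <= hausdorff k A.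
Proof. by move=> d0; apply: ereal_sup_ubound; exists d. Qed.

Lemma le_hausdorff_delta m k (d d' : R) (A : set 'rV[R]_m) : (d <= d')%R ->
  hausdorff_delta k d' A <= hausdorff_delta k d A.
Proof.
move=> dd; apply: le_ereal_inf_tmp => _ [F [AF dF] <-].
apply: hausdorff_delta_le_cover; split => // n x y Fx Fy.
by rewrite (le_trans (dF n _ _ Fx Fy)).
Qed.

Lemma hausdorff_le m k (A : set 'rV[R]_m) c :
  (forall d : R, (0 < d)%R -> hausdorff_delta k d A <= c) ->
  hausdorff k A <= c.
Proof. by move=> H; apply: ge_ereal_sup => _ [d d0 <-]; exact: H. Qed.

(** A cover of A of mesh d / L is first intersected with A, where alone phi is controlled; its image
    is then a cover of B of mesh d. *)
Lemma hausdorff_lipschitz m m' k (A : set 'rV[R]_m) (B : set 'rV[R]_m')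
    (phi : 'rV[R]_m -> 'rV[R]_m') (L : R) : (0 < L)%R -> B `<=` phi @` A ->
  (forall x y, A x -> A y -> (enorm (phi x - phi y) <= L * enorm (x - y))%R) ->
  hausdorff k B <= (L ^+ k)%:E * hausdorff k A.
Proof.
move=> L0 BA H; apply: hausdorff_le => d d0.
have Lk : (0 < L ^+ k)%R by rewrite exprn_gt0.
apply: (@le_trans _ _ ((L ^+ k)%:E * hausdorff_delta k (d / L) A)); last first.
  by rewrite lee_pmul2l// hausdorff_delta_le ?divr_gt0.
rewrite muleC -lee_pdivrMr//; apply: le_ereal_inf_tmp => _ [F [AF dF] <-].
rewrite lee_pdivrMr// muleC -nneseriesZl; last first.
  by move=> n _; exact: hausdorff_gauge_ge0.
have HF n x y : (F n `&` A) x -> (F n `&` A) y ->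
    (enorm (phi x - phi y) <= L * enorm (x - y))%R.
  by move=> [_ Ax] [_ Ay]; exact: H.
apply: (@le_trans _ _ (\sum_(n <oo) hausdorff_gauge k (phi @` (F n `&` A)))).
  apply: hausdorff_delta_le_cover; split=> [y /BA[x Ax <-]|n].
    by have [n _ Fx] := AF _ Ax; exists n => //; exists x.
  move=> _ _ [x Ax <-] [y Ay <-]; rewrite (le_trans (HF n _ _ Ax Ay))//.
  by rewrite mulrC -ler_pdivlMr//; exact: dF Ax.1 Ay.1.
apply: lee_nneseries => n _; first by move=> _; exact: hausdorff_gauge_ge0.
apply: (@le_trans _ _ ((L ^+ k)%:E * hausdorff_gauge k (F n `&` A))).
  by apply: (hausdorff_gauge_image k (ltW L0) _ (HF n)).
by rewrite lee_pmul2l// subset_hausdorff_gauge// => x [].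
Qed.

Lemma hausdorff_delta_fin_cover m k (d r : R) (A : set 'rV[R]_m)
    (T : finType) (F : T -> set 'rV[R]_m) : (0 <= r <= d)%R ->
  A `<=` \bigcup_t F t -> (forall t, diam_le r (F t)) ->
  hausdorff_delta k d A <= (#|T|%:R * (ball_volume R k * (r / 2) ^+ k))%:E.
Proof.
move=> /andP[r0 rd] AF Fr.
(* The finite family is padded with empty sets, whose gauge is 0 even for k = 0. *)
pose G n := if insub n is Some i then F (enum_val (i : 'I_#|T|)) else set0.
have Gr n : diam_le r (G n).
  by rewrite /G; case: insub => [i|x y []]; exact: Fr.
have G0 n : (#|T| <= n)%N -> G n = set0 by move=> Tn; rewrite /G insubN// -leqNgt.
apply: (@le_trans _ _ (\sum_(n <oo) hausdorff_gauge k (G n))).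
  apply: hausdorff_delta_le_cover; split=> [x /AF[t _ Ft]|n x y Gx Gy].
    exists (enum_rank t) => //; rewrite /G insubT//= => tT.
    by rewrite (_ : Sub _ _ = enum_rank t) ?enum_rankK//; exact: val_inj.
  exact: le_trans (Gr n x y Gx Gy) rd.
rewrite (@nneseries_split _ _ 0%N #|T|); last first.
  by move=> n _; exact: hausdorff_gauge_ge0.
rewrite add0n [X in _ + X]eseries0 ?adde0; last first.
  by move=> n Tn _; rewrite G0// hausdorff_gauge0.
apply: (@le_trans _ _
    (\sum_(0 <= n < #|T|) (ball_volume R k * (r / 2) ^+ k)%:E)).
  by apply: lee_sum => n _; rewrite -[in leRHS](ger0_norm r0);
     exact: hausdorff_gauge_diam.
by rewrite big_mkord sumEFin sumr_const card_ord mulr_natl.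
Qed.

End HausdorffBounds.

(** * Measurability of closed sets and closed hulls *)

Section HausdorffMetric.
Context {R : realType}.
Local Open Scope ereal_scope.

Lemma hausdorffU_le m k (A B : set 'rV[R]_m) :
  hausdorff k (A `|` B) <= hausdorff k A + hausdorff k B.
Proof. exact: outer_measureU2. Qed.

(** A set of diameter less than e cannot meet both A and B, so the gauge of a fine cover of the
    union splits between them. *)
Lemma hausdorffU_separated m k (A B : set 'rV[R]_m) (e : R) : (0 < e)%R ->
  (forall x y, A x -> B y -> (e <= enorm (x - y))%R) ->
  hausdorff k A + hausdorff k B <= hausdorff k (A `|` B).
Proof.
move=> e0 AB.
have step d : (0 < d)%R -> (d < e)%R ->
    hausdorff_delta k d A + hausdorff_delta k d B <= hausdorff k (A `|` B).
  move=> d0 de; apply: le_trans (hausdorff_delta_le k _ d0).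
  apply: le_ereal_inf_tmp => _ [F [ABF dF] <-].
  apply: (@le_trans _ _ (\sum_(n <oo)
      (hausdorff_gauge k (F n `&` A) + hausdorff_gauge k (F n `&` B)))).
    rewrite nneseriesD; try by move=> n _ _; exact: hausdorff_gauge_ge0.
    apply: leeD; apply: hausdorff_delta_le_cover; split=> [x Ax|n x y].
    - by have [n _ Fx] : (\bigcup_n F n) x by [apply: ABF; left|]; exists n.
    - by move=> [Fx _] [Fy _]; exact: dF Fx Fy.
    - by have [n _ Fx] : (\bigcup_n F n) x by [apply: ABF; right|]; exists n.
    - by move=> [Fx _] [Fy _]; exact: dF Fx Fy.
  apply: lee_nneseries => n _.
    by move=> _; rewrite adde_ge0// hausdorff_gauge_ge0.
  have [[x [Fx Ax]]|/set0P/negP/negPn/eqP->] := pselect (F n `&` A !=set0);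
    last by rewrite hausdorff_gauge0 add0e subset_hausdorff_gauge// => x [].
  have [[y [Fy By]]|/set0P/negP/negPn/eqP->] := pselect (F n `&` B !=set0);
    last by rewrite hausdorff_gauge0 adde0 subset_hausdorff_gauge// => ? [].
  by have := le_trans (AB _ _ Ax By) (dF _ _ _ Fx Fy); rewrite leNgt de.
(* With two independent meshes the suprema over d and d' can be taken one after the other. *)
have step2 d d' : (0 < d)%R -> (0 < d')%R ->
    hausdorff_delta k d A + hausdorff_delta k d' B <= hausdorff k (A `|` B).
  move=> d0 d'0; pose r : R := (Num.min (Num.min d d') (e / 2))%R.
  have r0 : (0 < r)%R by rewrite !lt_min d0 d'0 divr_gt0.
  apply: le_trans (step _ r0 _); last first.
    by rewrite !gt_min; apply/orP; right; lra.
  by apply: leeD; apply: le_hausdorff_delta; rewrite !ge_min lexx// orbT.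
have [->|] := eqVneq (hausdorff k (A `|` B)) +oo; first exact: leey.
rewrite -ltey => fin.
have fA d : (0 < d)%R -> hausdorff_delta k d A \is a fin_num.
  move=> d0; rewrite ge0_fin_numE ?hausdorff_delta_ge0// (le_lt_trans _ fin)//.
  apply: le_trans (step2 _ _ d0 d0); rewrite leeDl// hausdorff_delta_ge0//.
have fB : hausdorff k B \is a fin_num.
  rewrite ge0_fin_numE ?hausdorff_ge0// (le_lt_trans _ fin)//.
  by apply: le_hausdorff => x; right.
rewrite -leeBrDr//; apply: hausdorff_le => d d0; rewrite leeBrDr// addeC.
rewrite -leeBrDr ?fA//; apply: hausdorff_le => d' d'0; rewrite leeBrDr ?fA//.
by rewrite addeC step2.
Qed.

(** Caratheodory's argument. The shell P n.+1 is separated from T n, so adding it to the bound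
    [sumP] replaces T n by T n.+2. Hence the shells have a finite total measure, and the tails,
    which cover what T N misses, tend to 0. *)
Lemma hausdorff_separated_exhaustion m k (T : nat -> set 'rV[R]_m)
    (e : nat -> R) c :
  (forall n, T n `<=` T n.+1) -> (forall n, (0 < e n)%R) ->
  (forall n x y, T n x -> (\bigcup_n T n `\` T n.+1) y ->
     (e n <= enorm (x - y))%R) ->
  hausdorff k (\bigcup_n T n) < +oo -> (forall n, hausdorff k (T n) <= c) ->
  hausdorff k (\bigcup_n T n) <= c.
Proof.
set U := \bigcup_n T n => TS e0 sepT Ufin Tc.
pose P n := T n.+1 `\` T n.
have TU n : hausdorff k (T n) <= hausdorff k U.
  by apply: le_hausdorff => x Tx; exists n.
have sumP N : \sum_(0 <= n < N) hausdorff k (P n) <=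
    hausdorff k (T N) + hausdorff k (T N.-1).
  elim: N => [|N IH]; first by rewrite big_geq// adde_ge0// hausdorff_ge0.
  rewrite big_nat_recr//=; case: N IH => [_|N IH].
    rewrite big_geq// add0e; apply: lee_paddr; first exact: hausdorff_ge0.
    by apply: le_hausdorff => x [].
  apply: (le_trans (leeD IH (lexx _))); rewrite [leRHS]addeC -addeA.
  apply: leeD => //; apply: le_trans (hausdorffU_separated k (e0 N) _) _.
    by move=> x y Tx [Ty nTy]; apply: (sepT N) => //; split=> //; exists N.+2.
  by apply: le_hausdorff => x [/TS/TS|[]].
have Pfin : \sum_(0 <= n <oo) hausdorff k (P n) < +oo.
  apply: (@le_lt_trans _ _ (hausdorff k U + hausdorff k U)); last first.
    by rewrite lte_add_pinfty.
  apply: lime_le; first by apply: is_cvg_nneseries => n _ _; exact: hausdorff_ge0.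
  by near=> N; rewrite (le_trans (sumP N))// leeD.
have UT N : hausdorff k U <= c + \sum_(N <= n <oo) hausdorff k (P n).
  apply: (@le_trans _ _ (hausdorff k (T N `|` \bigcup_n P (n + N)%N))).
    apply: le_hausdorff => x [n _ Tx].
    (* The first index M that catches x puts it either into T N or into the shell P M.-1. *)
    have [M [TM minM]] : exists M, T M x /\ forall j, (j < M)%N -> ~ T j x.
      have ex : exists n, `[< T n x >] by exists n; apply/asboolP.
      exists (ex_minn ex); case: ex_minnP => M /asboolP TM minM; split=> // j jM.
      by move/asboolP/minM; rewrite leqNgt jM.
    have [MN|NM] := leqP M N.
      left; elim: N MN {minM} => [|N IH]; first by rewrite leqn0 => /eqP <-.
      by rewrite leq_eqVlt => /predU1P[<-//|/IH/TS].
    right; exists (M.-1 - N)%N => //; rewrite subnK; last first.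
      by rewrite -ltnS prednK// (leq_ltn_trans _ NM).
    have M0 : (0 < M)%N by exact: leq_ltn_trans NM.
    by split; [rewrite prednK|apply: minM; rewrite prednK].
  apply: (le_trans (hausdorffU_le _ _ _)).
  apply: leeD => //; rewrite -(@nneseries_addn _ (fun n => hausdorff k (P n))).
    exact: hausdorff_sigma_subadditive.
  by move=> *; exact: hausdorff_ge0.
have : c + \sum_(N <= n <oo) hausdorff k (P n) @[N --> \oo] --> c + 0.
  apply: cvgeD; last 2 first.
  - exact: cvg_cst.
  - by apply: nneseries_tail_cvg => // n _; exact: hausdorff_ge0.
  by rewrite fin_num_adde_defl.
rewrite adde0 => cvgc; rewrite -(cvg_lim _ cvgc)//.
apply: lime_ge; first by apply/cvg_ex; exists c.
by near=> N; exact: UT.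
Unshelve. all: by end_near. Qed.

(** The part of T off C is exhausted by the sets S n of points farther than 1 / (n + 1) from C.
    Points outside S n.+1 lie within 1 / (n + 2) of C, which gives the separation 1 / (n + 1) - 1 /
    (n + 2). *)
Lemma hausdorff_separatedC_exhaustion m k (C T : set 'rV[R]_m) : closed C ->
  hausdorff k T < +oo ->
  hausdorff k (T `&` C) + hausdorff k (T `&` ~` C) <= hausdorff k T.
Proof.
move=> cC Tfin.
pose S n := [set x | T x /\ forall y, C y -> (n.+1%:R^-1 < enorm (x - y))%R].
have US : T `&` ~` C = \bigcup_n S n.
  apply/seteqP; split=> [x [Tx nCx]|x [n _ [Tx Sx]]].
    have [e [e0 eC]] : exists e : R,
        (0 < e)%R /\ forall y, C y -> (e <= enorm (x - y))%R.
      apply: contrapT => H; apply: nCx; apply: (closed_enormP _).1 cC _ _ => e e0.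
      apply: contrapT => H'; apply: H; exists e; split=> // y Cy.
      by rewrite leNgt; apply/negP => yx; apply: H'; exists y => //; rewrite enormB.
    have [n _ /(_ n (leqnn n)) /= ne] := @near_infty_natSinv_lt R (PosNum e0).
    by exists n => //; split=> // y /eC; apply: lt_le_trans; apply: ne => /=.
  split=> // Cx; have := Sx _ Cx; rewrite subrr enorm0 ltNge => /negP; apply.
  by rewrite invr_ge0.
have fC : hausdorff k (T `&` C) \is a fin_num.
  rewrite ge0_fin_numE ?hausdorff_ge0// (le_lt_trans _ Tfin)//.
  by apply: le_hausdorff => x [].
rewrite addeC -leeBrDr// US.
apply: (@hausdorff_separated_exhaustion _ _ _
  (fun n => (n.+1%:R^-1 - n.+2%:R^-1)%R)).
- move=> n x [Tx Sx]; split=> // y /Sx; apply: le_lt_trans.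
  by rewrite lef_pV2 ?posrE// ler_nat.
- by move=> n; rewrite subr_gt0 ltf_pV2 ?posrE// ltr_nat.
- move=> n x y [Tx Sx] [Uy]; move: Uy; rewrite -US => -[Ty _] nSy.
  have [z Cz yz] : exists2 z, C z & (enorm (y - z) <= n.+2%:R^-1)%R.
    apply: contrapT => H; apply: nSy; split=> // z Cz.
    by rewrite ltNge; apply/negP => yz; apply: H; exists z.
  rewrite lerBlDr (le_trans (ltW (Sx _ Cz)))//.
  by rewrite (le_trans (enorm_triangle y x z))// lerD2l.
- by rewrite -US (le_lt_trans _ Tfin)//; apply: le_hausdorff => x [].
move=> n; rewrite leeBrDr// addeC.
have n0 : (0 < n.+1%:R^-1 :> R)%R by rewrite invr_gt0.
apply: le_trans (hausdorffU_separated k n0 _) _.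
  by move=> x y [_ Cx] [_ Sy]; rewrite enormB ltW// Sy.
by apply: le_hausdorff => x [[]|[]].
Qed.

Lemma closed_hausdorff_measurable m k (C : set 'rV[R]_m) : closed C ->
  (hausdorff k : set 'rV[R]_m -> \bar R).-cara.-measurable C.
Proof.
move=> cC; apply: le_caratheodory_measurable => X /=.
have [->|] := eqVneq (hausdorff k X) +oo; first exact: leey.
by rewrite -ltey; exact: hausdorff_separatedC_exhaustion.
Qed.

Lemma hausdorff_null_measurable m k (N : set 'rV[R]_m) : hausdorff k N = 0 ->
  (hausdorff k : set 'rV[R]_m -> \bar R).-cara.-measurable N.
Proof.
move=> N0; apply: le_caratheodory_measurable => X /=.
rewrite (_ : hausdorff k (X `&` N) = 0) ?add0e; last first.
  by apply/eqP; rewrite eq_le hausdorff_ge0 andbT -N0; apply: le_hausdorff => x [].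
by apply: le_hausdorff => x [].
Qed.

Lemma closure_le_sym_continuous m (A : set 'rV[R]_m)
    (f : 'rV[R]_m -> 'rV[R]_m -> R) (c : R) :
  (forall x y, f x y = f y x) -> (forall y, continuous (f^~ y)) ->
  (forall x y, A x -> A y -> (f x y <= c)%R) ->
  forall x y, closure A x -> closure A y -> (f x y <= c)%R.
Proof.
move=> fC cf fA.
have cl (B : set 'rV[R]_m) y : (forall x, B x -> (f x y <= c)%R) ->
    forall x, closure B x -> (f x y <= c)%R.
  move=> /(@closureS _ B [set x | (f x y <= c)%R]) + x Bx => /(_ x Bx).
  by rewrite -(closure_id _).1//; exact: closed_le_continuous.
move=> x y Ax Ay; apply: (cl A) => // z Az; rewrite fC.
by apply: (cl A) => // w Aw; exact: fA.
Qed.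

Lemma enormB_continuous m (y : 'rV[R]_m) : continuous (fun x : 'rV[R]_m => enorm (x - y)).
Proof.
apply: (@lipschitz_continuous _ _ _ 1) => x z; rewrite mul1r ler_norml.
have := enorm_triangle z x y; have := enorm_triangle x z y.
by rewrite (enormB z x); lra.
Qed.

Lemma diam_le_closure m (A : set 'rV[R]_m) (r : R) :
  diam_le r A -> diam_le r (closure A).
Proof.
move=> Ar; apply: closure_le_sym_continuous => //; first by move=> *; rewrite enormB.
exact: enormB_continuous.
Qed.

Lemma hausdorff_gauge_closure m k (A : set 'rV[R]_m) :
  hausdorff_gauge k (closure A) <= hausdorff_gauge k A.
Proof.
have [->|Afin] := eqVneq (hausdorff_gauge k A) +oo; first exact: leey.
have {}Afin : hausdorff_gauge k A \is a fin_num.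
  by rewrite ge0_fin_numE ?hausdorff_gauge_ge0// ltey.
apply: hausdorff_gauge_le; first exact: hausdorff_gauge_ge0.
move=> x y Ax Ay; rewrite -[leRHS]fineK// lee_fin; move: x y Ax Ay.
apply: closure_le_sym_continuous.
- by move=> x y; rewrite enormB.
- move=> y x; apply: (@continuous_comp _ _ _ (fun x : 'rV[R]_m => enorm (x - y))
    (fun t : R => ball_volume R k * (t / 2) ^+ k)%R).
    exact: enormB_continuous.
  apply: (@continuousM R R _ (fun t : R => (t / 2) ^+ k)%R); first exact: cvg_cst.
  apply: (@continuous_comp _ _ _ (fun t : R => t / 2)%R (fun t : R => t ^+ k)%R);
    last exact: exprn_continuous.
  by apply: continuousM; [exact: cvg_id|exact: cvg_cst].
- by move=> x y Ax Ay; rewrite -lee_fin fineK// le_hausdorff_gauge_points.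
Qed.

(** Closure changes neither the mesh nor the gauge bound, so nearly optimal covers may be taken
    closed. Using mesh and error 1 / (i + 1) at stage i, the intersection over i costs nothing in
    the limit. *)
Lemma hausdorff_closed_hull m k (A : set 'rV[R]_m) : hausdorff k A < +oo ->
  exists C : nat -> nat -> set 'rV[R]_m,
    [/\ forall i j, closed (C i j), A `<=` \bigcap_i \bigcup_j C i j &
       hausdorff k (\bigcap_i \bigcup_j C i j) <= hausdorff k A].
Proof.
move=> Afin.
have fA (d : R) : (0 < d)%R -> hausdorff_delta k d A \is a fin_num.
  move=> d0; rewrite ge0_fin_numE ?hausdorff_delta_ge0//.
  exact: le_lt_trans (hausdorff_delta_le _ _ d0) Afin.
have /choice[F FP] (i : nat) : exists F, fine_cover i.+1%:R^-1 A F /\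
    \sum_(n <oo) hausdorff_gauge k (F n) <= hausdorff k A + i.+1%:R^-1%:E.
  have i0 : (0 < i.+1%:R^-1 :> R)%R by rewrite invr_gt0.
  have [_ [F AF <-] HF] := lb_ereal_inf_adherent i0 (fA _ i0).
  exists F; split=> //; rewrite (le_trans (ltW HF))// leeD2r//.
  exact: hausdorff_delta_le.
exists (fun i j => closure (F i j)); split=> [i j|x Ax i _|].
- exact: closed_closure.
- have [[/(_ x Ax)[j _ Fx] _] _] := FP i; exists j => //.
  exact: subset_closure.
apply: hausdorff_le => d d0; apply/lee_addgt0Pr => e e0.
have me0 : (0 < Num.min d e)%R by rewrite lt_min d0.
have [i _ /(_ i (leqnn i))] := @near_infty_natSinv_lt R (PosNum me0).
rewrite /= lt_min => /andP[id ie].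
have [[AF dF] sF] := FP i.
apply: (@le_trans _ _ (\sum_(n <oo) hausdorff_gauge k (closure (F i n)))).
  apply: hausdorff_delta_le_cover; split; first by move=> x; exact.
  move=> n; apply: diam_le_closure => x y Fx Fy.
  by rewrite (le_trans (dF n _ _ Fx Fy))// ltW.
apply: (@le_trans _ _ (\sum_(n <oo) hausdorff_gauge k (F i n))).
  apply: lee_nneseries => n _; first by move=> _; exact: hausdorff_gauge_ge0.
  exact: hausdorff_gauge_closure.
by rewrite (le_trans sF)// leeD2l// lee_fin ltW.
Qed.

End HausdorffMetric.

(** * Integrals under bi-Lipschitz maps *)

Definition lipschitz_on (R : realType) (m m' : nat) (L : R) (A : set 'rV[R]_m)
    (phi : 'rV[R]_m -> 'rV[R]_m') :=
  forall x y, A x -> A y -> enorm (phi x - phi y) <= L * enorm (x - y).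

Section LipschitzTransport.
Context {R : realType} {m m' k : nat}.
Variables (X : set 'rV[R]_m) (Y : set 'rV[R]_m') (L L' : R).
Variables (phi : 'rV[R]_m' -> 'rV[R]_m) (psi : 'rV[R]_m -> 'rV[R]_m').
Hypotheses (cY : closed Y) (L0 : 0 < L) (L'0 : 0 < L').
Hypotheses (phiY : forall y, Y y -> X (phi y)).
Hypotheses (phiK : forall y, Y y -> psi (phi y) = y).
Hypotheses (phiL : lipschitz_on L Y phi) (psiL : lipschitz_on L' X psi).
Hypothesis (Xfin : (hausdorff k X < +oo)%E).

Lemma closed_lipschitz_preimage (C : set 'rV[R]_m) : closed C ->
  closed (Y `&` phi @^-1` C).
Proof.
move=> cC; apply: (closed_enormP _).2 => x H; have Yx : Y x.
  by apply: (closed_enormP _).1 cY _ _ => e /H[y [Yy _] yx]; exists y.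
split=> //=; apply: (closed_enormP _).1 cC _ _ => e e0.
have [y [Yy Cy] yx] := H _ (divr_gt0 e0 L0); exists (phi y) => //.
by rewrite (le_lt_trans (phiL Yy Yx))// mulrC -ltr_pdivlMr.
Qed.

(** As A is measurable of finite measure, its closed hull B exceeds it by a null set. Preimages in Y
    of closed sets are closed; the preimage of the null set is its image under the Lipschitz map
    psi, hence null. *)
Lemma hausdorff_measurable_preimage (A : set 'rV[R]_m) :
  (hausdorff k : set 'rV[R]_m -> \bar R).-cara.-measurable A -> A `<=` X ->
  (hausdorff k : set 'rV[R]_m' -> \bar R).-cara.-measurable (Y `&` phi @^-1` A).
Proof.
move=> mA AX; have Afin : (hausdorff k A < +oo)%E.
  by apply: le_lt_trans Xfin; exact: le_hausdorff.
have [C [cC AC HC]] := hausdorff_closed_hull Afin.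
set B := \bigcap_i \bigcup_j C i j in AC HC.
have N0 : hausdorff k (B `&` ~` A) = 0%E.
  have fA : hausdorff k A \is a fin_num by rewrite ge0_fin_numE// hausdorff_ge0.
  have mAB : hausdorff k B = (hausdorff k A + hausdorff k (B `&` ~` A))%E.
    by have := mA B; rewrite (setIidr AC).
  apply/eqP; rewrite eq_le hausdorff_ge0 andbT.
  by move: HC; rewrite mAB -[leRHS]adde0 leeD2lE.
rewrite (_ : Y `&` _ = (\bigcap_i \bigcup_j (Y `&` phi @^-1` (C i j))) `\`
    (Y `&` phi @^-1` (B `&` ~` A))); last first.
  apply/seteqP; split=> [y [Yy Ay]|y [Cy nBy]].
    split=> [i _|[_ [_]]]//; have [j _ Cj] := AC _ Ay i I; by exists j.
  have [_ _ [Yy _]] := Cy 0%N I.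
  split=> //=; apply: contrapT => nAy; apply: nBy; split=> //=; split=> // i _.
  by have [j _ [_ Cj]] := Cy i I; exists j.
apply: measurableD.
  apply: bigcap_measurable => // i _; apply: bigcup_measurable => j _.
  by apply: closed_hausdorff_measurable; exact: closed_lipschitz_preimage.
apply: hausdorff_null_measurable; apply/eqP; rewrite eq_le hausdorff_ge0 andbT.
apply: (@le_trans _ _ ((L' ^+ k)%:E * hausdorff k ((B `&` ~` A) `&` X))%E).
  apply: (hausdorff_lipschitz k L'0 (phi := psi)).
    by move=> y [Yy By]; exists (phi y); [split=> //; exact: phiY|exact: phiK].
  by move=> x y [_ Xx] [_ Xy]; exact: psiL.
rewrite (_ : hausdorff k _ = 0%E) ?mule0//.
apply/eqP; rewrite eq_le hausdorff_ge0 andbT -N0.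
by apply: le_hausdorff => x [].
Qed.

End LipschitzTransport.

Import HBNNSimple.

(** Yields the integral from the weighted sets themselves, overlapping or not, without computing the
    range of h. *)
Lemma exists_nnsfun_sum d (T : measurableType d) (R : realType)
    (mu : {measure set T -> \bar R}) (I : Type) (s : seq I) (w : I -> R)
    (A : I -> set T) :
  (forall i, 0 <= w i) -> (forall i, measurable (A i)) ->
  exists h : {nnsfun T >-> R},
    (forall x, h x = \sum_(i <- s) w i * \1_(A i) x) /\
    (sintegral mu h = \sum_(i <- s) (w i)%:E * mu (A i))%E.
Proof.
move=> w0 mA; elim: s => [|i s [h [hE sE]]].
  by exists nnsfun0; split=> [x|]; rewrite big_nil// sintegral0.
exists (add_nnsfun (scale_nnsfun (indic_nnsfun R (mA i)) (w0 i)) h).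
split=> [x|]; first by rewrite big_cons -hE.
rewrite big_cons -sE sintegralD; congr (_ + _)%E.
by rewrite sintegralrM/= sintegral_indic.
Qed.

Section LipschitzIntegral.
Context {R : realType} {m m' k : nat}.
Variables (X : set 'rV[R]_m) (Y : set 'rV[R]_m') (L L' : R).
Variables (phi : 'rV[R]_m' -> 'rV[R]_m) (psi : 'rV[R]_m -> 'rV[R]_m').
Hypotheses (cX : closed X) (cY : closed Y) (L0 : 0 < L) (L'0 : 0 < L').
Hypotheses (phiY : forall y, Y y -> X (phi y)) (psiX : forall x, X x -> Y (psi x)).
Hypotheses (phiK : forall y, Y y -> psi (phi y) = y).
Hypotheses (psiK : forall x, X x -> phi (psi x) = x).
Hypotheses (phiL : lipschitz_on L Y phi) (psiL : lipschitz_on L' X psi).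
Hypothesis (Xfin : (hausdorff k X < +oo)%E).

(** A simple function h below f is transported level by level: on the preimage of its level r
    outside N the value r / c is put, which stays below g, while the measure of the level set is at
    most L ^+ k times that of its preimage. *)
Lemma le_integral_lipschitz (f : 'rV[R]_m -> R) (g : 'rV[R]_m' -> R) (c : R)
    (N : set 'rV[R]_m) : 0 < c -> (forall x, 0 <= f x) -> (forall y, 0 <= g y) ->
  hausdorff k N = 0%E ->
  (forall y, Y y -> ~ N (phi y) -> f (phi y) <= c * g y) ->
  (\int[hausdorff_measure m k]_(x in X) (f x)%:E <=
   (L ^+ k * c)%:E * \int[hausdorff_measure m' k]_(y in Y) (g y)%:E)%E.
Proof.
move=> c0 f0 g0 N0 fg.
have Lk : 0 < L ^+ k by rewrite exprn_gt0.
rewrite !ge0_integralE; try by move=> *; rewrite lee_fin.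
apply: ge_ereal_sup => _ [h /= hf <-].
have mXN : (hausdorff k : set 'rV[R]_m -> \bar R).-cara.-measurable (X `\` N).
  apply: measurableD; first exact: closed_hausdorff_measurable.
  exact: hausdorff_null_measurable.
pose A r := Y `&` phi @^-1` (h @^-1` [set r] `&` (X `\` N)).
have mA r : (hausdorff k : set 'rV[R]_m' -> \bar R).-cara.-measurable (A r).
  apply: (hausdorff_measurable_preimage cY L0 L'0 phiY phiK phiL psiL Xfin).
    by apply: measurableI => //; exact: measurable_funPTI.
  by move=> x [_ []].
(* The maximum only makes the weight nonnegative for every real r; on the levels of h it is r
   itself. *)
pose w (r : R) : R := Num.max r 0 / c.
have w0 (r : R) : 0 <= w r by rewrite divr_ge0 ?le_max ?lexx ?orbT// ltW.
have [h' [h'E sE]] := @exists_nnsfun_sum _ _ _ (hausdorff_measure m' k) R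
  (enum_fset (fset_set (range h))) w A w0 mA.
apply: (@le_trans _ _
    ((L ^+ k * c)%:E * sintegral (hausdorff_measure m' k) h')%E); last first.
  apply: lee_wpmul2l; first by rewrite lee_fin mulr_ge0// ltW.
  apply: ereal_sup_ubound; exists h' => // y.
  rewrite h'E patchE.
  have [Ay|nAy] := pselect (exists r, A r y); last first.
    rewrite big1; first by case: ifP => // _; rewrite lee_fin.
    move=> r _; rewrite indicE memNset ?mulr0// => Ar; by apply: nAy; exists r.
  case: Ay => r [Yy [/= hr [Xy Ny]]]; rewrite mem_set//.
  have hin : h (phi y) \in fset_set (range h) by rewrite in_fset_set// inE; exists (phi y).
  rewrite (big_fsetD1 _ hin)/= big1_fset ?addr0; last first.
    move=> s; rewrite !inE => /andP[sr _] _; rewrite indicE memNset ?mulr0//.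
    by move=> [_ [/= hs _]]; rewrite hs eqxx in sr.
  rewrite indicE mem_set ?mulr1; last by split=> //=; split.
  rewrite /w (max_idPl _) ?fun_ge0// lee_fin ler_pdivrMr// mulrC.
  have := hf (phi y); rewrite patchE mem_set// lee_fin => /le_trans; apply.
  exact: fg.
rewrite sE [leLHS](sintegralE (hausdorff_measure m k) h) fsbig_finite//= ge0_sume_distrr; last first.
  by move=> r _; apply: mule_ge0; [rewrite lee_fin|exact: hausdorff_ge0].
rewrite big_seq [leRHS]big_seq; apply: lee_sum => r.
rewrite in_fset_set// inE => -[x0 _ hx0].
have r0 : 0 <= r by rewrite -hx0 fun_ge0.
rewrite /w (max_idPl _)// muleA -EFinM.
have -> : L ^+ k * c * (r / c) = r * L ^+ k
  by rewrite -mulrA (mulrC c) divfK ?gt_eqF// mulrC.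
rewrite EFinM -muleA.
(* Level 0 contributes nothing and is the only one that can leave X, since f is extended by 0
   outside X. *)
have [->|rn0] := eqVneq r 0; first by rewrite !mul0e.
apply: lee_wpmul2l; first by rewrite lee_fin.
have hrX x : h x = r -> X x.
  move=> hr; have := hf x; rewrite patchE; case: ifPn => [/set_mem//|_].
  by rewrite lee_fin hr => r0'; move: rn0; rewrite eq_le r0 r0'.
apply: (@le_trans _ _ (hausdorff k N + hausdorff k (h @^-1` [set r] `\` N))%E).
  apply: le_trans (hausdorffU_le _ _ _); apply: le_hausdorff => x hx.
  by have [Nx|Nx] := pselect (N x); [left|right; split].
rewrite N0 add0e; apply: (hausdorff_lipschitz k L0 (phi := phi)).
  move=> x [/= hx Nx]; have Xx := hrX x hx; exists (psi x); last exact: psiK.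
  by split; [exact: psiX|rewrite /= psiK].
by move=> x y [Yx _] [Yy _]; exact: phiL.
Qed.

End LipschitzIntegral.

(** * Boundaries of convex bodies *)

Section BoxCover.
Context {R : realType}.

Lemma exists_cell (N : nat) (w a : R) : (0 < N)%N -> 0 < w -> 0 <= a <= N%:R * w ->
  exists c : 'I_N, c%:R * w <= a <= c.+1%:R * w.
Proof.
move=> N0 w0 /andP[a0 aN]; have aw : 0 <= a / w by rewrite divr_ge0// ltW.
have /andP[l u] := truncn_itv aw.
have [tN|Nt] := ltnP (Num.truncn (a / w)) N.
  exists (Ordinal tN) => /=; rewrite -ler_pdivlMr// l/= -ler_pdivrMr//.
  exact: ltW.
have tN : (N.-1 < N)%N by rewrite prednK.
exists (Ordinal tN) => /=; rewrite prednK// aN andbT -ler_pdivlMr//.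
by apply: le_trans l; rewrite ler_nat (leq_trans _ Nt)// leq_pred.
Qed.

Variables (d m k : nat) (A : set 'rV[R]_m) (J : {set 'I_d}) (M : R) (q : 'I_d -> R).
Variable y : 'rV[R]_m -> 'rV[R]_d.
Hypotheses (M0 : 0 < M) (yM : forall x i, A x -> `|y x 0 i| <= M).
Hypothesis yq : forall x i, A x -> i \in J -> y x 0 i = q i.
Hypothesis yA : forall x x', A x -> A x' -> enorm (x - x') <= enorm (y x - y x').

Let e := #|[pred i | i \notin J]|.
Let D := Num.sqrt d%:R * (2 * M).

(** Cutting each of the e free coordinates of [-M, M] into n intervals gives n ^ e cells, each of
    diameter at most sqrt d * w = D / n; [yA] carries this diameter bound over to A. *)
Lemma hausdorff_delta_box n : (0 < n)%N ->
  (hausdorff_delta k (D / n%:R) A <=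
   ((n ^ e)%:R * (ball_volume R k * (D / n%:R / 2) ^+ k))%:E)%E.
Proof.
move=> n0; have n0' : 0 < n%:R :> R by rewrite ltr0n.
pose w := 2 * M / n%:R; have w0 : 0 < w by rewrite divr_gt0// mulr_gt0.
have -> : D / n%:R = Num.sqrt d%:R * w by rewrite /D /w !mulrA.
pose T := {ffun {i | i \notin J} -> 'I_n}.
have -> : (n ^ e)%N = #|T| by rewrite card_ffun card_ord card_sig.
pose F (c : T) := [set x | A x /\ forall s,
  (c s)%:R * w <= y x 0 (val s) + M <= (c s).+1%:R * w].
apply: (@hausdorff_delta_fin_cover _ _ _ _ _ _ T F).
- by rewrite lexx mulr_ge0// ltW.
- move=> x Ax; have H (s : {i | i \notin J}) : exists c : 'I_n,
      c%:R * w <= y x 0 (val s) + M <= c.+1%:R * w.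
    apply: exists_cell => //; have := yM (val s) Ax.
    rewrite ler_norml -subr_ge0 opprK => /andP[-> /=].
    by rewrite /w mulrCA divff ?gt_eqF// mulr1 => yM'; lra.
  have {H}[c cP] := choice H.
  exists (finfun c) => //; split=> // s; rewrite ffunE; exact: cP.
- move=> c x x' [Ax Fx] [Ax' Fx']; rewrite (le_trans (yA Ax Ax'))//.
  apply: enorm_le_const; first exact: ltW.
  move=> i; rewrite !mxE; have [iJ|iJ] := boolP (i \in J).
    by rewrite !(yq _ iJ)// subrr normr0 ltW.
  have /andP[a b] := Fx (Sub i iJ); have /andP[a' b'] := Fx' (Sub i iJ).
  rewrite /= in a b a' b'; rewrite ler_norml.
  by move: a b a' b'; rewrite -[(c _).+1]addn1 natrD !mulrDl mul1r; lra.
Qed.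

Let box_bound n : (0 < n)%N ->
  (hausdorff_delta k (D / n%:R) A <=
   (ball_volume R k * (D / 2) ^+ k * ((n ^ e)%:R / n%:R ^+ k))%:E)%E.
Proof.
move=> n0; apply: (le_trans (hausdorff_delta_box n0)); rewrite lee_fin.
rewrite [D / n%:R / 2]mulrAC exprMn exprVn le_eqVlt; apply/orP; left.
by apply/eqP; ring.
Qed.

Let D0 : 0 <= D. Proof. by rewrite !mulr_ge0// ltW. Qed.

Let small_mesh (r : R) n : 0 < r -> exists2 N, (n < N)%N & D / N%:R <= r.
Proof.
move=> r0; have Dr : 0 < r / (D + 1) by rewrite divr_gt0// ltr_wpDl.
have [N _ HN] := @near_infty_natSinv_lt R (PosNum Dr).
exists (maxn N n).+1; first by rewrite ltnS leq_maxr.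
have := HN (maxn N n) (leq_maxl _ _); rewrite /= => H.
apply: (@le_trans _ _ (D * (r / (D + 1)))); first by rewrite ler_wpM2l// ltW.
by rewrite mulrCA ger_pMr// ler_pdivrMr ?ltr_wpDl// mul1r lerDl.
Qed.

Lemma hausdorff_box_lty : (e <= k)%N -> (hausdorff k A < +oo)%E.
Proof.
move=> ek; apply: (@le_lt_trans _ _ (ball_volume R k * (D / 2) ^+ k)%:E);
  last exact: ltry.
apply: hausdorff_le => r r0; have [N N0 Nr] := small_mesh 0 r0.
apply: (le_trans (le_hausdorff_delta _ _ Nr)); apply: (le_trans (box_bound N0)).
rewrite lee_fin ler_piMr ?mulr_ge0 ?ball_volume_ge0 ?exprn_ge0 ?divr_ge0//.
by rewrite ler_pdivrMr ?exprn_gt0 ?ltr0n// mul1r -natrX ler_nat leq_pexp2l.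
Qed.

(** There are n ^ e cells of gauge proportional to n ^ (- k), so their total gauge is at most a
    constant times 1 / n. *)
Lemma hausdorff_box_eq0 : (e < k)%N -> hausdorff k A = 0%E.
Proof.
move=> ek; apply/eqP; rewrite eq_le hausdorff_ge0 andbT.
apply: hausdorff_le => r r0; apply/lee_addgt0Pr => eps eps0; rewrite add0e.
pose c := ball_volume R k * (D / 2) ^+ k.
have c0 : 0 <= c by rewrite mulr_ge0 ?ball_volume_ge0 ?exprn_ge0 ?divr_ge0.
have [N N1 Nr] := small_mesh (Num.truncn (c / eps)) r0.
have N0 : (0 < N)%N by exact: leq_ltn_trans N1.
apply: (le_trans (le_hausdorff_delta _ _ Nr)); apply: (le_trans (box_bound N0)).
rewrite lee_fin -/c; have N0' : 0 < N%:R :> R by rewrite ltr0n.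
apply: (@le_trans _ _ (c * N%:R^-1)).
  rewrite ler_wpM2l// ler_pdivrMr ?exprn_gt0// mulrC ler_pdivlMr//.
  by rewrite -natrX -natrM ler_nat -expnSr leq_pexp2l.
rewrite ler_pdivrMr// mulrC -ler_pdivrMr//.
have /andP[_ u] := truncn_itv (divr_ge0 c0 (ltW eps0)).
by rewrite (le_trans (ltW u))// ler_nat.
Qed.

End BoxCover.

Section SupportingNormal.
Context {R : realType} {d : nat}.
Implicit Types (K : set 'rV[R]_d) (x y z n : 'rV[R]_d).

Lemma convex_setP K x y (t : R) : convex_set K -> K x -> K y -> 0 <= t <= 1 ->
  K (t *: x + (1 - t) *: y).
Proof.
move=> cK Kx Ky /andP[t0 t1].
have := cK x y (Itv01 t0 t1); rewrite !inE => /(_ Kx Ky).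
by [].
Qed.

Lemma exists_nearest K y : compact K -> K !=set0 ->
  exists2 x, K x & forall z, K z -> enorm (x - y) <= enorm (z - y).
Proof.
move=> cK K0; have ce : {within K, continuous (fun z => enorm (z - y))}.
  exact/continuous_subspaceT/enormB_continuous.
have [x Kx H] := EVT_min_rV K0 cK ce; exists x; first by rewrite inE in Kx.
by move=> z Kz; apply: H; rewrite inE.
Qed.

Lemma nearest_obtuse K y x z : convex_set K -> K x -> K z ->
  (forall z, K z -> enorm (x - y) <= enorm (z - y)) -> dot (z - x) (y - x) <= 0.
Proof.
move=> cK Kx Kz H; rewrite leNgt; apply/negP => a0.
set a := dot _ _ in a0; pose b := dot (z - x) (z - x).
have b0 : 0 < b.
  rewrite lt_def dot_ge0 andbT dot_eq0; apply: contraTneq a0 => zx.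
  by rewrite /a zx dot0l ltxx.
(* Moving x by t towards z changes the squared distance by - 2 t a + t^2 b, which is negative
   because t b <= a. *)
pose t := Num.min 1 (a / b).
have t0 : 0 < t by rewrite lt_min ltr01 divr_gt0.
have tb : t * b <= a by rewrite -ler_pdivlMr// ge_min lexx orbT.
have Kt : K (t *: z + (1 - t) *: x).
  by apply: convex_setP => //; rewrite ltW//= ge_min lexx.
have := H _ Kt; rewrite -(@ler_pXn2r _ 2) ?nnegrE ?enorm_ge0// !sqr_enorm.
have -> : t *: z + (1 - t) *: x - y = (x - y) + t *: (z - x).
  by rewrite scalerBl scale1r scalerBr; apply/rowP => i; rewrite !mxE; ring.
have e : dot (x - y) (z - x) = - a.
  by rewrite /a -[X in dot X _]opprB dotNl dotC.
rewrite dot_addZ e -/b => H'.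
have : 0 < t * (2 * a - t * b) by rewrite mulr_gt0//; lra.
lra.
Qed.

Lemma compact_closureE K : compact K -> closure K = K.
Proof.
move=> cK; apply/esym/closure_id; exact: compact_closed.
Qed.

(** Exterior points y tend to x. The direction from the nearest point of K to y is a normal at x up
    to an error 2 |y - x|, and a cluster point of such directions on the compact unit sphere is a
    normal. *)
Lemma exists_normalE K x : compact K -> convex_set K -> bdE K x ->
  exists n, is_normalE K x n.
Proof.
move=> cK vK [_ Kx xK].
move: Kx; rewrite compact_closureE// => Kx.
have approx (e : R) : 0 < e -> exists n, dot n n = 1 /\
    forall y, K y -> dot (y - x) n <= e.
  move=> e0; have e2 : 0 < e / 2 by rewrite divr_gt0.
  have [y [_ nKy] yx] := (closure_enormP _ _).1 xK _ e2.
  have [z Kz zy] := exists_nearest y cK (ex_intro _ x Kx).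
  have zy0 : 0 < enorm (y - z).
    by rewrite enorm_gt0 subr_eq0; apply: contra_not_neq nKy => ->.
  exists ((enorm (y - z))^-1 *: (y - z)); split.
    by rewrite dotZl dotZr -sqr_enorm; field; rewrite gt_eqF.
  move=> w Kw; rewrite dotZr mulrC ler_pdivrMr//.
  have -> : w - x = (w - z) + (z - x) by rewrite addrA subrK.
  rewrite dotDl -[leRHS]add0r; apply: lerD; first exact: (nearest_obtuse vK Kz Kw zy).
  apply: (le_trans (dot_le_enorm _ _)); rewrite ler_wpM2r ?enorm_ge0//.
  have := zy _ Kx; have := enorm_triangle y z x; rewrite (enormB x y).
  have := yx; set u := enorm (z - y); set v := enorm (y - x); set t := enorm (z - x).
  by lra.
have /choice[n nP] (i : nat) : exists n, dot n n = 1 /\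
    forall y, K y -> dot (y - x) n <= i.+1%:R^-1.
  by apply: approx; rewrite invr_gt0.
pose S : set 'rV[R]_d := [set n | dot n n = 1].
have cS : compact S.
  apply: (@closed_bounded_compact _ _ _ 1); last by move=> z /enorm1 ->.
  have -> : S = [set z | enorm z <= 1] `&` [set z | - enorm z <= -1].
    apply/seteqP; split=> z /=; first by move/enorm1 => ->; rewrite !lexx.
    move=> [z1]; rewrite lerN2 => z1'; have z11 : enorm z = 1.
      by apply/eqP; rewrite eq_le z1.
    by rewrite /S/= -sqr_enorm z11 expr1n.
  apply: closedI; apply: closed_le_continuous; first exact: enorm_continuous.
  by move=> z; apply: continuousN; exact: enorm_continuous.
have [|m [Sm clm]] := cS (n @ \oo) _.
  by exists 0%N => // i _; exact: (nP i).1.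
exists m; split=> // y Ky; apply/ler_addgt0Pr => e e0; rewrite add0r.
have cl : closed [set z | dot (y - x) z <= e].
  apply: closed_le_continuous => z.
  have -> : dot (y - x) = dot^~ (y - x) by apply/funext => w; rewrite dotC.
  exact: dot_continuous.
have : closure [set z | dot (y - x) z <= e] m.
  move=> B mB; apply: (clm _ B) => //.
  have [N _ HN] := @near_infty_natSinv_lt R (PosNum e0).
  by exists N => // i Ni; rewrite /= (le_trans ((nP i).2 _ Ky))// ltW// HN.
by rewrite -((closure_id _).1 cl).
Qed.

End SupportingNormal.

Section NormalPoints.
Context {R : realType} {d : nat}.
Implicit Types (K : set 'rV[R]_d) (x y z n : 'rV[R]_d).
Implicit Types (J : {set 'I_d}) (q : 'I_d -> R) (M : R).

(* The points of the box [-M, M]^d in the normal cones of K that lie on the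
   flat fixing the coordinates in J to q have these feet in K; the foot map is
   nonexpansive, so the feet inherit the small measure of the flat. *)
Definition feet K (J : {set 'I_d}) (q : 'I_d -> R) (M : R) : set 'rV[R]_d :=
  [set x | K x /\ exists y, [/\ forall z, K z -> dot (z - x) (y - x) <= 0,
     forall i, i \in J -> y 0 i = q i & forall i, `|y 0 i| <= M]].

(** The two obtuse angle conditions add up to |x - x'|^2 <= (x - x').(y - y'). *)
Lemma foot_nonexpansive K x y x' y' : K x -> K x' ->
  (forall z, K z -> dot (z - x) (y - x) <= 0) ->
  (forall z, K z -> dot (z - x') (y' - x') <= 0) ->
  enorm (x - x') <= enorm (y - y').
Proof.
move=> Kx Kx' /(_ x' Kx') H /(_ x Kx) H'.
have [->|xx] := eqVneq x x'; first by rewrite subrr enorm0 enorm_ge0.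
have xx0 : 0 < enorm (x - x') by rewrite enorm_gt0 subr_eq0.
rewrite -(ler_pM2l xx0); apply: le_trans (dot_le_enorm _ _).
rewrite -expr2 sqr_enorm; move: H H'.
have -> : y - y' = (x - x') + (y - x) - (y' - x').
  by apply/rowP => i; rewrite !mxE; ring.
rewrite (dotBr (x - x' + (y - x))) (dotDr (x - x') (y - x)) -(opprB x x') dotNl.
by lra.
Qed.

Let feet_point K J q M : exists y : 'rV[R]_d -> 'rV[R]_d,
  forall x, feet K J q M x -> [/\ forall z, K z -> dot (z - x) (y x - x) <= 0,
     forall i, i \in J -> y x 0 i = q i & forall i, `|y x 0 i| <= M].
Proof.
have H x : exists y, feet K J q M x ->
    [/\ forall z, K z -> dot (z - x) (y - x) <= 0,
       forall i, i \in J -> y 0 i = q i & forall i, `|y 0 i| <= M].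
  have [[_ [y Hy]]|nx] := pselect (feet K J q M x); first by exists y.
  by exists 0.
by have [y Hy] := choice H; exists y.
Qed.

Lemma hausdorff_feet_lty K J q M k : 0 < M ->
  (#|[pred i | i \notin J]| <= k)%N -> (hausdorff k (feet K J q M) < +oo)%E.
Proof.
move=> M0 Jk; have [y Hy] := feet_point K J q M.
apply: (@hausdorff_box_lty _ d _ _ _ J M q y M0) => //.
- by move=> x i /Hy[_ _].
- by move=> x i /Hy[_ H _]; exact: H.
- move=> x x' Fx Fx'; have [Hx _ _] := Hy _ Fx; have [Hx' _ _] := Hy _ Fx'.
  by apply: foot_nonexpansive Hx Hx'; [case: Fx|case: Fx'].
Qed.

Lemma hausdorff_feet_eq0 K J q M k : 0 < M ->
  (#|[pred i | i \notin J]| < k)%N -> hausdorff k (feet K J q M) = 0%E.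
Proof.
move=> M0 Jk; have [y Hy] := feet_point K J q M.
apply: (@hausdorff_box_eq0 _ d _ _ _ J M q y M0) => //.
- by move=> x i /Hy[_ _].
- by move=> x i /Hy[_ H _]; exact: H.
- move=> x x' Fx Fx'; have [Hx _ _] := Hy _ Fx; have [Hx' _ _] := Hy _ Fx'.
  by apply: foot_nonexpansive Hx Hx'; [case: Fx|case: Fx'].
Qed.

End NormalPoints.

Section ConvexBoundary.
Context {R : realType} {d : nat}.
Variable K : set 'rV[R]_d.
Hypotheses (cK : compact K) (vK : convex_set K) (K0 : interior K 0).
Implicit Types (x y z n : 'rV[R]_d).

Lemma interior0_ball : exists2 r : R, 0 < r & forall y, enorm y <= r -> K y.
Proof.
have [e e0 eK] := (nbhs_enormP _ _).1 K0; exists (e / 2); first exact: divr_gt0.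
by move=> y ye; apply: eK; rewrite subr0 (le_lt_trans ye)//; lra.
Qed.

Lemma bdE_sub x : bdE K x -> K x.
Proof. by case=> _; rewrite compact_closureE. Qed.

Lemma normalE_height_ge x n (r : R) : 0 <= r -> (forall y, enorm y <= r -> K y) ->
  is_normalE K x n -> r <= dot x n.
Proof.
move=> r0 rK [n1 Hn]; rewrite -[r]mulr1 -(enorm1 n1); apply: dot_ball_le => //.
by move=> z /rK /Hn; rewrite dotBl subr_le0.
Qed.

Lemma normalE_cone x n a y : 0 <= a -> is_normalE K x n -> K y ->
  dot (y - x) (a *: n) <= 0.
Proof. by move=> a0 [_ /(_ y) H] /H; rewrite dotZr; exact: mulr_ge0_le0. Qed.

Lemma hausdorff_fin_bigcup_lty k (I : finType) (F : I -> set 'rV[R]_d) :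
  (forall i, hausdorff k (F i) < +oo)%E ->
  (hausdorff k (\bigcup_i F i) < +oo)%E.
Proof.
move=> Ffin; have -> : \bigcup_i F i = \bigcup_(i in [set` enum I]) F i.
  by apply: eq_bigcupl; split=> i //= _; rewrite mem_enum.
elim: (enum I) => [|i s IH]; first by rewrite bigcup0 ?hausdorff0// => i.
rewrite (_ : \bigcup_(_ in _) _ = F i `|` \bigcup_(i in [set` s]) F i); last first.
  apply/seteqP; split=> [x [j /=]|x].
    by rewrite in_cons => /predU1P[->|js] Fx; [left|right; exists j].
  by case=> [Fx|[j js Fx]]; [exists i|exists j] => //=; rewrite in_cons ?eqxx ?js ?orbT.
apply: (le_lt_trans (hausdorffU_le _ _ _)); exact: lte_add_pinfty.
Qed.

(** Some coordinate of the unit normal has |n_i| >= 1 / d, so the normal ray at x meets one of the 2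
    d hyperplanes y_i = D or y_i = - D after a length at most 2 D d. Thus the boundary consists of
    feet of finitely many bounded pieces of hyperplanes. *)
Lemma hausdorff_bdE_lty : (0 < d)%N -> (hausdorff d.-1 (bdE K) < +oo)%E.
Proof.
move=> d0; have [D D0 KD] := compact_enorm_le cK.
have d0' : 0 < d%:R :> R by rewrite ltr0n.
pose M := D + 2 * D * d%:R.
have M0 : 0 < M by rewrite addr_gt0// !mulr_gt0.
pose F (i : 'I_d * bool) := feet K [set i.1]%SET (cst ((-1) ^+ i.2 * D)) M.
apply: (@le_lt_trans _ _ (hausdorff d.-1 (\bigcup_i F i))); last first.
  apply: hausdorff_fin_bigcup_lty => -[i b]; apply: hausdorff_feet_lty => //.
  rewrite -ltnS prednK// -[X in (_ < X)%N]card_ord -(cardC (mem [set i]%SET)).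
  rewrite cards1 add1n ltnS; apply: eq_leq; apply: eq_card => j.
  by rewrite !inE.
apply: le_hausdorff => x xK; have Kx := bdE_sub xK.
have [n Hn] := exists_normalE cK vK xK; have [n1 Hn'] := Hn.
have [i di] : exists i, 1 <= d%:R * `|n 0 i|.
  apply: contrapT => H; have := enorm_le_sum n; rewrite enorm1// leNgt => /negP; apply.
  have -> : 1 = \sum_(i < d) d%:R^-1 :> R.
    by rewrite sumr_const card_ord -[RHS]mulr_natl mulfV// gt_eqF.
  apply: ltr_sum; first by apply/hasP; exists (Ordinal d0) => //; rewrite mem_index_enum.
  move=> i _; rewrite -[X in _ < X]mul1r ltr_pdivlMr// mulrC ltNge.
  by apply/negP => ?; apply: H; exists i.
have ni0 : 0 < `|n 0 i|.
  by rewrite ltNge; apply/negP => ni; have := mulr_ge0_le0 (ltW d0') ni; lra.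
pose b := n 0 i < 0; pose s : R := (-1) ^+ b.
have sn : s * n 0 i = `|n 0 i|.
  rewrite /s /b; case: ltP => h; first by rewrite ltr0_norm// expr1 mulN1r.
  by rewrite ger0_norm// expr0 mul1r.
have ss : s * s = 1 by rewrite -expr2 sqrr_sign.
(* The solution of s (x_i + t n_i) = D, where s is the sign of n_i. *)
pose t := (D - s * x 0 i) / `|n 0 i|.
have xi : `|x 0 i| <= D by apply: le_trans (coord_le_enorm _ _) (KD _ Kx).
have sx : `|s * x 0 i| <= D by rewrite normrM normr_sign mul1r.
have t0 : 0 <= t by rewrite divr_ge0// subr_ge0 (le_trans (ler_norm _) sx).
have tM : t <= 2 * D * d%:R.
  rewrite ler_pdivrMr// -(mulrA (2 * D)); apply: (@le_trans _ _ (2 * D)).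
    by move: sx; rewrite ler_norml => /andP[]; lra.
  by rewrite -[leLHS]mulr1 ler_wpM2l// mulr_ge0// ltW.
exists (i, b) => //=; split=> //; exists (x + t *: n); split.
- by move=> z Kz; rewrite addrAC subrr add0r; exact: normalE_cone.
- move=> j; rewrite inE => /eqP->; rewrite !mxE.
  have -> : t * n 0 i = s * (D - s * x 0 i).
    have -> : t * n 0 i = t * (s * `|n 0 i|) by rewrite -sn (mulrA s) ss mul1r.
    by rewrite mulrCA divfK ?gt_eqF.
  by rewrite mulrBr (mulrA s s) ss /= -/s; ring.
- move=> j; rewrite !mxE (le_trans (ler_normD _ _))// lerD//.
    by apply: le_trans (coord_le_enorm _ _) (KD _ Kx).
  rewrite normrM (ger0_norm t0) (le_trans _ tM)// ler_piMr//.
  by rewrite (le_trans (coord_le_enorm _ _))// enorm1.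
Qed.

Definition singular_points : set 'rV[R]_d :=
  [set x | bdE K x /\ exists n n', [/\ is_normalE K x n, is_normalE K x n' & n != n']].

End ConvexBoundary.

Section SingularPoints.
Context {R : realType} {d : nat}.
Variable K : set 'rV[R]_d.
Hypotheses (cK : compact K) (vK : convex_set K) (K0 : interior K 0).
Implicit Types (x y z n : 'rV[R]_d).

Lemma hausdorff_countable_eq0 k (T : countType) (F : T -> set 'rV[R]_d) :
  (forall t, hausdorff k (F t) = 0%E) -> hausdorff k (\bigcup_t F t) = 0%E.
Proof.
move=> F0; apply/eqP; rewrite eq_le hausdorff_ge0 andbT.
pose G (i : nat) := if (choice.unpickle i : option T) is Some t then F t else set0.
apply: (@le_trans _ _ (hausdorff k (\bigcup_n G n))).
  apply: le_hausdorff => x [t _ Ft]; exists (choice.pickle t) => //.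
  by rewrite /G choice.pickleK.
apply: (le_trans (hausdorff_sigma_subadditive k G)).
rewrite eseries0// => i _ _; rewrite /G.
by case: choice.unpickle => [t|]; [exact: F0|exact: hausdorff0].
Qed.

(** Dependent unit normals that differ would be opposite, but both have positive height because 0 is
    interior. *)
Lemma normalE_minor x n n' : is_normalE K x n -> is_normalE K x n' -> n != n' ->
  exists i j, n 0 i * n' 0 j - n 0 j * n' 0 i != 0.
Proof.
move=> Hn Hn' nn; apply: contrapT => H.
have {}H i j : n 0 i * n' 0 j = n 0 j * n' 0 i.
  apply/eqP; rewrite -subr_eq0; apply: contrapT => /negP ?.
  by apply: H; exists i, j.
have [r r0 rK] := interior0_ball K0.
have [i ni] : exists i, n 0 i != 0.
  apply: contrapT => n0; have [n1 _] := Hn; have : n = 0.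
    apply/rowP => i; rewrite mxE; apply/eqP/negPn/negP => ?; apply: n0.
    by exists i.
  by move=> n00; move: n1; rewrite n00 dot0l => /esym/eqP; rewrite oner_eq0.
pose c := n' 0 i / n 0 i; have n'c : n' = c *: n.
  apply/rowP => j; rewrite mxE; apply: (mulfI ni); rewrite H /c.
  by rewrite [RHS]mulrA (mulrC (n 0 i)) divfK// mulrC.
have : c ^+ 2 = 1 by have := Hn'.1; rewrite n'c dotZl dotZr Hn.1 mulr1.
move/eqP; rewrite sqrf_eq1 => /orP[/eqP c1|/eqP c1].
  by move: nn; rewrite n'c c1 scale1r eqxx.
have := normalE_height_ge (ltW r0) rK Hn.
have := normalE_height_ge (ltW r0) rK Hn'.
by rewrite n'c c1 dotZr; lra.
Qed.

(** A countable family of flats of codimension 2, cut to bounded boxes. The diagonal i = j, which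
    would fix only one coordinate, is made empty. *)
Let slice (t : 'I_d * 'I_d * rat * rat * nat) : set 'rV[R]_d :=
  let: (i, j, q, q', M) := t in
  if i == j then set0 else
  feet K [set i; j]%SET (fun l => if l == i then ratr q else ratr q') M.+1%:R.

Let slice0 t : hausdorff d.-1 (slice t) = 0%E.
Proof.
case: t => -[[[i j] q] q'] M; rewrite /slice.
case: eqVneq => [_|ij]; first exact: hausdorff0.
apply: hausdorff_feet_eq0 => //.
have := cardC (mem [set i; j]%SET); rewrite cards2 ij card_ord => dE.
rewrite -[X in (_ < X.-1)%N]dE /= add1n ltnS.
by apply: eq_leq; apply: eq_card => l; rewrite !inE.
Qed.

(* The normal cone at a singular point contains a two-dimensional cone, which
   meets a flat of codimension 2 given by two rational coordinates. *)
Lemma hausdorff_singular_points : hausdorff d.-1 (singular_points K) = 0%E.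
Proof.
apply/eqP; rewrite eq_le hausdorff_ge0 andbT.
rewrite -[leRHS](hausdorff_countable_eq0 slice0); apply: le_hausdorff.
move=> x [xK [n [n' [Hn Hn' nn]]]]; have Kx := bdE_sub cK xK.
have [i [j D0]] := normalE_minor Hn Hn' nn; set D := _ - _ in D0.
have ij : i != j by apply: contraNneq D0 => ij; rewrite /D ij subrr.
have D0' : 0 < `|D| / 4 by rewrite divr_gt0 ?normr_gt0.
(* The centre x + n + n' lies inside the cone, at coefficients (1, 1), so there is room to move two
   of its coordinates to nearby rationals. *)
pose p l := x 0 l + n 0 l + n' 0 l.
have rat_near t : exists q : rat, `|ratr q - t| <= `|D| / 4.
  have /rat_in_itvoo[q] : t - `|D| / 4 < t + `|D| / 4 by lra.
  rewrite in_itv/= => /andP[a b]; exists q; rewrite ler_norml; lra.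
have [q Hq] := rat_near (p i); have [q' Hq'] := rat_near (p j).
pose u := ratr q - p i; pose v := ratr q' - p j.
(* Cramer's rule for u and v as combinations of n and n'. With |u|, |v| <= |D| / 4 the corrections
   are at most 1 / 2 in absolute value, so a and b stay nonnegative. *)
pose a := 1 + (u * n' 0 j - v * n' 0 i) / D.
pose b := 1 + (v * n 0 i - u * n 0 j) / D.
have le1 m l : is_normalE K x m -> `|m 0 l| <= 1.
  by move=> [m1 _]; rewrite (le_trans (coord_le_enorm _ _))// enorm1.
have pos s s' : `|s| <= 1 -> `|s'| <= 1 ->
    forall u v, `|u| <= `|D| / 4 -> `|v| <= `|D| / 4 -> 0 <= 1 + (u * s - v * s') / D.
  move=> s1 s1' u' v' Hu Hv; rewrite -lerBlDl sub0r lerNl.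
  apply: (le_trans (ler_norm _)); rewrite normrN normrM normfV.
  rewrite ler_pdivrMr ?normr_gt0// mul1r (le_trans (ler_normB _ _))//.
  have H1 : `|u' * s| <= `|D| / 4 by rewrite normrM (le_trans _ Hu)// ler_piMr.
  have H2 : `|v' * s'| <= `|D| / 4 by rewrite normrM (le_trans _ Hv)// ler_piMr.
  have := normr_ge0 D; lra.
have a0 : 0 <= a by apply: pos => //; exact: le1.
have b0 : 0 <= b by apply: pos => //; exact: le1.
pose y := x + (a *: n + b *: n').
pose M := Num.truncn (enorm y).
exists (i, j, q, q', M) => //; rewrite /slice (negbTE ij); split=> //.
exists y; split.
- move=> z Kz; rewrite /y addrAC subrr add0r dotDr -[leRHS]addr0.
  by apply: lerD; [exact: normalE_cone a0 Hn Kz|exact: normalE_cone b0 Hn' Kz].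
- move=> l; rewrite !inE => /orP[]/eqP->; rewrite ?eqxx.
    rewrite !mxE -[RHS](subrK (p i)) -/u /a /b /p.
    suff : (u * n' 0 j - v * n' 0 i) / D * n 0 i + (v * n 0 i - u * n 0 j) / D * n' 0 i = u by lra.
    by rewrite /D; field; exact: D0.
  rewrite eq_sym (negbTE ij) !mxE -[RHS](subrK (p j)) -/v /a /b /p.
  suff : (u * n' 0 j - v * n' 0 i) / D * n 0 j + (v * n 0 i - u * n 0 j) / D * n' 0 j = v by lra.
  by rewrite /D; field; exact: D0.
- move=> l; rewrite (le_trans (coord_le_enorm _ _))//.
  by have /andP[_ /ltW] := truncn_itv (enorm_ge0 y).
Qed.

End SingularPoints.

Section BoundarySegment.
Context {R : realType} {d : nat}.
Variable K : set 'rV[R]_d.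

Implicit Types (x y z n : 'rV[R]_d).

(** The first parameter, as an infimum, at which the segment is in K is a limit of parameters in K
    and, from below, of parameters outside; if it is 0 the exterior point is y itself. *)
Lemma segment_boundary y z : ~ K y -> K z ->
  exists2 t : R, 0 <= t <= 1 & bdE K (y + t *: (z - y)).
Proof.
move=> nKy Kz; pose T := [set t : R | 0 <= t <= 1 /\ K (y + t *: (z - y))].
have T1 : T 1 by split; [rewrite ler01 lexx|rewrite scale1r addrC subrK].
have infT : has_inf T by split; [exists 1|exists 0 => t [/andP[]]].
have t01 : 0 <= inf T <= 1.
  rewrite ge_inf ?infT.2//= ?andbT; last by case: infT.
  by apply: lb_le_inf => [|t [/andP[]]]; first exists 1.
have [D D0 HD] : exists2 D, 0 < D & forall s t : R,
    enorm (y + s *: (z - y) - (y + t *: (z - y))) <= D * `|s - t|.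
  exists (enorm (z - y) + 1); first by rewrite ltr_wpDl// enorm_ge0.
  move=> s t; rewrite opprD addrACA subrr add0r -scalerBl enormZ mulrC.
  by rewrite ler_wpM2r// lerDl.
exists (inf T) => //; split=> //; apply/closure_enormP => e e0.
  have e' : 0 < e / D by rewrite divr_gt0.
  have [t [t1 Kt] tT] := inf_adherent e' infT.
  exists (y + t *: (z - y)) => //; rewrite (le_lt_trans (HD _ _))//.
  rewrite mulrC -ltr_pdivlMr// ger0_norm ?ltrBlDl// subr_ge0.
  by apply: ge_inf => //; exact: infT.2.
have [T0|T0] := leP (inf T) 0.
  exists y; first by split.
  have -> : inf T = 0 by apply/eqP; rewrite eq_le T0; case/andP: t01.
  by rewrite scale0r addr0 subrr enorm0.
pose s := Num.max 0 (inf T - e / D / 2).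
have e' : 0 < e / D by rewrite divr_gt0.
have sT : s < inf T by rewrite gt_max T0/= ; lra.
exists (y + s *: (z - y)).
  split=> // Ks; have : T s.
    split=> //; rewrite le_max lexx/=; case/andP: t01 => _; lra.
  by move=> /(ge_inf infT.2); rewrite leNgt sT.
rewrite (le_lt_trans (HD _ _))// mulrC -ltr_pdivlMr// distrC ger0_norm ?subr_ge0 ?ltW//.
have : inf T - e / D / 2 <= s by rewrite le_max lexx orbT.
lra.
Qed.

End BoundarySegment.

(** * Second-order expansions *)

Section Frames.
Context {R : realType}.

(** Stacking n on B gives a square matrix Q with Q Q^T = 1; the claim is Q^T Q = 1. *)
Lemma orthonormal_frame1 d (B : 'M[R]_(d.-1, d)) (n : 'rV[R]_d) :
  dot n n = 1 -> B *m B^T = 1%:M -> n *m B^T = 0 -> B^T *m B = 1%:M - n^T *m n.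
Proof.
case: d B n => [|d] B n n1 BB nB.
  by move: n1; rewrite /dot big_ord0 => /esym/eqP; rewrite oner_eq0.
pose Q := col_mx n B : 'M[R]_(1 + d).
have nn : n *m n^T = 1%:M by rewrite [n *m n^T]mx11_scalar -dotE n1.
have : Q *m Q^T = 1%:M.
  rewrite tr_col_mx mul_col_row nn BB nB -[B *m n^T]trmxK trmx_mul trmxK nB trmx0.
  by rewrite -scalar_mx_block.
by move/mulmx1C; rewrite tr_col_mx mul_row_col => <-; rewrite addrC addKr.
Qed.

Lemma orthonormal_frame2 d (B : 'M[R]_(d.-1, d.+1)) (u n : 'rV[R]_d.+1) :
  (0 < d)%N -> dot u u = 1 -> dot n n = 1 -> dot u n = 0 ->
  B *m B^T = 1%:M -> u *m B^T = 0 -> n *m B^T = 0 ->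
  B^T *m B = 1%:M - u^T *m u - n^T *m n.
Proof.
case: d B u n => [//|d] B u n _ u1 n1 un BB uB nB.
have sc (x y : 'rV[R]_d.+2) : x *m y^T = (dot x y)%:M.
  by rewrite [x *m y^T]mx11_scalar -dotE.
pose Q := col_mx u (col_mx n B) : 'M[R]_(1 + (1 + d)).
have tr0 (x : 'rV[R]_d.+2) : x *m B^T = 0 -> B *m x^T = 0.
  by move=> xB; rewrite -[B *m x^T]trmxK trmx_mul trmxK xB trmx0.
have : Q *m Q^T = 1%:M.
  rewrite tr_col_mx mul_col_row tr_col_mx mul_mx_row mul_col_mx mul_col_row.
  rewrite !sc BB uB nB !tr0// (dotC n) un u1 n1 !raddf0 row_mx0 col_mx0.
  by rewrite -!scalar_mx_block.
move/mulmx1C; rewrite tr_col_mx mul_row_col tr_col_mx mul_row_col => <-.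
by rewrite [_ - u^T *m u]addrAC subrr add0r addrAC subrr add0r.
Qed.

End Frames.

Section SecondOrder.
Context {R : realType}.

Lemma mulmx_bilinear_le m (P : 'M[R]_m) : exists2 C : R, 0 < C &
  forall x y : 'rV[R]_m, `|dot (x *m P) y| <= C * enorm x * enorm y.
Proof.
have [C C0 HC] := mulmx_le P; exists C => // x y.
by rewrite (le_trans (norm_dot_le _ _))// ler_wpM2r ?enorm_ge0.
Qed.

Lemma dot_congruence k m (B : 'M[R]_(k, m)) (S : 'M[R]_k) (x y : 'rV[R]_m) :
  dot (x *m B^T *m S) (y *m B^T) = dot (x *m (B^T *m S *m B)) y.
Proof. by rewrite [LHS]dotC dot_mulmx trmxK dotC !mulmxA. Qed.

Lemma dot_congruenceT k m (M : 'M[R]_(k, m)) (S : 'M[R]_m) (x y : 'rV[R]_k) :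
  dot (x *m (M *m S *m M^T)) y = dot (x *m M *m S) (y *m M).
Proof. by rewrite -{1}[M]trmxK -dot_congruence trmxK. Qed.

(** The scalar core of the transfer below. There s = |v|, t is the normal component of v, x0, x1, x2
    are the values of the Hessian form on the pairs from v L and n' L, l = |v L| and q = |n' L|. The
    expansion gives |t| = O(s^2), so the terms with t x1 and t^2 x2 are of higher order; each of the
    four errors gets a share e / 4 * c * s^2. *)
Lemma transfer_bound (a c t x0 x1 x2 s e e1 eta l A K q : R) :
  0 < c -> `|a| <= eta -> eta <= 1 / 2 -> 0 <= l -> 0 <= s -> 0 <= A -> 0 < e1 ->
  `|- ((1 + a) * c * t) - (1 + a) ^+ 2 * x0 / 2| <= e1 * ((1 + a) * l) ^+ 2 ->
  `|x0| <= A * s ^+ 2 -> `|x1| <= A * s * q -> `|x2| <= A * q ^+ 2 ->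
  l ^+ 2 <= K * s ^+ 2 -> 0 <= q -> 0 <= K ->
  e1 * (2 * K) <= e / 4 * c -> eta * A <= e / 4 * c ->
  (2 * (A + e1 * K) / c) * (A * q) * s <= e / 4 * c ->
  (2 * (A + e1 * K) / c) ^+ 2 * (A * q ^+ 2) * s ^+ 2 <= e / 4 * c ->
  `|- t - c^-1 * (x0 - 2 * t * x1 + t ^+ 2 * x2) / 2| <= e * s ^+ 2.
Proof.
move=> c0 aeta eta1 l0 s0 A0 e10 H Hx0 Hx1 Hx2 Hl q0 K0 B1 B2 B3 B4.
set T := 2 * (A + e1 * K) / c in B3 B4.
have /andP[a1 a2] : - (1 / 2) <= a <= 1 / 2 by rewrite -ler_norml (le_trans aeta).
pose b := 1 + a; have b0 : 0 < b by rewrite /b; lra.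
have b2 : b <= 2 by rewrite /b; lra.
have s2 : 0 <= s ^+ 2 by rewrite sqr_ge0.
have H' : `|- (c * t) - b * x0 / 2| <= e1 * (2 * K) * s ^+ 2.
  rewrite -(ler_pM2l b0) -[X in X * `|_|](gtr0_norm b0) -normrM.
  have -> : b * (- (c * t) - b * x0 / 2) = - (b * c * t) - b ^+ 2 * x0 / 2 by field.
  apply: (le_trans H); rewrite -/b exprMn.
  have -> : b * (e1 * (2 * K) * s ^+ 2) = e1 * (b * 2 * (K * s ^+ 2)) by ring.
  rewrite ler_wpM2l ?(ltW e10)// expr2 -mulrA -mulrA ler_wpM2l ?(ltW b0)//.
  by apply: ler_pM => //; [exact: ltW|exact: sqr_ge0].
have bx0 : `|b * x0| <= 2 * (A * s ^+ 2).
  by rewrite normrM (gtr0_norm b0); apply: ler_pM => //; exact: ltW.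
have tT : `|t| <= T * s ^+ 2.
  rewrite /T mulrAC ler_pdivlMr// -(gtr0_norm c0) -normrM mulrC.
  have -> : c * t = - (- (c * t) - b * x0 / 2) - b * x0 / 2 by ring.
  rewrite (le_trans (ler_normB _ _))// normrN.
  have -> : `|b * x0 / 2| = `|b * x0| / 2 by rewrite normrM (@ger0_norm _ 2^-1).
  have : 0 <= A * s ^+ 2 by rewrite mulr_ge0.
  lra.
have T0 : 0 <= T by rewrite divr_ge0 ?(ltW c0)// mulr_ge0// addr_ge0// mulr_ge0// ltW.
have tx1 : `|t * x1| <= e / 4 * c * s ^+ 2.
  rewrite normrM; apply: (@le_trans _ _ (T * s ^+ 2 * (A * s * q))).
    by apply: ler_pM.
  rewrite (_ : T * _ * _ = T * (A * q) * s * s ^+ 2); last by ring.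
  by rewrite ler_wpM2r.
have tx2 : `|t ^+ 2 * x2| <= e / 4 * c * s ^+ 2.
  rewrite normrM; apply: (@le_trans _ _ ((T * s ^+ 2) ^+ 2 * (A * q ^+ 2))).
    apply: ler_pM => //; rewrite normrX lerXn2r// nnegrE ?normr_ge0//.
    by rewrite mulr_ge0.
  rewrite (_ : _ ^+ 2 * _ = T ^+ 2 * (A * q ^+ 2) * s ^+ 2 * s ^+ 2); last by ring.
  by rewrite ler_wpM2r.
have ax0 : `|a * x0| <= e / 4 * c * s ^+ 2.
  rewrite normrM; apply: (@le_trans _ _ (eta * (A * s ^+ 2))).
    by apply: ler_pM.
  by rewrite mulrA ler_wpM2r.
rewrite -(ler_pM2l c0) -[X in X * `|_|](gtr0_norm c0) -normrM.
have -> : c * (- t - c^-1 * (x0 - 2 * t * x1 + t ^+ 2 * x2) / 2) =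
    (- (c * t) - b * x0 / 2) + a * x0 / 2 + t * x1 - t ^+ 2 * x2 / 2.
  by rewrite /b; field; rewrite gt_eqF.
have H'' : `|- (c * t) - b * x0 / 2| <= e / 4 * c * s ^+ 2.
  by rewrite (le_trans H')// ler_wpM2r.
move: H'' tx1 tx2 ax0; rewrite !ler_norml.
set E := e / 4 * c * s ^+ 2.
have -> : c * (e * s ^+ 2) = 4 * E by rewrite /E; field.
set p := - (c * t) - b * x0 / 2; set r := t ^+ 2 * x2; set w := t * x1; set z := a * x0.
by move=> /andP[? ?] /andP[? ?] /andP[? ?] /andP[? ?]; lra.
Qed.

End SecondOrder.

Section SecondOrderTransfer.
Context {R : realType}.

(* C' near 0 is carried into C by z = (1 + o(1)) v L; normal components scale by
   c, tangential ones transform by M, so the Hessian S pulls back to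
   M S M^T / c. *)
Lemma second_order_transfer k m m' (C : set 'rV[R]_m) (C' : set 'rV[R]_m')
    (n : 'rV[R]_m) (n' : 'rV[R]_m') (B : 'M[R]_(k, m)) (B' : 'M[R]_(k, m'))
    (S : 'M[R]_k) (L : 'M[R]_(m', m)) (c : R) (M := B' *m L *m B^T) :
  0 < c ->
  (forall v, C' v -> v = v *m B'^T *m B' + dot v n' *: n') ->
  (forall v, C' v -> dot (v *m L) n = c * dot v n') ->
  (forall eta, 0 < eta -> exists2 delta, 0 < delta &
    forall v, C' v -> enorm v < delta ->
      exists2 a, `|a| <= eta & C ((1 + a) *: (v *m L))) ->
  second_order C n B S -> second_order C' n' B' (c^-1 *: (M *m S *m M^T)).
Proof.
move=> c0 decC' normC' mapC' [Ssym HS]; split.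
  by rewrite linearZ /= trmx_mul trmxK trmx_mul Ssym mulmxA.
move=> e e0.
pose P := B^T *m S *m B; pose q := enorm (n' *m L).
have Psym x y : dot (x *m P) y = dot (y *m P) x.
  by rewrite dotC dot_mulmx /P !trmx_mul trmxK Ssym !mulmxA.
have [A0 A00 HA0] := mulmx_bilinear_le P; have [CL CL0 HL] := mulmx_le L.
pose K := CL ^+ 2; have K0 : 0 < K by rewrite exprn_gt0.
pose A := A0 * (K + CL + 1); have AP : 0 < A by rewrite mulr_gt0// !addr_gt0.
(* The choices of e1, eta and H meet the four smallness conditions of [transfer_bound]; H serves the
   last two. *)
pose e1 := e / 4 * c / (2 * K).
have ec0 : 0 < e / 4 * c by rewrite mulr_gt0// divr_gt0.
have e10 : 0 < e1 by rewrite divr_gt0// mulr_gt0.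
pose eta := Num.min (1 / 2) (e / 4 * c / A).
have eta0 : 0 < eta by rewrite lt_min !divr_gt0.
pose T := 2 * (A + e1 * K) / c.
have T0 : 0 < T by rewrite divr_gt0// mulr_gt0// addr_gt0// mulr_gt0.
have q0 : 0 <= q by exact: enorm_ge0.
pose H := T * (A * q) + T ^+ 2 * (A * q ^+ 2) + 1.
have H0 : 0 < H.
  have [T1 A1] := (ltW T0, ltW AP).
  by rewrite ltr_wpDl// addr_ge0// mulr_ge0 ?sqr_ge0// mulr_ge0 ?sqr_ge0.
have [d1 d10 Hd1] := mapC' _ eta0; have [d2 d20 Hd2] := HS _ e10.
pose delta := Num.min (Num.min d1 (d2 / (2 * CL))) (Num.min 1 (e / 4 * c / H)).
have delta0 : 0 < delta by rewrite !lt_min d10 ltr01 !divr_gt0// mulr_gt0.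
exists delta => // v C'v; rewrite !lt_min => /andP[/andP[v1 v2] /andP[v3 v4]].
have [a aeta Cz] := Hd1 v C'v v1.
have a12 : - (1 / 2) <= a <= 1 / 2.
  by rewrite -ler_norml (le_trans aeta)// ge_min lexx.
set l := enorm (v *m L); have ll : l <= CL * enorm v by exact: HL.
have s0 : 0 <= enorm v by exact: enorm_ge0.
have zl : enorm ((1 + a) *: (v *m L)) = (1 + a) * l.
  by rewrite enormZ ger0_norm// ; case/andP: a12; lra.
have zd2 : enorm ((1 + a) *: (v *m L)) < d2.
  rewrite zl; apply: (@le_lt_trans _ _ (2 * (CL * enorm v))).
    by apply: ler_pM => //; rewrite ?enorm_ge0//; case/andP: a12; lra.
  by rewrite mulrA mulrC -ltr_pdivlMr// mulr_gt0.
have := Hd2 _ Cz zd2; rewrite zl dot_congruence -/P !dotZl -scalemxAl dotZl dotZr.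
rewrite normC'// => Hz.
set t := dot v n'.
have -> : dot (v *m B'^T *m (c^-1 *: (M *m S *m M^T))) (v *m B'^T) =
    c^-1 * (dot (v *m L *m P) (v *m L) - 2 * t * dot (v *m L *m P) (n' *m L) +
            t ^+ 2 * dot (n' *m L *m P) (n' *m L)).
  rewrite -scalemxAr dotZl; congr (_ * _).
  (* B' sees only the tangential part v - t n', whose image under L differs from v L by t times n'
     L; this is the source of the cross terms. *)
  have vt : v *m B'^T *m M = (v *m L - t *: (n' *m L)) *m B^T.
    rewrite /M !mulmxA; congr (_ *m _); rewrite scalemxAl -mulmxBl.
    by congr (_ *m _); rewrite [in RHS](decC' _ C'v) addrK.
  rewrite dot_congruenceT vt dot_congruence -/P.
  set x := v *m L; set y := n' *m L.
  by rewrite mulmxBl -scalemxAl !dotBl !dotBr !dotZl !dotZr (Psym y x); ring.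
apply: (@transfer_bound _ a c t _ _ _ _ e e1 eta l A K q) => //.
- by rewrite ge_min lexx.
- exact: enorm_ge0.
- exact: ltW.
- move: Hz; set x := v *m L; rewrite -/t.
  by rewrite (_ : (1 + a) * (c * t) = (1 + a) * c * t) ?mulrA// expr2 mulrA.
- rewrite (le_trans (HA0 _ _))// -/l -!mulrA ler_pM2l//.
  apply: (@le_trans _ _ (K * enorm v ^+ 2)).
    by rewrite -expr2 -exprMn lerXn2r// nnegrE ?enorm_ge0// mulr_ge0// ltW.
  by rewrite ler_wpM2r ?sqr_ge0// -addrA lerDl addr_ge0// ltW.
- rewrite (le_trans (HA0 _ _))// -/l -/q ler_wpM2r// -mulrA ler_pM2l//.
  rewrite (le_trans ll)// ler_wpM2r//.
  by rewrite [K + CL]addrC -addrA lerDl addr_ge0// ltW.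
- rewrite (le_trans (HA0 _ _))// -/q expr2 mulrA ler_wpM2r// ler_wpM2r//.
  by rewrite ler_peMr ?(ltW A00)// lerDr addr_ge0// ltW.
- by rewrite /K -exprMn lerXn2r// nnegrE ?enorm_ge0// mulr_ge0// ltW.
- exact: ltW.
- by rewrite /e1 divfK// gt_eqF// mulr_gt0.
- by rewrite -ler_pdivlMr// ge_min lexx orbT.
- have vH : H * enorm v <= e / 4 * c by rewrite mulrC -ler_pdivlMr// ltW.
  apply: le_trans vH; rewrite ler_wpM2r// /H -/T.
  by rewrite -addrA lerDl addr_ge0// mulr_ge0 ?sqr_ge0// mulr_ge0 ?sqr_ge0// ltW.
- have vH : H * enorm v <= e / 4 * c by rewrite mulrC -ler_pdivlMr// ltW.
  apply: le_trans vH; rewrite -/T.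
  apply: (@le_trans _ _ (T ^+ 2 * (A * q ^+ 2) * enorm v)).
    apply: ler_wpM2l; last by rewrite expr2 ler_piMr// ltW.
    by rewrite mulr_ge0 ?sqr_ge0// mulr_ge0 ?sqr_ge0// ltW.
  rewrite ler_wpM2r// /H [T * _ + _]addrC -addrA lerDl addr_ge0//.
  by rewrite mulr_ge0 ?(ltW T0)// mulr_ge0// ltW.
Qed.

(** The two expansions give quadratic forms that agree up to o(|v|^2) on C. As C contains points in
    directions close to every tangent vector, the forms agree on the tangent hyperplane, so S1 and
    S2 are conjugate under the orthogonal matrix B1 B2^T. *)
Lemma second_order_det_unique k m (C : set 'rV[R]_m) (n : 'rV[R]_m)
    (B1 B2 : 'M[R]_(k, m)) (S1 S2 : 'M[R]_k) :
  B1 *m B1^T = 1%:M -> n *m B1^T = 0 -> B2^T *m B2 = 1%:M - n^T *m n ->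
  (forall t, dot t n = 0 -> forall eta delta : R, 0 < eta -> 0 < delta ->
     exists s w, [/\ 0 < s, enorm (w - t) <= eta, enorm (s *: w) < delta
       & C (s *: w)]) ->
  second_order C n B1 S1 -> second_order C n B2 S2 -> \det S1 = \det S2.
Proof.
move=> BB1 nB1 BB2 tgt [S1sym H1] [S2sym H2].
pose P := B1^T *m S1 *m B1 - B2^T *m S2 *m B2.
have [A A0 HA] := mulmx_bilinear_le P.
have P0 t : dot t n = 0 -> dot (t *m P) t = 0.
  move=> tn; apply/eqP; rewrite -normr_le0; apply/ler_addgt0Pr => e e0.
  rewrite add0r; pose r := enorm t; have r0 : 0 <= r by exact: enorm_ge0.
  (* The forms enter halved, so two errors e1 |v|^2 give 4 e1 |v|^2 for their difference; with |w|
     <= r + 1 this is e / 2. *)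
  pose e1 := e / (8 * (r + 1) ^+ 2).
  have r1 : 0 < (r + 1) ^+ 2 by rewrite exprn_gt0// ltr_wpDl.
  have e10 : 0 < e1 by rewrite divr_gt0// mulr_gt0.
  pose eta := Num.min 1 (e / (2 * (A * (2 * r + 1)))).
  have r20 : 0 < 2 * r + 1 by rewrite ltr_wpDl// mulr_ge0.
  have eta0 : 0 < eta by rewrite lt_min ltr01 divr_gt0// !mulr_gt0.
  have [d1 d10 {}H1] := H1 _ e10; have [d2 d20 {}H2] := H2 _ e10.
  have dd : 0 < Num.min d1 d2 by rewrite lt_min d10.
  have [s [w [s0 wt]]] := tgt t tn _ _ eta0 dd.
  rewrite lt_min => /andP[sw1 sw2] Cw.
  have := H1 _ Cw sw1; have := H2 _ Cw sw2; rewrite !dot_congruence => {}H2 {}H1.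
  have w1 : enorm w <= r + 1.
    have : enorm (w - t) <= 1 by rewrite (le_trans wt)// ge_min lexx.
    by have := enormD (w - t) t; rewrite subrK -/r; lra.
  have wP : `|dot (w *m P) w| <= e / 2.
    have : `|dot ((s *: w) *m P) (s *: w)| <= 4 * e1 * enorm (s *: w) ^+ 2.
      rewrite /P mulmxBr dotBl; move: H1 H2; rewrite !ler_norml.
      by move=> /andP[? ?] /andP[? ?]; lra.
    rewrite enormZ (gtr0_norm s0) -scalemxAl dotZl dotZr mulrA normrM.
    rewrite (gtr0_norm (mulr_gt0 s0 s0)) exprMn -expr2 mulrCA ler_pM2l ?exprn_gt0//.
    move/le_trans; apply; apply: (@le_trans _ _ (4 * e1 * (r + 1) ^+ 2)).
      apply: ler_wpM2l; first by rewrite mulr_ge0// ltW.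
      rewrite lerXn2r ?nnegrE ?enorm_ge0//.
      by rewrite addr_ge0.
    rewrite le_eqVlt; apply/orP; left; apply/eqP; rewrite /e1; field.
    by rewrite gt_eqF// ltr_wpDl.
  have -> : dot (t *m P) t = dot (w *m P) w - dot (w *m P) (w - t)
                             - dot ((w - t) *m P) t.
    by rewrite mulmxBl !dotBl !dotBr; ring.
  have b1 : `|dot (w *m P) (w - t)| <= A * (r + 1) * eta.
    by rewrite (le_trans (HA _ _))// ler_pM ?mulr_ge0 ?enorm_ge0 ?(ltW A0)//
      ler_wpM2l// ltW.
  have b2 : `|dot ((w - t) *m P) t| <= A * eta * r.
    by rewrite (le_trans (HA _ _))// ler_wpM2r// ler_wpM2l// ltW.
  have b3 : A * (r + 1) * eta + A * eta * r <= e / 2.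
    have -> : A * (r + 1) * eta + A * eta * r = A * (2 * r + 1) * eta by ring.
    rewrite mulrC -ler_pdivlMr ?mulr_gt0//.
    by rewrite ge_min; apply/orP; right; rewrite -mulrA -invfM.
  move: wP b1 b2; rewrite !ler_norml => /andP[? ?] /andP[? ?] /andP[? ?]; lra.
have Psym : P^T = P by rewrite linearB /= !trmx_mul !trmxK S1sym S2sym !mulmxA.
pose N := B1 *m P *m B1^T.
have N0 x : dot (x *m N) x = 0.
  rewrite /N !mulmxA dot_mulmx trmxK; apply: P0.
  rewrite dot_mulmx (_ : n *m B1^T = 0) ?dot0r//.
have Nsym x y : dot (x *m N) y = dot (y *m N) x.
  by rewrite dotC dot_mulmx /N !trmx_mul !trmxK Psym !mulmxA.
have {}N0 : N = 0.
  (* Polarisation: for y = x N, the form at x + y equals 2 |y|^2. *)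
  apply/row_matrixP => i; rewrite row0 rowE; set x := delta_mx _ _.
  apply/eqP; rewrite -dot_eq0; apply/eqP; set y := x *m N.
  have := N0 (x + y); rewrite mulmxDl dotDl !dotDr !N0 (Nsym y) -/y; lra.
pose O := B1 *m B2^T.
have OO : O *m O^T = 1%:M.
  rewrite /O trmx_mul trmxK mulmxA -(mulmxA B1) BB2 mulmxBr mulmx1 mulmxBl BB1.
  rewrite [B1 *m (n^T *m n)]mulmxA (_ : B1 *m n^T = 0) ?mul0mx ?subr0//.
  by apply: trmx_inj; rewrite trmx_mul trmxK nB1 trmx0.
have : S1 = O *m S2 *m O^T.
  apply/eqP; rewrite -subr_eq0 -N0 /N /P mulmxBr mulmxBl /O trmx_mul trmxK !mulmxA.
  by rewrite BB1 mul1mx -!mulmxA BB1 mulmx1.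
move=> ->; rewrite !det_mulmx mulrC mulrA -det_mulmx.
by rewrite (mulmx1C OO) det1 mul1r.
Qed.

End SecondOrderTransfer.

(** * Gnomonic projection *)

Section Gnomonic.
Context {R : realType} {d : nat}.
Variables (lam : R) (o : 'rV[R]_d.+1) (iota : 'M[R]_(d, d.+1)).
Implicit Types (x z n : 'rV[R]_d) (u v y m : 'rV[R]_d.+1) (K : set 'rV[R]_d).

Definition rho x : R := Num.sqrt (1 + lam * dot x x).

Definition gno x : 'rV[R]_d.+1 := (rho x)^-1 *: (o + x *m iota).

(** Homogeneous of degree 0 in y, hence meaningful off the sphere; on the open hemisphere around o
    it inverts [gno]. *)
Definition ungno y : 'rV[R]_d := (lam * dot y o)^-1 *: (y *m iota^T).

(** The linear hyperplane orthogonal to it cuts the affine chart o + z iota in the points with z.n =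
    x.n. *)
Definition gno_normal x n : 'rV[R]_d.+1 :=
  (Num.sqrt (1 + lam * dot x n ^+ 2))^-1 *: (n *m iota - (lam * dot x n) *: o).

Hypotheses (lam0 : 0 < lam) (oS : Sp lam o) (oi : identifies_perp o iota).

Let oo : dot o o = lam^-1. Proof. exact: oS. Qed.

Let ii : iota *m iota^T = 1%:M. Proof. by case: oi. Qed.

Let oiT : o *m iota^T = 0. Proof. by case: oi. Qed.

Lemma dot_o_iota x : dot o (x *m iota) = 0.
Proof. by rewrite dotC dot_mulmx oiT dot0r. Qed.

Let dot_iota_o x : dot (x *m iota) o = 0.
Proof. by rewrite dotC dot_o_iota. Qed.

Lemma iotaT_iota : iota^T *m iota = 1%:M - lam *: (o^T *m o).
Proof.
have s0 : 0 <= lam := ltW lam0.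
rewrite (@orthonormal_frame1 _ d.+1 iota (Num.sqrt lam *: o))//.
- by rewrite [(_ *: o)^T]linearZ /= -scalemxAl -scalemxAr scalerA -expr2 sqr_sqrtr.
- by rewrite dotZl dotZr mulrA -expr2 sqr_sqrtr// oo mulfV ?gt_eqF.
- by rewrite -scalemxAl oiT scaler0.
Qed.

Lemma perp_decomp y : y = (lam * dot y o) *: o + (y *m iota^T) *m iota.
Proof.
rewrite -mulmxA iotaT_iota mulmxBr mulmx1 -scalemxAr row_outer scalerA.
by rewrite addrC subrK.
Qed.

Lemma rho_arg_ge1 x : 1 <= 1 + lam * dot x x.
Proof. by rewrite lerDl mulr_ge0 ?dot_ge0// ltW. Qed.

Lemma rho_ge1 x : 1 <= rho x.
Proof. by rewrite -[leLHS]sqrtr1 ler_wsqrtr// rho_arg_ge1. Qed.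

Lemma rho_gt0 x : 0 < rho x.
Proof. exact: lt_le_trans (rho_ge1 x). Qed.

Lemma sqr_rho x : rho x ^+ 2 = 1 + lam * dot x x.
Proof. by rewrite sqr_sqrtr// (le_trans ler01)// rho_arg_ge1. Qed.

Lemma dot_gno x z : dot (gno x) (gno z) = (lam^-1 + dot x z) / (rho x * rho z).
Proof.
rewrite /gno !dotLE dot_o_iota dot_iota_o dot_isometry// oo addr0 add0r invfM.
by ring.
Qed.

Lemma dot_gno_o x : dot (gno x) o = (lam * rho x)^-1.
Proof. by rewrite /gno !dotLE dot_iota_o oo addr0 invfM mulrC. Qed.

Lemma gno_Sp x : Sp lam (gno x).
Proof.
rewrite /Sp/= dot_gno -expr2 sqr_rho; field.
by rewrite !gt_eqF//= (lt_le_trans ltr01)// rho_arg_ge1.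
Qed.

Lemma gno_iotaT x : gno x *m iota^T = (rho x)^-1 *: x.
Proof. by rewrite -scalemxAl mulmxDl oiT add0r -mulmxA ii mulmx1. Qed.

Lemma gnoK x : ungno (gno x) = x.
Proof.
rewrite /ungno gno_iotaT dot_gno_o scalerA -[RHS]scale1r; congr (_ *: _).
by field; rewrite !gt_eqF// rho_gt0.
Qed.

Lemma gno_inj x z : gno x = gno z -> x = z.
Proof. by move=> xz; rewrite -(gnoK x) xz gnoK. Qed.

Lemma ungnoK y : Sp lam y -> 0 < dot y o -> gno (ungno y) = y.
Proof.
move=> yS yo; have c0 : 0 < lam * dot y o by rewrite mulr_gt0.
have e : o + ungno y *m iota = (lam * dot y o)^-1 *: y.
  rewrite /ungno -scalemxAl; apply: (@scalerI _ _ (lam * dot y o)).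
    by rewrite gt_eqF.
  by rewrite scalerDr !scalerA mulfV ?gt_eqF// !scale1r -perp_decomp.
rewrite /gno e scalerA (_ : rho _ = (lam * dot y o)^-1).
  by rewrite mulVf ?scale1r// gt_eqF// invr_gt0.
rewrite /rho (_ : 1 + _ = ((lam * dot y o)^-1) ^+ 2).
  by rewrite sqrtr_sqr ger0_norm// invr_ge0 ltW.
have : lam * dot (o + ungno y *m iota) (o + ungno y *m iota) =
    1 + lam * dot (ungno y) (ungno y).
  rewrite dotDl !dotDr dot_o_iota dot_iota_o dot_isometry// oo addr0 add0r.
  by rewrite mulrDr mulfV// gt_eqF.
move=> <-; rewrite e dotZl dotZr (yS : dot y y = _); field.
by rewrite !gt_eqF.
Qed.

(** Only inner products of R^d enter, so models built on unrelated o and iota can be compared. *)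
Lemma gno_dist x z : enorm (gno x - gno z) ^+ 2 =
  2 * (rho x * rho z - (1 + lam * dot x z)) / (lam * (rho x * rho z)).
Proof.
rewrite sqr_enorm dotBl !dotBr (gno_Sp x : dot _ _ = _) (gno_Sp z : dot _ _ = _).
rewrite (dotC (gno z)) dot_gno; field.
by rewrite !gt_eqF// ?rho_gt0.
Qed.

(** The excess of the left side is lam^2 times the Gram determinant of x and z. *)
Let gram x z : (rho x * rho z) ^+ 2 - (1 + lam * dot x z) ^+ 2 >=
  lam * enorm (x - z) ^+ 2.
Proof.
rewrite exprMn !sqr_rho sqr_enorm dotBl !dotBr (dotC z x).
have W : 0 <= dot x x * dot z z - dot x z ^+ 2.
  rewrite -!sqr_enorm -exprMn subr_ge0 -(real_normK (num_real (dot x z))).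
  by rewrite lerXn2r// ?nnegrE ?norm_dot_le// mulr_ge0 ?enorm_ge0.
have := mulr_ge0 (sqr_ge0 lam) W; lra.
Qed.

Let rhorho_ge x z : 1 + lam * dot x z <= rho x * rho z.
Proof.
have rr : 0 <= rho x * rho z by rewrite mulr_ge0 ?(ltW (rho_gt0 _)).
apply: (le_trans (ler_norm _)); rewrite -(@ler_pXn2r _ 2) ?nnegrE//.
rewrite real_normK ?num_real// -subr_ge0; apply: le_trans (gram x z).
by rewrite mulr_ge0 ?sqr_ge0// ltW.
Qed.

(** With N = rho x * rho z and P = 1 + lam x.z, one has lam |x - z|^2 = rho x^2 + rho z^2 - 2 P >= 2
    (N - P), and N >= 1. *)
Lemma gno_nonexpansive x z : enorm (gno x - gno z) <= enorm (x - z).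
Proof.
rewrite -(@ler_pXn2r _ 2) ?nnegrE ?enorm_ge0// gno_dist.
have [rx rz] : 0 < rho x /\ 0 < rho z by rewrite !rho_gt0.
have N1 : 1 <= rho x * rho z by rewrite mulr_ege1 ?rho_ge1.
rewrite ler_pdivrMr ?mulr_gt0//.
have lA : lam * enorm (x - z) ^+ 2 =
    rho x ^+ 2 + rho z ^+ 2 - 2 * (1 + lam * dot x z).
  by rewrite !sqr_rho sqr_enorm dotBl !dotBr (dotC z x); ring.
rewrite mulrCA mulrA lA mulrC.
have NP : 0 <= rho x * rho z - (1 + lam * dot x z) by rewrite subr_ge0.
set N := rho x * rho z in N1 NP *; set P := 1 + _ in NP *.
apply: (@le_trans _ _ (N * (2 * (N - P)))).
  by rewrite mulrC -[leLHS]mul1r ler_wpM2r// mulr_ge0.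
rewrite [leRHS]mulrC ler_wpM2l ?(le_trans ler01)//.
by have := sqr_ge0 (rho x - rho z); rewrite /N sqrrB; lra.
Qed.

(** By [gram], lam |x - z|^2 <= (N - P) (N + P), where P <= N <= 1 + lam D^2 and N - P is the
    numerator of the distance formula. *)
Lemma gno_expansive (D : R) x z : enorm x <= D -> enorm z <= D ->
  enorm (x - z) <= (1 + lam * D ^+ 2) * enorm (gno x - gno z).
Proof.
move=> xD zD; have D0 : 0 <= D by exact: le_trans (enorm_ge0 _) xD.
have l0 := ltW lam0; set M := 1 + lam * D ^+ 2.
have M1 : 1 <= M by rewrite lerDl mulr_ge0 ?sqr_ge0.
have M0 : 0 <= M by exact: le_trans ler01 M1.
have rM t : enorm t <= D -> rho t ^+ 2 <= M.
  move=> tD; rewrite sqr_rho lerD2l ler_wpM2l// -sqr_enorm lerXn2r//.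
  by rewrite nnegrE enorm_ge0.
have [rx rz] : 0 < rho x /\ 0 < rho z by rewrite !rho_gt0.
set N := rho x * rho z; have N0 : 0 < N by rewrite mulr_gt0.
have NM : N <= M.
  have := rM _ xD; have := rM _ zD.
  by have := sqr_ge0 (rho x - rho z); rewrite /N sqrrB; lra.
rewrite -(@ler_pXn2r _ 2) ?nnegrE ?mulr_ge0 ?enorm_ge0// exprMn gno_dist -/N.
set P := 1 + lam * dot x z; have PN : P <= N by exact: rhorho_ge.
have := gram x z; rewrite -/N -/P subr_sqr => lA.
rewrite mulrA ler_pdivlMr ?mulr_gt0// mulrA [leLHS]mulrC.
apply: (@le_trans _ _ (N * ((N - P) * (N + P)))).
  by rewrite ler_wpM2l ?(ltW N0)// mulrC.
apply: (@le_trans _ _ (M * ((N - P) * (2 * M)))); last first.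
  by rewrite le_eqVlt; apply/orP; left; apply/eqP; ring.
have NP0 : 0 <= N - P by rewrite subr_ge0.
have [NP1|NP1] := leP 0 (N + P).
  apply: ler_pM => //; [exact: ltW|exact: mulr_ge0|].
  by rewrite ler_wpM2l//; lra.
apply: (@le_trans _ _ 0); last by rewrite !mulr_ge0.
by rewrite pmulr_rle0// mulr_ge0_le0// ltW.
Qed.

End Gnomonic.

Section GnomonicBody.
Context {R : realType} {d : nat}.
Variables (lam : R) (o : 'rV[R]_d.+1) (iota : 'M[R]_(d, d.+1)).
Implicit Types (x z n : 'rV[R]_d) (u v y m : 'rV[R]_d.+1) (K : set 'rV[R]_d).
Hypotheses (lam0 : 0 < lam) (oS : Sp lam o) (oi : identifies_perp o iota).

Local Notation gno := (gno lam o iota).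
Local Notation ungno := (ungno lam o iota).
Local Notation rho := (rho lam).
Local Notation gno_normal := (gno_normal lam o iota).

Let oo : dot o o = lam^-1. Proof. exact: oS. Qed.
Let ii : iota *m iota^T = 1%:M. Proof. by case: oi. Qed.
Let oiT : o *m iota^T = 0. Proof. by case: oi. Qed.
Let doi x : dot o (x *m iota) = 0. Proof. exact: dot_o_iota. Qed.
Let dio x : dot (x *m iota) o = 0. Proof. by rewrite dotC doi. Qed.
Let sl0 : 0 < Num.sqrt lam. Proof. by rewrite sqrtr_gt0. Qed.
Let sl2 : Num.sqrt lam ^+ 2 = lam. Proof. by rewrite sqr_sqrtr// ltW. Qed.

Lemma geodesicS_gno r (w : 'rV[R]_d) : 0 <= r < pi / (2 * Num.sqrt lam) ->
  dot w w = 1 -> geodesicS lam o (w *m iota) r = gno (tanS lam r *: w).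
Proof.
move=> /andP[r0 rpi] w1; set th := Num.sqrt lam * r.
have th2 : - (pi / 2) < th < pi / 2.
  rewrite (@lt_le_trans _ _ 0) ?mulr_ge0 ?(ltW sl0)//=; last first.
    by rewrite oppr_lt0 divr_gt0// pi_gt0.
  by move: rpi; rewrite invfM mulrA ltr_pdivlMr// mulrC.
have c0 : 0 < cos th by exact: cos_gt0_pihalf.
have rE : rho (tanS lam r *: w) = (cos th)^-1.
  rewrite /rho dotZl dotZr w1 mulr1 /tanS -/th -expr2 exprMn exprVn sl2.
  rewrite mulrCA mulfV ?gt_eqF// mulr1 -cos2_tan2 ?gt_eqF//.
  by rewrite -exprVn sqrtr_sqr ger0_norm// invr_ge0 ltW.
rewrite /gno rE invrK scalerDr -scalemxAl scalerA; congr (_ + _ *: _).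
by rewrite /tanS -/th /tan; field; rewrite !gt_eqF.
Qed.

Lemma gnomonic_preimageE K : (0 < d)%N ->
  gnomonic_preimage lam o iota K = gno @` K.
Proof.
move=> d0; apply/seteqP; split=> [y [r [w [r0 w1 -> Kw]]]|_ [x Kx <-]].
  by exists (tanS lam r *: w) => //; rewrite geodesicS_gno.
have pi0 : 0 < pi / (2 * Num.sqrt lam) by rewrite divr_gt0 ?pi_gt0 ?mulr_gt0.
(* The centre has r = 0 but still needs a unit direction, which exists as d > 0. *)
have [x0|x0] := eqVneq x 0.
  have w1 : dot (delta_mx 0 (Ordinal d0) : 'rV[R]_d) (delta_mx 0 (Ordinal d0)) = 1.
    rewrite /dot (bigD1 (Ordinal d0))//= !mxE !eqxx mul1r big1 ?addr0// => i ni.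
    by rewrite !mxE (negbTE ni) andbF mul0r.
  have t0 : tanS lam 0 = 0 by rewrite /tanS mulr0 tan0 mul0r.
  exists 0, (delta_mx 0 (Ordinal d0)); split=> //; first by rewrite lexx.
    by rewrite geodesicS_gno ?lexx// t0 scale0r x0.
  by rewrite t0 scale0r -x0.
have nx : 0 < enorm x by rewrite enorm_gt0.
pose r := atan (Num.sqrt lam * enorm x) / Num.sqrt lam.
have r0 : 0 <= r < pi / (2 * Num.sqrt lam).
  rewrite divr_ge0 ?(ltW sl0) //=; last first.
    by rewrite -atan0 le_atan// mulr_ge0 ?enorm_ge0// ltW.
  by rewrite /r invfM mulrA ltr_pM2r ?invr_gt0// atan_ltpi2.
have tr : tanS lam r = enorm x.
  rewrite /tanS /r mulrCA mulfV ?gt_eqF// mulr1 atanK mulrAC mulfV ?mul1r//.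
  by rewrite gt_eqF.
have w1 : dot ((enorm x)^-1 *: x) ((enorm x)^-1 *: x) = 1.
  by rewrite dotZl dotZr -sqr_enorm; field; rewrite gt_eqF.
have xE : enorm x *: ((enorm x)^-1 *: x) = x.
  by rewrite scalerA mulfV ?scale1r// gt_eqF.
exists r, ((enorm x)^-1 *: x); split=> //; last by rewrite tr xE.
by rewrite geodesicS_gno// tr xE.
Qed.

(** Up to the scalar 1 / (lam y.o) the displacement is exactly linear in y. The matrix annihilates
    [gno x], and [push_mx] is its rescaling. *)
Lemma ungnoB x y : dot y o != 0 ->
  ungno y - x = (lam * dot y o)^-1 *: (y *m (iota^T - lam *: (o^T *m x))).
Proof.
move=> yo; rewrite /ungno mulmxBr -scalemxAr row_outer scalerA scalerBr scalerA.
by rewrite mulVf ?scale1r// mulf_neq0// gt_eqF.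
Qed.

Lemma gno_annihilates x : gno x *m (iota^T - lam *: (o^T *m x)) = 0.
Proof.
have xo : dot (gno x) o != 0.
  by rewrite dot_gno_o// invr_eq0 gt_eqF// mulr_gt0// rho_gt0.
have := ungnoB x xo; rewrite gnoK// subrr => /esym/eqP.
by rewrite scaler_eq0 invr_eq0 mulf_eq0 gt_eqF// (negbTE xo) => /eqP.
Qed.

Lemma ungno_near x : exists2 C : R, 0 < C & exists2 e : R, 0 < e &
  forall y, enorm (y - gno x) < e ->
    0 < dot y o /\ enorm (ungno y - x) <= C * enorm (y - gno x).
Proof.
pose c := dot (gno x) o.
have c0 : 0 < c by rewrite /c dot_gno_o// invr_gt0 mulr_gt0// rho_gt0.
have [A A0 HA] := mulmx_le (iota^T - lam *: (o^T *m x)).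
have no : 0 < enorm o + 1 by rewrite ltr_wpDl// enorm_ge0.
exists ((lam * (c / 2))^-1 * A).
  by rewrite mulr_gt0// invr_gt0 mulr_gt0// divr_gt0.
exists (c / 2 / (enorm o + 1)); first by rewrite !divr_gt0.
move=> y; rewrite ltr_pdivlMr// => ye.
have yo : c / 2 < dot y o.
  have : `|dot (y - gno x) o| < c / 2.
    apply: le_lt_trans ye; apply: (le_trans (norm_dot_le _ _)).
    by rewrite ler_wpM2l ?enorm_ge0// lerDl.
  by rewrite dotBl -/c ltr_norml => /andP[]; lra.
have yo0 : 0 < dot y o by rewrite (lt_trans _ yo)// divr_gt0.
split=> //; rewrite ungnoB ?gt_eqF// enormZ.
rewrite -[y in _ * enorm (y *m _)](subrK (gno x)) mulmxDl gno_annihilates addr0.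
rewrite -mulrA ler_pM ?enorm_ge0//.
rewrite ger0_norm ?invr_ge0 ?mulr_ge0 ?(ltW lam0) ?(ltW yo0)//.
by rewrite lef_pV2 ?posrE ?mulr_gt0 ?divr_gt0// ler_pM2l// ltW.
Qed.

Lemma compact_gno K : compact K -> compact (gno @` K).
Proof.
move=> cK; apply: continuous_compact cK; apply: continuous_subspaceT => x B.
move=> /nbhs_enormP[e e0 eB]; apply/nbhs_enormP; exists e => // z zx.
by apply: eB; apply: le_lt_trans zx; exact: gno_nonexpansive.
Qed.

Lemma bdS_gno K : compact K -> bdS lam (gno @` K) = gno @` (bdE K).
Proof.
move=> cK; apply/seteqP; split.
  move=> u [_]; rewrite compact_closureE; last exact: compact_gno.
  move=> [x Kx <-] nK; exists x => //; split=> //; first exact: subset_closure.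
  have [C C0 [e e0 He]] := ungno_near x.
  apply/closure_enormP => r r0.
  have re : 0 < Num.min e (r / C) by rewrite lt_min e0 divr_gt0.
  have [y [yS nKy]] := (closure_enormP _ _).1 nK _ re.
  rewrite lt_min => /andP[/He[yo yx] yr]; exists (ungno y).
    by split=> // Ky; apply: nKy; exists (ungno y) => //; rewrite ungnoK.
  by rewrite (le_lt_trans yx)// mulrC -ltr_pdivlMr.
move=> _ [x [_ Kx nKx] <-]; split; first exact: gno_Sp.
  by rewrite compact_closureE in Kx => //; apply: subset_closure; exists x.
apply/closure_enormP => r r0.
have [z [_ nKz] zx] := (closure_enormP _ _).1 nKx _ r0.
exists (gno z); last by apply: le_lt_trans zx; exact: gno_nonexpansive.
by split; [exact: gno_Sp|move=> [w Kw /(gno_inj lam0 oS oi) wz]; rewrite -wz in nKz].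
Qed.

Let sg2 x n : 1 <= 1 + lam * dot x n ^+ 2.
Proof. by rewrite lerDl mulr_ge0 ?sqr_ge0// ltW. Qed.

Let sg0 x n : 0 < Num.sqrt (1 + lam * dot x n ^+ 2).
Proof. by rewrite sqrtr_gt0 (lt_le_trans ltr01). Qed.

Let sqr_sg x n : Num.sqrt (1 + lam * dot x n ^+ 2) ^+ 2 = 1 + lam * dot x n ^+ 2.
Proof. by rewrite sqr_sqrtr// (le_trans ler01). Qed.

Lemma dot_gno_normal_o x n :
  dot o (gno_normal x n) = - dot x n / Num.sqrt (1 + lam * dot x n ^+ 2).
Proof.
rewrite /gno_normal dotZr dotBr dotZr doi oo; field.
by rewrite !gt_eqF ?sg0.
Qed.

Lemma dot_gno_normal_self x n : dot n n = 1 ->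
  dot (gno_normal x n) (gno_normal x n) = 1.
Proof.
move=> n1; rewrite /gno_normal dotZl dotZr dotBl !dotBr !dotZl !dotZr.
rewrite dio doi dot_isometry// n1 oo mulrA -expr2 exprVn sqr_sg.
by field; rewrite !gt_eqF// (lt_le_trans ltr01).
Qed.

Lemma dot_gno_gno_normal x n z :
  dot (gno z) (gno_normal x n) =
  (rho z * Num.sqrt (1 + lam * dot x n ^+ 2))^-1 * dot (z - x) n.
Proof.
rewrite /gno /gno_normal dotZl dotZr dotBr !dotDl !dotZr doi.
rewrite dot_isometry// oo dio dotNl; field.
by rewrite !gt_eqF// rho_gt0.
Qed.

Lemma is_normalS_gno K x n :
  is_normalE K x n -> is_normalS (gno @` K) (gno x) (gno_normal x n).
Proof.
move=> [n1 Hn]; split; first exact: dot_gno_normal_self.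
  by rewrite dot_gno_gno_normal subrr dot0l mulr0.
move=> _ [z Kz <-]; rewrite dot_gno_gno_normal mulr_ge0_le0 ?Hn// invr_ge0.
by rewrite ltW// mulr_gt0// rho_gt0.
Qed.

(** Orthogonality to [gno x] fixes the o-component of m by its part w = m iota^T, and unit length
    fixes |w|. So regularity passes to the sphere and [get] can only select [gno_normal]. *)
Lemma is_normalS_gno_inv K x m : is_normalS (gno @` K) (gno x) m ->
  exists2 n, is_normalE K x n & m = gno_normal x n.
Proof.
move=> [m1 um Hm]; pose w := m *m iota^T.
have mE : m = (lam * dot m o) *: o + w *m iota by exact: perp_decomp.
have gm z : dot (gno z) m = (rho z)^-1 * (dot m o + dot z w).
  by rewrite /gno dotZl dotDl dot_mulmx (dotC o).
have mo : dot m o = - dot x w.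
  move/eqP: um; rewrite gm mulf_eq0 invr_eq0 gt_eqF ?rho_gt0//= => /eqP; lra.
have wK z : K z -> dot (z - x) w <= 0.
  move=> Kz; have : dot (gno z) m <= 0 by apply: Hm; exists z.
  by rewrite gm mo pmulr_rle0 ?invr_gt0 ?rho_gt0// dotBl; lra.
have w0 : 0 < enorm w.
  rewrite enorm_gt0; apply/eqP => w0; move: m1; rewrite mE mo w0 mul0mx dot0r.
  by rewrite oppr0 mulr0 scale0r addr0 dot0l => /esym/eqP; rewrite oner_eq0.
have [b bw] : exists b, b = enorm w by exists (enorm w).
rewrite -bw in w0; have [n nE] : exists n, n = b^-1 *: w by exists (b^-1 *: w).
have wn : w = b *: n.
  by rewrite nE scalerA mulfV ?scale1r// gt_eqF.
have n1 : dot n n = 1.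
  by rewrite nE dotZl dotZr -sqr_enorm -bw; field; rewrite gt_eqF.
have mE' : m = b *: (n *m iota - (lam * dot x n) *: o).
  rewrite {1}mE mo [in LHS]wn dotZr -scalemxAl scalerBr scalerA addrC.
  by congr (_ + _); rewrite -scaleNr; congr (_ *: _); ring.
have b2 : b ^+ 2 * (1 + lam * dot x n ^+ 2) = 1.
  rewrite -[RHS]m1 mE' dotZl dotZr dotBl !dotBr !dotZl !dotZr dio doi oo.
  by rewrite dot_isometry// n1; field; rewrite gt_eqF.
have bE : b = (Num.sqrt (1 + lam * dot x n ^+ 2))^-1.
  apply/eqP; rewrite -(@eqrXn2 _ 2)// ?(ltW w0) ?invr_ge0 ?(ltW (sg0 _ _))//.
  have s0 : 1 + lam * dot x n ^+ 2 != 0 by rewrite gt_eqF// (lt_le_trans ltr01).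
  by rewrite exprVn sqr_sg; apply/eqP/(mulIf s0); rewrite b2 mulVf.
exists n; last by rewrite mE' bE.
by split=> // z /wK H; rewrite nE dotZr; rewrite mulr_ge0_le0// invr_ge0 ltW.
Qed.

Definition regular_point K x := forall n n', is_normalE K x n -> is_normalE K x n' -> n = n'.

Lemma normalE_regular K x n : regular_point K x -> is_normalE K x n ->
  Defs.normalE K x = n.
Proof. by move=> reg Hn; apply: reg => //; apply: getPex; exists n. Qed.

Lemma normalS_gno K x n : regular_point K x -> is_normalE K x n ->
  normalS (gno @` K) (gno x) = gno_normal x n.
Proof.
move=> reg Hn; have : is_normalS (gno @` K) (gno x) (normalS (gno @` K) (gno x)).
  by apply: getPex; exists (gno_normal x n); exact: is_normalS_gno.
by move=> /is_normalS_gno_inv[n' Hn' ->]; rewrite (reg _ _ Hn' Hn).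
Qed.

End GnomonicBody.

(** * Distance from o to a tangent hyperplane *)

Section TangentDistance.
Context {R : realType} {d : nat}.
Variables (lam : R) (o : 'rV[R]_d.+1) (iota : 'M[R]_(d, d.+1)).
Implicit Types (x z n : 'rV[R]_d) (u v y m : 'rV[R]_d.+1) (K : set 'rV[R]_d).
Hypotheses (lam0 : 0 < lam) (oS : Sp lam o) (oi : identifies_perp o iota).

Local Notation gno := (gno lam o iota).
Local Notation rho := (rho lam).
Local Notation gno_normal := (gno_normal lam o iota).

Let sl0 : 0 < Num.sqrt lam. Proof. by rewrite sqrtr_gt0. Qed.
Let sl2 : Num.sqrt lam ^+ 2 = lam. Proof. by rewrite sqr_sqrtr// ltW. Qed.

Lemma le_acos (a b : R) : -1 <= a -> a <= b -> b <= 1 -> acos b <= acos a.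
Proof.
move=> a1 ab b1; have aI : -1 <= a <= 1 by rewrite a1 (le_trans ab).
have bI : -1 <= b <= 1 by rewrite b1 (le_trans a1).
rewrite leNgt; apply/negP; rewrite -ltr_cos ?in_itv/= ?acos_ge0 ?acos_lepi//.
by rewrite !acosK ?in_itv// ltNge ab.
Qed.

(** p is the orthogonal projection of o. On the hyperplane y.o = y.p, so Cauchy-Schwarz gives lam
    |y.o| <= 1 / s, with equality at y = s p. The distance is thus acos (1 / s) / sqrt lam, and tan
    (acos (1 / s)) = sqrt (s^2 - 1) = sqrt lam * h. *)
Lemma tan_dist_great_hyperplane m (h : R) (s := Num.sqrt (1 + lam * h ^+ 2)) :
  0 <= h -> dot m m = 1 -> dot o m = - h / s ->
  tanS lam (inf (distS lam o @` (Sp lam `&` [set y | dot y m = 0]))) = h.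
Proof.
move=> h0 m1 om; have s1 : 1 <= 1 + lam * h ^+ 2.
  by rewrite lerDl mulr_ge0 ?sqr_ge0// ltW.
have s0 : 0 < s by rewrite sqrtr_gt0 (lt_le_trans ltr01).
have s2 : s ^+ 2 = 1 + lam * h ^+ 2 by rewrite sqr_sqrtr// (le_trans ler01).
have s1' : 1 <= s by rewrite -[leLHS]sqrtr1 ler_wsqrtr.
pose p := o + (h / s) *: m.
have oo : dot o o = lam^-1 by exact: oS.
have h2 : h ^+ 2 = (s ^+ 2 - 1) / lam by rewrite s2; field; rewrite gt_eqF.
have pp : dot p p = (lam * s ^+ 2)^-1.
  rewrite /p dot_addZ oo om m1 !exprMn exprVn mulr1.
  have -> : lam^-1 + 2 * (h / s) * (- h / s) + h ^+ 2 / s ^+ 2 =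
    lam^-1 - h ^+ 2 / s ^+ 2 by field; rewrite !gt_eqF.
  by rewrite h2; field; rewrite !gt_eqF.
have po : dot p o = (lam * s ^+ 2)^-1.
  rewrite /p dotDl dotZl (dotC m) om oo.
  have -> : lam^-1 + h / s * (- h / s) = lam^-1 - h ^+ 2 / s ^+ 2.
    by field; rewrite !gt_eqF.
  by rewrite h2; field; rewrite !gt_eqF.
have sI : -1 <= s^-1 <= 1.
  by rewrite invf_le1// s1' andbT (@le_trans _ _ 0)// ?invr_ge0 ?(ltW s0)// lerN10.
have dI : inf (distS lam o @` (Sp lam `&` [set y | dot y m = 0])) =
    acos s^-1 / Num.sqrt lam.
  have mem : (distS lam o @` (Sp lam `&` [set y | dot y m = 0]))
      (acos s^-1 / Num.sqrt lam).
    exists (s *: p).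
      split=> /=; first by rewrite /Sp/= dotZl dotZr pp; field; rewrite !gt_eqF.
      by rewrite dotZl [dot p m]dotDl dotZl om m1; field; rewrite gt_eqF.
    by rewrite /distS dotZr (dotC o) po; congr (acos _ / _); field; rewrite !gt_eqF.
  have lb : lbound (distS lam o @` (Sp lam `&` [set y | dot y m = 0]))
      (acos s^-1 / Num.sqrt lam).
    move=> _ [y [yS ym] <-]; rewrite /distS ler_pM2r ?invr_gt0//.
    have yy : dot y y = lam^-1 by [].
    have yo : dot o y = dot p y by rewrite /p dotDl dotZl (dotC m) ym mulr0 addr0.
    have bound a : a ^+ 2 * (lam * s ^+ 2) = 1 -> 0 <= a -> a * (Num.sqrt lam)^-1 * lam = s^-1.
      move=> a1 a0; have aE : a = (Num.sqrt lam * s)^-1.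
        apply/eqP; rewrite -(@eqrXn2 _ 2)// ?invr_ge0 ?mulr_ge0 ?(ltW s0)//.
        rewrite exprVn exprMn sl2; apply/eqP.
        by apply: (mulIf (x := lam * s ^+ 2)); rewrite ?a1 ?mulVf// mulf_neq0 ?expf_neq0// gt_eqF.
      by rewrite aE -[in X in _ * X = _]sl2; field; rewrite !gt_eqF.
    have ny : enorm y = (Num.sqrt lam)^-1.
      by rewrite /enorm yy sqrtrV// ltW.
    have np : enorm p * (Num.sqrt lam)^-1 * lam = s^-1.
      apply: bound; last exact: enorm_ge0.
      by rewrite sqr_enorm pp mulVf// mulf_neq0 ?expf_neq0// gt_eqF.
    have : `|lam * dot o y| <= s^-1.
      rewrite normrM (gtr0_norm lam0) yo -np mulrC ler_wpM2r ?(ltW lam0)// -ny.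
      exact: norm_dot_le.
    rewrite ler_norml => /andP[b1 b2]; apply: le_acos => //; last by case/andP: sI.
    by apply: le_trans b1; rewrite lerN2; case/andP: sI.
  apply/eqP; rewrite eq_le; apply/andP; split.
    by apply: ge_inf => //; exists (acos s^-1 / Num.sqrt lam).
  by apply: lb_le_inf => //; exists (acos s^-1 / Num.sqrt lam).
rewrite dI /tanS mulrCA mulfV ?gt_eqF// mulr1 /tan sin_acos// acosK ?in_itv//.
have s1V : 0 <= 1 - s^-1 ^+ 2.
  by rewrite subr_ge0 exprn_ile1 ?invr_ge0 ?(ltW s0)// invf_le1.
have -> : Num.sqrt (1 - s^-1 ^+ 2) / s^-1 = Num.sqrt ((1 - s^-1 ^+ 2) * s ^+ 2).
  by rewrite invrK sqrtrM// sqrtr_sqr gtr0_norm.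
have -> : (1 - s^-1 ^+ 2) * s ^+ 2 = lam * h ^+ 2.
  by rewrite h2; field; rewrite !gt_eqF.
by rewrite sqrtrM ?ltW// sqrtr_sqr ger0_norm// mulrAC mulfV ?mul1r// gt_eqF.
Qed.

Lemma fS_gno K x n : regular_point K x -> is_normalE K x n -> 0 <= dot x n ->
  fS lam o (gno @` K) (gno x) =
  Num.sqrt ((lam + dot x n ^+ 2) / (1 + lam * dot x n ^+ 2)).
Proof.
move=> reg Hn h0; rewrite /fS /tan_dist_tangent /tangent_hyperplane.
rewrite (normalS_gno lam0 oS oi reg Hn) (tan_dist_great_hyperplane h0)//.
  exact: dot_gno_normal_self Hn.1.
by rewrite dot_gno_normal_o.
Qed.

End TangentDistance.

Section TangentApproximation.
Context {R : realType} {d : nat}.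
Variable K : set 'rV[R]_d.
Hypotheses (cK : compact K) (vK : convex_set K) (K0 : interior K 0).
Implicit Types (x z n : 'rV[R]_d).

(* On the segment from x + s (t + s n), outside K, to the interior point
   (1 - s) x there is a boundary point; the expansion forces it to lie within
   O(s^2) of the tangent vector s t. *)
Lemma tangent_approx k x n (B : 'M[R]_(k, d)) (S : 'M[R]_k) t (eta delta : R) :
  is_normalE K x n -> bdE K x ->
  second_order [set v | bdE K (x + v)] n B S -> dot t n = 0 ->
  0 < eta -> 0 < delta ->
  exists s w, [/\ 0 < s, enorm (w - t) <= eta, enorm (s *: w) < delta
    & bdE K (x + s *: w)].
Proof.
move=> Hn xK [_ HS] tn eta0 delta0; have Kx := bdE_sub cK xK.
have [r r0 rK] := interior0_ball K0.
have h0 : 0 < dot x n by exact: lt_le_trans (normalE_height_ge (ltW r0) rK Hn).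
have K00 : K 0 by apply: rK; rewrite enorm0 ltW.
have n1 := Hn.1; have en1 := enorm1 n1.
have [C C0 HC] := mulmx_bilinear_le (B^T *m S *m B).
have [d1 d10 Hd1] := HS 1 ltr01.
pose W := enorm t + 1 + enorm x.
have W0 : 0 < W by rewrite /W addrAC ltr_wpDl// addr_ge0// enorm_ge0.
pose G := (1 + (C + 1) * W ^+ 2) / dot x n.
have G0 : 0 < G by rewrite divr_gt0// addr_gt0// mulr_gt0 ?exprn_gt0// addr_gt0.
have GW0 : 0 < 1 + G * W by rewrite addr_gt0// mulr_gt0.
(* W bounds |w|, and G will give tau <= s G, hence |w - t| <= s (1 + G W) <= eta. The factors 2 make
   |s w| <= s W strictly less than delta and d1. *)
pose s := Num.min (Num.min 1 (eta / (1 + G * W)))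
                  (Num.min (delta / (2 * W)) (d1 / (2 * W))).
have s0 : 0 < s by rewrite !lt_min ltr01 !divr_gt0// mulr_gt0.
have [s1 [s2 [s3 s4]]] : s <= 1 /\ s <= eta / (1 + G * W) /\
    s <= delta / (2 * W) /\ s <= d1 / (2 * W).
  by rewrite !ge_min !lexx ?orbT.
have [||tau /andP[tau0 tau1] bd] := @segment_boundary _ _ K (x + s *: (t + s *: n)) ((1 - s) *: x).
- move=> Ky; have := Hn.2 _ Ky; rewrite addrAC subrr add0r dotZl dotDl tn add0r.
  by rewrite dotZl n1 mulr1 leNgt !mulr_gt0.
- have := @convex_setP _ _ K 0 x s vK K00 Kx; rewrite scaler0 add0r.
  by apply; rewrite s1 ltW.
pose w := (1 - tau) *: (t + s *: n) - tau *: x.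
have xw : x + s *: w = x + s *: (t + s *: n) +
    tau *: ((1 - s) *: x - (x + s *: (t + s *: n))).
  by rewrite /w; apply/rowP => i; rewrite !mxE; ring.
rewrite -xw in bd.
have wW : enorm w <= W.
  rewrite /w (le_trans (enormD _ _))// enormN !enormZ (ger0_norm tau0).
  rewrite ger0_norm ?subr_ge0// lerD//; last by rewrite ler_piMl ?enorm_ge0.
  apply: (@le_trans _ _ (enorm (t + s *: n))).
    by rewrite ler_piMl ?enorm_ge0//; lra.
  rewrite (le_trans (enormD _ _))// lerD2l enormZ en1 mulr1 gtr0_norm//.
have swW : enorm (s *: w) <= s * W by rewrite enormZ gtr0_norm// ler_pM2l.
have small e : 0 < e -> s <= e / (2 * W) -> enorm (s *: w) < e.
  move=> e0; rewrite ler_pdivlMr ?mulr_gt0// => se; apply: (le_lt_trans swW).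
  by have := mulr_gt0 s0 W0; lra.
exists s, w; split=> //; last exact: small.
have := Hd1 _ bd (small _ d10 s4); rewrite mul1r dot_congruence.
set Q := dot (_ *m _) _ => HQ.
have QB : `|Q| <= C * (s * W) ^+ 2.
  rewrite (le_trans (HC _ _))//.
  have -> : C * (s * W) ^+ 2 = C * (s * W) * (s * W) by ring.
  apply: ler_pM => //.
  - by rewrite mulr_ge0 ?enorm_ge0// ltW.
  - exact: enorm_ge0.
  - by rewrite ler_wpM2l// ltW.
have sW2 : enorm (s *: w) ^+ 2 <= (s * W) ^+ 2.
  by rewrite lerXn2r ?nnegrE ?enorm_ge0// mulr_ge0// ltW.
have wn : dot (s *: w) n = s * ((1 - tau) * s - tau * dot x n).
  by rewrite dotZl /w dotBl !dotZl dotDl tn add0r dotZl n1 mulr1.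
(* The normal component of s w contains - s tau (x.n), while the expansion makes it O(s^2); since
   x.n > 0, tau is O(s). *)
have tauh : s * (tau * dot x n) <= s * (s * (1 + (C + 1) * W ^+ 2)).
  have : - dot (s *: w) n <= `|Q| / 2 + (s * W) ^+ 2.
    by move: HQ; rewrite ler_norml => /andP[_]; have := ler_norm Q; lra.
  have : 0 <= s * (s * tau) by rewrite !mulr_ge0// ltW.
  by rewrite wn; have := normr_ge0 Q; move: QB; rewrite exprMn; lra.
have tauG : tau <= s * G by rewrite /G mulrA ler_pdivlMr// -(ler_pM2l s0).
have -> : w - t = s *: n - tau *: (t + s *: n + x).
  by rewrite /w; apply/rowP => i; rewrite !mxE; ring.
rewrite (le_trans (enormD _ _))// enormN !enormZ en1 mulr1 (gtr0_norm s0).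
rewrite (ger0_norm tau0); move: s2; rewrite ler_pdivlMr// => /(le_trans _); apply.
rewrite mulrDr mulr1 lerD2l mulrA ler_pM ?enorm_ge0//.
rewrite (le_trans (enormD _ _))// lerD2r (le_trans (enormD _ _))// lerD2l.
by rewrite enormZ en1 mulr1 gtr0_norm.
Qed.

End TangentApproximation.

(** * Transformation of the curvature *)

Section MatrixExtensionality.
Context {R : realType}.

Lemma mx_dot_ext k m (A B : 'M[R]_(k, m)) :
  (forall r s, dot (r *m A) s = dot (r *m B) s) -> A = B.
Proof.
move=> H; apply/row_matrixP => i; rewrite !rowE; set r := delta_mx _ _.
apply/eqP; rewrite -subr_eq0 -dot_eq0; apply/eqP.
by rewrite dotBl H subrr.
Qed.

(** The matrix determinant lemma: both sides are determinants of block triangular matrices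
    intertwined by the unipotent T. *)
Lemma det_rank1_update k (c : R) (a : 'rV[R]_k) :
  \det (1%:M + c *: (a^T *m a)) = 1 + c * dot a a.
Proof.
pose T : 'M[R]_(1 + k) := block_mx 1%:M 0 a^T 1%:M.
have detT : \det T = 1 by rewrite det_lblock !det1 mulr1.
have aa : a *m a^T = (dot a a)%:M by rewrite [a *m a^T]mx11_scalar -dotE.
have E : T *m block_mx 1%:M (- c *: a) 0 (1%:M + c *: (a^T *m a)) =
    block_mx (1 + c * dot a a)%:M (- c *: a) 0 1%:M *m T.
  rewrite !mulmx_block !mul1mx !mulmx1 !mulmx0 !mul0mx !addr0 !add0r.
  rewrite -scalemxAl aa scale_scalar_mx -raddfD /= mulNr addrK.
  by rewrite -scalemxAr (scaleNr c (a^T *m a)) addrCA addNr addr0.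
have := congr1 determinant E.
by rewrite !det_mulmx detT mulr1 mul1r !det_ublock !det1 mul1r mulr1 det_scalar1.
Qed.

End MatrixExtensionality.

Section TangentMap.
Context {R : realType} {d : nat}.
Variables (lam : R) (o : 'rV[R]_d.+1) (iota : 'M[R]_(d, d.+1)).
Hypotheses (lam0 : 0 < lam) (oS : Sp lam o) (oi : identifies_perp o iota).
Variables (x n : 'rV[R]_d).
Hypotheses (n1 : dot n n = 1) (d0 : (0 < d)%N).
Implicit Types (u v y m : 'rV[R]_d.+1) (z : 'rV[R]_d).

Local Notation u := (gno lam o iota x).
Local Notation m := (gno_normal lam o iota x n).
Local Notation r := (rho lam x).
Local Notation s := (Num.sqrt (1 + lam * dot x n ^+ 2)).

Let oo : dot o o = lam^-1. Proof. exact: oS. Qed.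
Let ii : iota *m iota^T = 1%:M. Proof. by case: oi. Qed.
Let oiT : o *m iota^T = 0. Proof. by case: oi. Qed.
Let doi z : dot o (z *m iota) = 0. Proof. exact: dot_o_iota. Qed.
Let dio z : dot (z *m iota) o = 0. Proof. by rewrite dotC doi. Qed.
Let r0 : 0 < r. Proof. exact: rho_gt0. Qed.
Let s2 : s ^+ 2 = 1 + lam * dot x n ^+ 2.
Proof. by rewrite sqr_sqrtr// addr_ge0// mulr_ge0 ?sqr_ge0// ltW. Qed.
Let s0 : 0 < s.
Proof. by rewrite sqrtr_gt0 ltr_pwDl// mulr_ge0 ?sqr_ge0// ltW. Qed.
Let uu : dot u u = lam^-1. Proof. exact: gno_Sp. Qed.
Let um : dot u m = 0.
Proof. by rewrite dot_gno_gno_normal// subrr dot0l mulr0. Qed.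
Let mm : dot m m = 1. Proof. exact: dot_gno_normal_self. Qed.
Let ru : r *: u = o + x *m iota.
Proof. by rewrite scalerA mulfV ?scale1r// gt_eqF. Qed.

(* Up to a scalar factor 1 + o(1), the differentials at u and at x of the chart
   y |-> ungno y - x and of its inverse. *)
Definition push_mx : 'M[R]_(d.+1, d) := r *: (iota^T - lam *: (o^T *m x)).

Definition pull_mx : 'M[R]_(d, d.+1) := r^-1 *: (iota - (lam / r) *: (x^T *m u)).

Lemma mul_push y : y *m push_mx = r *: (y *m iota^T - (lam * dot y o) *: x).
Proof. by rewrite /push_mx -scalemxAr mulmxBr -scalemxAr row_outer scalerA. Qed.

Lemma mul_pull z : z *m pull_mx = r^-1 *: (z *m iota - (lam / r * dot z x) *: u).
Proof. by rewrite /pull_mx -scalemxAr mulmxBr -scalemxAr row_outer scalerA. Qed.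

Lemma dot_push y : dot (y *m push_mx) n = r * s * dot y m.
Proof.
rewrite mul_push dotZl dotBl dotZl dot_mulmx trmxK /gno_normal dotZr dotBr dotZr.
by field; rewrite gt_eqF.
Qed.

Lemma dot_pull z : dot (z *m pull_mx) m = (r * s)^-1 * dot z n.
Proof.
rewrite mul_pull dotZl dotBl dotZl um mulr0 subr0 /gno_normal dotZr dotBr dotZr.
by rewrite dio mulr0 subr0 dot_isometry// invfM; ring.
Qed.

Lemma dot_pull_gno z : dot (z *m pull_mx) u = 0.
Proof.
rewrite mul_pull dotZl dotBl dotZl uu /gno dotZr dotDr dio add0r dot_isometry//.
by field; rewrite !gt_eqF.
Qed.

Let perp_iota y : dot y u = 0 -> dot (y *m iota^T) x = - dot y o.
Proof.
move=> yu; rewrite dot_mulmx trmxK; have : dot y (r *: u) = 0 by rewrite dotZr yu mulr0.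
by rewrite ru dotDr; lra.
Qed.

Lemma push_pull y : dot y u = 0 -> y *m push_mx *m pull_mx = y.
Proof.
move=> yu; rewrite mul_pull mul_push -scalemxAl.
have -> : (y *m iota^T - (lam * dot y o) *: x) *m iota = y - (lam * dot y o * r) *: u.
  rewrite mulmxBl -mulmxA (iotaT_iota lam0 oS oi) mulmxBr mulmx1 -scalemxAr.
  rewrite row_outer scalerA -scalemxAl -(scalerA (lam * _)) ru scalerDr opprD.
  by rewrite addrA.
rewrite dotZl dotBl dotZl perp_iota//.
have -> : lam / r * (r * (- dot y o - lam * dot y o * dot x x)) =
    - (lam * dot y o) * r ^+ 2.
  by rewrite sqr_rho//; field; rewrite gt_eqF.
rewrite mulNr scaleNr opprK [r *: (y - _)]scalerBr [r *: (_ *: u)]scalerA.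
have -> : r * (lam * dot y o * r) = lam * dot y o * r ^+ 2 by ring.
by rewrite subrK scalerA mulVf ?scale1r// gt_eqF.
Qed.

Lemma dot_push_push y y' : dot y u = 0 -> dot y' u = 0 ->
  dot (y *m push_mx) (y' *m push_mx) =
  r ^+ 2 * (dot y y' + lam * r ^+ 2 * (dot y o * dot y' o)).
Proof.
move=> yu y'u; rewrite !mul_push dotZl dotZr dotBl !dotBr !dotZl !dotZr.
rewrite (perp_iota yu) (dotC x (y' *m _)) (perp_iota y'u).
have -> : dot (y *m iota^T) (y' *m iota^T) = dot y y' - lam * (dot y o * dot y' o).
  rewrite dot_mulmx trmxK -mulmxA (iotaT_iota lam0 oS oi) mulmxBr mulmx1.
  by rewrite -scalemxAr row_outer dotBr !dotZr; ring.
by rewrite [LHS]mulrA -expr2 sqr_rho//; ring.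
Qed.

Variables (B : 'M[R]_(d.-1, d)) (B' : 'M[R]_(d.-1, d.+1)).
Hypotheses (BB : B *m B^T = 1%:M) (nB : n *m B^T = 0).
Hypotheses (BB' : B' *m B'^T = 1%:M) (uB' : u *m B'^T = 0) (mB' : m *m B'^T = 0).

Let frameB : B^T *m B = 1%:M - n^T *m n.
Proof. exact: orthonormal_frame1. Qed.

Lemma frame_gno : B'^T *m B' = 1%:M - lam *: (u^T *m u) - m^T *m m.
Proof.
have sl : Num.sqrt lam ^+ 2 = lam by rewrite sqr_sqrtr// ltW.
rewrite (@orthonormal_frame2 _ _ B' (Num.sqrt lam *: u) m)//.
- by rewrite [(_ *: u)^T]linearZ /= -scalemxAl -scalemxAr scalerA -expr2 sl.
- by rewrite dotZl dotZr mulrA -expr2 sl uu mulfV// gt_eqF.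
- by rewrite dotZl um mulr0.
- by rewrite -scalemxAl uB' scaler0.
Qed.

Let perpB' (t : 'rV[R]_d.-1) : dot (t *m B') u = 0.
Proof. by rewrite dot_mulmx uB' dot0r. Qed.

Let normB' (t : 'rV[R]_d.-1) : dot (t *m B' *m push_mx) n = 0.
Proof. by rewrite dot_push dot_mulmx mB' dot0r mulr0. Qed.

Let projB (t : 'rV[R]_d.-1) :
  t *m B' *m push_mx *m B^T *m B = t *m B' *m push_mx.
Proof.
by rewrite -mulmxA frameB mulmxBr mulmx1 row_outer normB' scale0r subr0.
Qed.

Lemma push_pull_frames : (B' *m push_mx *m B^T) *m (B *m pull_mx *m B'^T) = 1%:M.
Proof.
apply: mx_dot_ext => t t'; rewrite !mulmxA projB push_pull// -mulmxA BB'.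
by rewrite mulmx1.
Qed.

(** M M^T is r^2 times a rank-one update of the identity along a = o B'^T. As the components of o
    along u and m are known, Pythagoras gives |a|^2 = 1 / (lam s^2) - 1 / (lam r^2), so the update
    has determinant r^2 / s^2. *)
Lemma det_push_frames : \det (B' *m push_mx *m B^T) ^+ 2 = r ^+ d.*2 / s ^+ 2.
Proof.
set M := B' *m _ *m _.
have [a aE] : exists a, a = o *m B'^T by exists (o *m B'^T).
have MM : M *m M^T = r ^+ 2 *: (1%:M + (lam * r ^+ 2) *: (a^T *m a)).
  apply: mx_dot_ext => t t'; rewrite mulmxA dot_mulmx trmxK /M !mulmxA.
  rewrite dotC dot_mulmx trmxK projB dotC dot_push_push// dot_isometry//.
  rewrite -scalemxAr mulmxDr mulmx1 -scalemxAr row_outer dotZl dotDl !dotZl.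
  by rewrite (dot_mulmx t) (dot_mulmx t') -aE (dotC a t').
rewrite expr2 -{2}det_tr -det_mulmx MM detZ det_rank1_update.
have -> : dot a a = lam^-1 - (lam * r ^+ 2)^-1 - dot x n ^+ 2 / s ^+ 2.
  rewrite aE dot_mulmx trmxK -mulmxA frame_gno !mulmxBr mulmx1 -scalemxAr.
  rewrite !row_outer; have expand (U V : 'rV[R]_d.+1) :
      dot o (o - lam *: (dot o U *: U) - dot o V *: V) =
      lam^-1 - lam * dot o U ^+ 2 - dot o V ^+ 2.
    by rewrite !dotBr !dotZr oo; ring.
  rewrite expand dot_gno_normal_o// (dotC o u) dot_gno_o//.
  by field; rewrite !gt_eqF.
have -> : lam^-1 - (lam * r ^+ 2)^-1 - dot x n ^+ 2 / s ^+ 2 =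
    (s ^+ 2 - lam * dot x n ^+ 2) / (lam * s ^+ 2) - (lam * r ^+ 2)^-1.
  by field; rewrite !gt_eqF.
have -> : s ^+ 2 - lam * dot x n ^+ 2 = 1 by rewrite s2 addrK.
rewrite -exprM mul2n; have -> : d.*2 = (d.-1.*2 + 2)%N by rewrite -[d in LHS]prednK// doubleS addn2.
rewrite exprD; move: (r ^+ d.-1.*2) => X.
by field; rewrite !gt_eqF.
Qed.

End TangentMap.

(** * Transport of tangent frames *)

Section FrameExistence.
Context {R : realType} {d : nat}.
Variables (lam : R) (o : 'rV[R]_d.+1) (iota : 'M[R]_(d, d.+1)).
Hypotheses (lam0 : 0 < lam) (oS : Sp lam o) (oi : identifies_perp o iota).
Variables (x n : 'rV[R]_d).
Hypotheses (n1 : dot n n = 1).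

Local Notation u := (gno lam o iota x).
Local Notation m := (gno_normal lam o iota x n).
Local Notation r := (rho lam x).
Local Notation s := (Num.sqrt (1 + lam * dot x n ^+ 2)).

Let oo : dot o o = lam^-1. Proof. exact: oS. Qed.
Let ii : iota *m iota^T = 1%:M. Proof. by case: oi. Qed.
Let oiT : o *m iota^T = 0. Proof. by case: oi. Qed.
Let doi z : dot o (z *m iota) = 0. Proof. exact: dot_o_iota. Qed.
Let dio z : dot (z *m iota) o = 0. Proof. by rewrite dotC doi. Qed.
Let r0 : 0 < r. Proof. exact: rho_gt0. Qed.
Let s2 : s ^+ 2 = 1 + lam * dot x n ^+ 2.
Proof. by rewrite sqr_sqrtr// addr_ge0// mulr_ge0 ?sqr_ge0// ltW. Qed.
Let s0 : 0 < s.
Proof. by rewrite sqrtr_gt0 ltr_pwDl// mulr_ge0 ?sqr_ge0// ltW. Qed.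
Let uu : dot u u = lam^-1. Proof. exact: gno_Sp. Qed.
Let um : dot u m = 0.
Proof. by rewrite dot_gno_gno_normal// subrr dot0l mulr0. Qed.
Let mm : dot m m = 1. Proof. exact: dot_gno_normal_self. Qed.

(** The point of the tangent hyperplane nearest to o, that is, [gno] of (x.n) n. It may coincide
    with u, so the reflection uses u + e0, for which u.(u + e0) > 0, and not u - e0. *)
Let e0 := s^-1 *: (o + dot x n *: (n *m iota)).
Let w := u + e0.

Let e0e0 : dot e0 e0 = lam^-1.
Proof.
rewrite /e0 dotZl dotZr dotDl !dotDr !dotZl !dotZr oo doi dio dot_isometry// n1.
have -> : s^-1 * (s^-1 * (lam^-1 + dot x n * 0 + (dot x n * 0 + dot x n * (dot x n * 1)))) =
  (1 + lam * dot x n ^+ 2) / (lam * s ^+ 2) by field; rewrite !gt_eqF.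
by rewrite -{1}s2; field; rewrite !gt_eqF.
Qed.

Let e0m : dot e0 m = 0.
Proof.
rewrite /e0 /gno_normal !(dotZl, dotZr, dotDl, dotBr) oo doi dio dot_isometry// n1.
by field; rewrite !gt_eqF.
Qed.

Let ue0 : dot u e0 = s / (lam * r).
Proof.
rewrite /e0 /gno !(dotZl, dotZr, dotDl, dotDr) oo doi dio dot_isometry//.
transitivity ((1 + lam * dot x n ^+ 2) / (lam * r * s)).
  by field; rewrite !gt_eqF.
by rewrite -{1}s2; field; rewrite !gt_eqF.
Qed.

Let ww : dot w w = 2 * dot u w.
Proof. by rewrite /w !dotDl !dotDr (dotC e0 u) uu e0e0; ring. Qed.

Let uw0 : 0 < dot u w.
Proof. by rewrite /w dotDr uu ue0 addr_gt0 ?invr_gt0// divr_gt0// mulr_gt0. Qed.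

(* The reflection exchanging u and - e0 and fixing m. As e0 and m span the same
   plane as o and n iota, it carries the orthogonal complement of that plane,
   where iota puts the tangent space of bd K, onto the complement of u and m. *)
Let refl : 'M[R]_d.+1 := 1%:M - (dot u w)^-1 *: (w^T *m w).

Let mul_refl y : y *m refl = y - (dot y w / dot u w) *: w.
Proof.
by rewrite /refl mulmxBr mulmx1 -scalemxAr row_outer scalerA mulrC.
Qed.

Let refl_u : u *m refl = - e0.
Proof. by rewrite mul_refl mulfV ?gt_eqF// scale1r /w opprD addNKr. Qed.

Let refl_m : m *m refl = m.
Proof.
by rewrite mul_refl /w dotDr (dotC m) um (dotC m) e0m addr0 mul0r scale0r subr0.
Qed.

Let refl_sym : refl^T = refl.
Proof.
rewrite /refl linearB /= trmx1 linearZ /=; congr (_ - _ *: _).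
by rewrite trmx_mul trmxK.
Qed.

Let refl2 : refl *m refl = 1%:M.
Proof.
apply: mx_dot_ext => y y'; rewrite mulmxA !mul_refl mulmx1.
have -> : dot (y - (dot y w / dot u w) *: w) w = - dot y w.
  by rewrite dotBl dotZl ww; field; rewrite gt_eqF.
by rewrite mulNr scaleNr opprK subrK.
Qed.

Let refl_e0 : e0 *m refl = - u.
Proof.
by rewrite -[e0]opprK -refl_u mulNmx -mulmxA refl2 mulmx1.
Qed.

Lemma exists_frame_gno k (B : 'M[R]_(k, d)) :
  B *m B^T = 1%:M -> n *m B^T = 0 ->
  exists B' : 'M[R]_(k, d.+1),
    [/\ B' *m B'^T = 1%:M, u *m B'^T = 0 & m *m B'^T = 0].
Proof.
move=> BB nB; exists (B *m iota *m refl); rewrite !trmx_mul refl_sym; split.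
- by rewrite !mulmxA -(mulmxA _ refl refl) refl2 mulmx1 -(mulmxA _ iota iota^T) ii mulmx1.
- rewrite !mulmxA refl_u !mulNmx /e0 -!scalemxAl mulmxDl oiT add0r.
  by rewrite -scalemxAl -mulmxA ii mulmx1 -scalemxAl nB !scaler0 oppr0.
- rewrite !mulmxA refl_m /gno_normal -!scalemxAl mulmxBl -scalemxAl oiT.
  by rewrite scaler0 subr0 -(mulmxA n) ii mulmx1 nB scaler0.
Qed.

(** The image of o under the reflection is a combination of u and m, so reflecting B' makes its rows
    orthogonal to o, and they lie in the range of iota. *)
Lemma exists_frame_ungno k (B' : 'M[R]_(k, d.+1)) :
  B' *m B'^T = 1%:M -> u *m B'^T = 0 -> m *m B'^T = 0 ->
  exists B : 'M[R]_(k, d), B *m B^T = 1%:M /\ n *m B^T = 0.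
Proof.
move=> BB uB mB.
have oB : o *m refl *m B'^T = 0.
  have oE : o = s^-1 *: (e0 - dot x n *: m).
    rewrite /e0 /gno_normal; move: (n *m iota) => N; apply/rowP => i.
    rewrite !mxE; transitivity ((1 + lam * dot x n ^+ 2) / s ^+ 2 * o 0 i).
      by rewrite -{1}s2 mulfV ?mul1r// gt_eqF// exprn_gt0.
    by field; rewrite gt_eqF.
  have -> : o *m refl = s^-1 *: (- u - dot x n *: m).
    by rewrite {1}oE -scalemxAl mulmxBl refl_e0 -scalemxAl refl_m.
  rewrite -scalemxAl mulmxBl mulNmx uB -scalemxAl mB.
  by rewrite scaler0 oppr0 addr0 scaler0.
have Bo : B' *m refl *m o^T = 0.
  by apply: trmx_inj; rewrite !trmx_mul trmxK refl_sym mulmxA oB trmx0.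
exists (B' *m refl *m iota^T); rewrite !trmx_mul trmxK refl_sym; split.
  rewrite -(mulmxA _ iota^T) (mulmxA iota^T) (iotaT_iota lam0 oS oi).
  rewrite mulmxBl mul1mx mulmxBr -scalemxAl -scalemxAr !mulmxA Bo !mul0mx scaler0.
  by rewrite subr0 -(mulmxA _ refl refl) refl2 mulmx1.
have -> : n *m (iota *m (refl *m B'^T)) = s *: (m *m refl *m B'^T) +
    (lam * dot x n) *: (o *m refl *m B'^T).
  rewrite !mulmxA scalemxAl scalemxAl scalemxAl scalemxAl -mulmxDl -mulmxDl.
  congr (_ *m _ *m _); rewrite scalerA mulfV ?gt_eqF// scale1r.
  by rewrite subrK.
by rewrite refl_m mB oB !scaler0 addr0.
Qed.

End FrameExistence.

(** * The exponential map in the gnomonic chart *)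

Section TrigLimits.
Context {R : realType}.

Lemma derive0_quotient (f : R -> R) (df : R) : is_derive (0 : R) 1 f df -> f 0 = 0 ->
  forall eta : R, 0 < eta -> exists2 delta : R, 0 < delta &
    forall t, 0 < t < delta -> `|f t / t - df| <= eta.
Proof.
move=> Df f0 eta eta0; have Dv := @derive_val _ _ _ _ _ _ _ Df.
have cv := @ex_derive _ _ _ _ _ _ _ Df.
have : (fun h : R => h^-1 *: ((f \o shift 0) (h *: 1) - f 0)) @ 0^' --> df.
  by rewrite -Dv; exact: cv.
move=> /cvgrPdist_le /(_ _ eta0)/nbhs_ballP[delta /= delta0 H].
exists delta => // t /andP[t0 td]; have := H t.
rewrite /ball/= sub0r normrN gtr0_norm// => /(_ td).
rewrite gt_eqF// => /(_ isT); rewrite f0 subr0 addr0.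
by rewrite /GRing.scale/= mulr1 distrC mulrC.
Qed.

Lemma sin_quotient (eta : R) : 0 < eta -> exists2 delta : R, 0 < delta &
  forall t : R, 0 < t < delta -> `|sin t / t - 1| <= eta.
Proof.
by move=> eta0; rewrite -cos0; apply: derive0_quotient => //; exact: sin0.
Qed.

Lemma atan_quotient (eta : R) : 0 < eta -> exists2 delta : R, 0 < delta &
  forall t : R, 0 < t < delta -> `|atan t / t - 1| <= eta.
Proof.
move=> eta0; have := @derive0_quotient atan _ (is_derive1_atan 0) (atan0 R) _ eta0.
by rewrite expr0n addr0 invr1.
Qed.

Lemma cos_near0 (eta : R) : 0 < eta -> exists2 delta : R, 0 < delta &
  forall t : R, 0 < t < delta -> `|cos t - 1| <= eta.
Proof.
move=> eta0; have := @continuous_cos R 0.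
move=> /cvgrPdist_le /(_ _ eta0)/nbhs_ballP[delta /= delta0 H].
exists delta => // t /andP[t0 td]; have := H t.
by rewrite /ball/= sub0r normrN gtr0_norm// cos0 distrC; exact.
Qed.

End TrigLimits.

Section ExponentialChart.
Context {R : realType} {d : nat}.
Variables (lam : R) (o : 'rV[R]_d.+1) (iota : 'M[R]_(d, d.+1)).
Hypotheses (lam0 : 0 < lam) (oS : Sp lam o) (oi : identifies_perp o iota).
Variable (x : 'rV[R]_d).
Implicit Types (v y : 'rV[R]_d.+1) (z : 'rV[R]_d).

Local Notation gno := (gno lam o iota).
Local Notation ungno := (ungno lam o iota).
Local Notation u := (gno x).
Local Notation r := (rho lam x).
Local Notation push := (push_mx lam o iota x).
Local Notation pull := (pull_mx lam o iota x).

Let oo : dot o o = lam^-1. Proof. exact: oS. Qed.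
Let r0 : 0 < r. Proof. exact: rho_gt0. Qed.
Let uu : dot u u = lam^-1. Proof. exact: gno_Sp. Qed.
Let sl0 : 0 < Num.sqrt lam. Proof. by rewrite sqrtr_gt0. Qed.
Let sl2 : Num.sqrt lam ^+ 2 = lam. Proof. by rewrite sqr_sqrtr// ltW. Qed.

Lemma expS0 y : expS lam y 0 = y.
Proof.
by rewrite /expS /geodesicS enorm0 mulr0 cos0 scale1r scaler0 scaler0 addr0.
Qed.

Lemma expS_neq0 y v : v != 0 -> expS lam y v =
  cos (Num.sqrt lam * enorm v) *: y +
  (sin (Num.sqrt lam * enorm v) / (Num.sqrt lam * enorm v)) *: v.
Proof.
move=> v0; rewrite /expS /geodesicS scalerA; congr (_ + _ *: _).
by rewrite invfM mulrA.
Qed.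

Lemma expS_Sp y v : Sp lam y -> dot v y = 0 -> Sp lam (expS lam y v).
Proof.
move=> yS vy; have yy : dot y y = lam^-1 by []. have [->|v0] := eqVneq v 0; first by rewrite expS0.
have nv : 0 < enorm v by rewrite enorm_gt0.
rewrite /Sp/= expS_neq0//; set th := _ * enorm v.
have th0 : 0 < th by rewrite mulr_gt0.
rewrite dot_addZ !dotZl dotZr yy (dotC y) vy -sqr_enorm.
have -> : enorm v ^+ 2 = th ^+ 2 / lam.
  by rewrite /th exprMn sl2 mulrAC mulfV ?mul1r// gt_eqF.
transitivity ((cos th ^+ 2 + sin th ^+ 2) / lam); last by rewrite cos2Dsin2 mul1r.
by field; rewrite !gt_eqF.
Qed.

Lemma gno_unique y z (k : R) : Sp lam y -> 0 < k -> y = k *: (o + z *m iota) ->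
  y = gno z.
Proof.
move=> yS k0 yE; have yo : dot y o = k / lam.
  by rewrite yE dotZl dotDl oo (dotC _ o) (dot_o_iota oi) addr0.
rewrite -(ungnoK lam0 oS oi yS) ?yo ?divr_gt0//; congr gno.
have [ii oiT] := oi.
rewrite /ungno yo {1}yE -scalemxAl mulmxDl oiT add0r -mulmxA ii mulmx1 scalerA.
have -> : (lam * (k / lam))^-1 * k = 1 by field; rewrite !gt_eqF.
by rewrite scale1r.
Qed.

(** The gnomonic projection straightens geodesics, so z - x is exactly parallel to v push. The
    matrix of [ungnoB] kills the u-part of cos th u + k v, with k = sin th / th, which leaves the
    factor 1 + a = k / D, where D = lam r (gno z).o tends to 1. *)
Lemma exp_to_chart (eta : R) : 0 < eta -> exists2 delta, 0 < delta &
  forall v z, dot v u = 0 -> enorm v < delta -> expS lam u v = gno z ->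
    exists2 a, `|a| <= eta & z - x = (1 + a) *: (v *m push).
Proof.
(* With |k - 1| <= e and |D - 1| <= 3 e, the error is at most 4 e / D, where D > 1 / 2. *)
move=> eta0; pose e := Num.min (1 / 10) (eta / 10).
have e0 : 0 < e by rewrite lt_min !divr_gt0.
have e1 : e <= 1 / 10 by rewrite ge_min lexx.
have e2 : e <= eta / 10 by rewrite ge_min lexx orbT.
have [d1 d10 H1] := sin_quotient e0; have [d2 d20 H2] := cos_near0 e0.
pose W := lam * r * enorm o + 1.
have W0 : 0 < W by rewrite ltr_wpDl// !mulr_ge0 ?enorm_ge0// ltW.
pose delta := Num.min (Num.min d1 d2 / Num.sqrt lam) (e / W).
have delta0 : 0 < delta by rewrite lt_min !divr_gt0// lt_min d10.
exists delta => // v z vu; rewrite lt_min => /andP[].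
rewrite ltr_pdivlMr// mulrC lt_min => /andP[v1 v2] v3 vz.
have [v0|v0] := eqVneq v 0.
  exists 0; first by rewrite normr0 ltW.
  move: vz; rewrite v0 expS0 => /(gno_inj lam0 oS oi) ->.
  by rewrite subrr mul0mx scaler0.
have nv : 0 < enorm v by rewrite enorm_gt0.
move: vz; rewrite expS_neq0//; set th := Num.sqrt lam * enorm v in v1 v2 *.
have th0 : 0 < th by rewrite mulr_gt0.
set k := sin th / th => vz.
have {}H1 : `|k - 1| <= e by apply: H1; rewrite th0.
have {}H2 : `|cos th - 1| <= e by apply: H2; rewrite th0.
pose w := lam * r * dot v o.
have We : `|w| <= e.
  rewrite normrM gtr0_norm ?mulr_gt0//; move: v3; rewrite ltr_pdivlMr// => v3.
  apply: (@le_trans _ _ (enorm v * W)); last exact: ltW.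
  rewrite mulrC; apply: (@le_trans _ _ (enorm v * enorm o * (lam * r))).
    by rewrite ler_wpM2r ?mulr_ge0 ?norm_dot_le// ltW.
  by rewrite -mulrA ler_wpM2l ?enorm_ge0// mulrC lerDl.
have kw : `|k * w| <= 2 * e.
  rewrite normrM ler_pM//; move: H1; rewrite !ler_norml => /andP[? ?].
  by apply/andP; split; lra.
pose D := cos th + k * w.
have DE : lam * r * dot (gno z) o = D.
  rewrite -vz dotDl (dotZl _ u) (dotZl _ v) dot_gno_o// /D /w; field.
  by rewrite !gt_eqF.
have /andP[D1 D2] : 1 - 3 * e <= D <= 1 + 3 * e.
  by move: H2 kw; rewrite !ler_norml /D => /andP[? ?] /andP[? ?]; apply/andP; split; lra.
have D0 : 0 < D by lra.
exists (k / D - 1).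
  rewrite (_ : k / D - 1 = (k - D) / D); last by field; rewrite gt_eqF.
  rewrite normrM normfV (gtr0_norm D0) ler_pdivrMr//.
  have : `|k - D| <= 4 * e.
    by move: H1; rewrite !ler_norml => /andP[? ?]; apply/andP; split; lra.
  move/le_trans; apply; apply: (@le_trans _ _ (eta * (1 / 2))); first by lra.
  by apply: ler_wpM2l; [exact: ltW|lra].
have zo : dot (gno z) o != 0.
  by rewrite dot_gno_o// invr_eq0 gt_eqF// mulr_gt0// rho_gt0.
have zmap : gno z *m (iota^T - lam *: (o^T *m x)) =
    k *: (v *m (iota^T - lam *: (o^T *m x))).
  rewrite -vz mulmxDl -(scalemxAl (cos th)) -(scalemxAl k).
  by rewrite (gno_annihilates lam0 oS oi) scaler0 add0r.
have -> : z - x = (lam * dot (gno z) o)^-1 *: (gno z *m (iota^T - lam *: (o^T *m x))).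
  by rewrite -(ungnoB iota lam0 x zo) (gnoK lam0 oS oi).
rewrite zmap /push_mx -scalemxAr !scalerA (_ : 1 + (k / D - 1) = k / D); last first.
  by rewrite addrC subrK.
congr (_ *: _).
have -> : dot (gno z) o = D / (lam * r).
  by rewrite -DE mulrC mulKf// gt_eqF// mulr_gt0.
by field; rewrite !gt_eqF.
Qed.

(** The tangent vector v' is chosen so that u + v' lies on the ray through o + (x + z) iota. The
    geodesic in its direction meets this ray after the angle atan tau, tau = sqrt lam |v'|, so v'
    must be shortened by k = atan tau / tau. *)
Lemma chart_to_exp (eta : R) : 0 < eta -> exists2 delta, 0 < delta &
  forall z, enorm z < delta -> exists2 a, `|a| <= eta &
    expS lam u ((1 + a) *: (z *m pull)) = gno (x + z).
Proof.
move=> eta0; pose e := Num.min (1 / 2) (eta / 4).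
have e0 : 0 < e by rewrite lt_min !divr_gt0.
have e1 : e <= 1 / 2 by rewrite ge_min lexx.
have e2 : e <= eta / 4 by rewrite ge_min lexx orbT.
have [d1 d10 H1] := atan_quotient e0; have [A A0 HA] := mulmx_le pull.
pose W := lam * enorm x / r ^+ 2 + 1.
have W0 : 0 < W.
  by rewrite ltr_wpDl// divr_ge0 ?sqr_ge0// mulr_ge0 ?enorm_ge0// ltW.
pose delta := Num.min (d1 / (2 * A * Num.sqrt lam)) (e / W).
have delta0 : 0 < delta by rewrite lt_min !divr_gt0// !mulr_gt0.
exists delta => // z; rewrite lt_min => /andP[z1 z2].
pose mz := lam / r ^+ 2 * dot x z.
have mze : `|mz| <= e.
  rewrite normrM gtr0_norm ?divr_gt0 ?exprn_gt0//.
  move: z2; rewrite ltr_pdivlMr// => z2.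
  apply: (@le_trans _ _ (enorm z * W)); last exact: ltW.
  apply: (@le_trans _ _ (lam / r ^+ 2 * (enorm x * enorm z))).
    by rewrite ler_wpM2l ?norm_dot_le// divr_ge0 ?sqr_ge0// ltW.
  have -> : lam / r ^+ 2 * (enorm x * enorm z) = enorm z * (lam * enorm x / r ^+ 2) by ring.
  by rewrite ler_wpM2l ?enorm_ge0// lerDl.
have /andP[m1 m2] : - e <= mz <= e by rewrite -ler_norml.
have D0 : 0 < 1 + mz by lra.
pose v' := (1 + mz)^-1 *: (z *m pull).
have vu : dot v' u = 0 by rewrite dotZl dot_pull_gno// mulr0.
have uv : u + v' = (r * (1 + mz))^-1 *: (o + (x + z) *m iota).
  apply: (@scalerI _ _ (r * (1 + mz))); first by rewrite gt_eqF// mulr_gt0.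
  rewrite scalerA mulfV ?scale1r; last by rewrite gt_eqF// mulr_gt0.
  have ru : r *: u = o + x *m iota by rewrite scalerA mulfV ?scale1r// gt_eqF.
  have -> : (r * (1 + mz)) *: (u + v') =
      (r * (1 + mz)) *: u + r *: (z *m pull).
    by rewrite [LHS]scalerDr /v' [(_ * _) *: (_ *: (z *m _))]scalerA -mulrA
      mulfV ?mulr1// gt_eqF.
  have -> : r *: (z *m pull) = z *m iota - (lam / r * dot z x) *: u.
    by rewrite mul_pull scalerA mulfV ?scale1r ?gt_eqF.
  have -> : r * (1 + mz) = r + lam / r * dot z x.
    by rewrite /mz (dotC x); field; rewrite gt_eqF.
  by rewrite scalerDl mulmxDl [RHS]addrA -ru addrACA subrr addr0.
have [v0|v0] := eqVneq v' 0.
  exists 0; first by rewrite normr0 ltW.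
  have -> : z *m pull = 0.
    move/eqP: v0; rewrite scaler_eq0 invr_eq0 gt_eqF//= => /eqP; exact.
  rewrite scaler0 expS0.
  have uv' : u = (r * (1 + mz))^-1 *: (o + (x + z) *m iota) by rewrite -uv v0 addr0.
  by apply: gno_unique uv'; [exact: gno_Sp|rewrite invr_gt0 mulr_gt0].
have nv : 0 < enorm v' by rewrite enorm_gt0.
pose tau := Num.sqrt lam * enorm v'.
have tau0 : 0 < tau by rewrite mulr_gt0.
have tau1 : tau < d1.
  rewrite /tau /v' enormZ gtr0_norm ?invr_gt0//.
  apply: (@le_lt_trans _ _ (Num.sqrt lam * (2 * (A * enorm z)))).
    rewrite ler_wpM2l ?(ltW sl0)// ler_pM ?enorm_ge0 ?invr_ge0 ?(ltW D0)//.
    by rewrite invf_ple ?posrE//; lra.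
  move: z1; rewrite ltr_pdivlMr ?mulr_gt0// => z1.
  by have -> : Num.sqrt lam * (2 * (A * enorm z)) =
    enorm z * (2 * A * Num.sqrt lam) by ring.
pose k := atan tau / tau.
have ke : `|k - 1| <= e by apply: H1; rewrite tau0.
have at0 : 0 < atan tau by rewrite -atan0 lt_atan.
have k0 : 0 < k by rewrite divr_gt0.
exists (k / (1 + mz) - 1).
  rewrite (_ : _ - 1 = (k - (1 + mz)) / (1 + mz)); last by field; rewrite gt_eqF.
  rewrite normrM normfV (gtr0_norm D0) ler_pdivrMr//.
  have : `|k - (1 + mz)| <= 2 * e.
    by move: ke; rewrite !ler_norml => /andP[? ?]; apply/andP; split; lra.
  move/le_trans; apply; apply: (@le_trans _ _ (eta * (1 / 2))); first by lra.
  by apply: ler_wpM2l; [exact: ltW|lra].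
rewrite addrC subrK -scalerA -/v'.
have kv : k *: v' != 0 by rewrite scaler_eq0 gt_eqF//=.
have th : Num.sqrt lam * enorm (k *: v') = atan tau.
  by rewrite enormZ gtr0_norm// mulrCA -/tau /k divfK// gt_eqF.
have c0 : 0 < cos (atan tau).
  by apply: cos_gt0_pihalf; rewrite atan_gtNpi2 atan_ltpi2.
have sc : sin (atan tau) = tau * cos (atan tau).
  by rewrite -{2}(atanK tau) /tan divfK// gt_eqF.
have yE : expS lam u (k *: v') = cos (atan tau) *: (u + v').
  rewrite expS_neq0// th [RHS]scalerDr; congr (_ + _).
  rewrite [LHS]scalerA; congr (_ *: _).
  by rewrite sc /k; field; rewrite !gt_eqF.
apply: (@gno_unique _ _ (cos (atan tau) / (r * (1 + mz)))).
- by apply: expS_Sp; [exact: gno_Sp|rewrite dotZl vu mulr0].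
- by rewrite divr_gt0// mulr_gt0.
- by rewrite yE uv scalerA.
Qed.

End ExponentialChart.

Section CurvatureTransformation.
Context {R : realType} {d : nat}.
Variables (lam : R) (o : 'rV[R]_d.+1) (iota : 'M[R]_(d, d.+1)).
Hypotheses (lam0 : 0 < lam) (oS : Sp lam o) (oi : identifies_perp o iota).
Variable K : set 'rV[R]_d.
Hypotheses (cK : compact K) (vK : convex_set K) (K0 : interior K 0).
Hypothesis (d0 : (0 < d)%N).

Local Notation gno := (gno lam o iota).

(** [xget] selects an unspecified member, hence the uniqueness; maps in both directions make A and
    A' empty together, and then both sides are 0. *)
Lemma xget_scale (A A' : set R) (F : R) : F != 0 ->
  (forall k, A k -> A' (F * k)) -> (forall k, A' k -> A (F^-1 * k)) ->
  (forall k k', A k -> A k' -> k = k') -> xget 0 A' = F * xget 0 A.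
Proof.
move=> F0 AA' A'A uA; have [[k Ak]|nA] := pselect (exists k, A k).
  have Ax : A (xget 0 A) by apply: xgetPex; exists k.
  have /A'A Ax' : A' (xget 0 A') by apply: xgetPex; exists (F * k); exact: AA'.
  by rewrite (uA _ _ Ax Ax') mulrA mulfV// mul1r.
rewrite !xgetPN ?mulr0// => k; first by move=> Ak; apply: nA; exists k.
by move=> /A'A Ak; apply: nA; exists (F^-1 * k).
Qed.

Section AtPoint.
Variables (x n : 'rV[R]_d).
Hypotheses (xK : bdE K x) (reg : regular_point K x) (Hn : is_normalE K x n).

Local Notation u := (gno x).
Local Notation m := (gno_normal lam o iota x n).
Local Notation r := (rho lam x).
Local Notation s := (Num.sqrt (1 + lam * dot x n ^+ 2)).
Local Notation push := (push_mx lam o iota x).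
Local Notation pull := (pull_mx lam o iota x).
Local Notation CE := [set v | bdE K (x + v)].
Local Notation CS := [set v | dot v u = 0 /\ bdS lam (gno @` K) (expS lam u v)].

Let n1 : dot n n = 1 := Hn.1.
Let r0 : 0 < r. Proof. exact: rho_gt0. Qed.
Let s0 : 0 < s.
Proof. by rewrite sqrtr_gt0 ltr_pwDl// mulr_ge0 ?sqr_ge0// ltW. Qed.

Lemma second_order_gno (B : 'M[R]_(d.-1, d)) (B' : 'M[R]_(d.-1, d.+1)) S :
  B' *m B'^T = 1%:M -> u *m B'^T = 0 -> m *m B'^T = 0 ->
  second_order CE n B S ->
  second_order CS m B'
    ((r * s)^-1 *: ((B' *m push *m B^T) *m S *m (B' *m push *m B^T)^T)).
Proof.
move=> BB' uB' mB'; apply: second_order_transfer.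
- exact: mulr_gt0.
- move=> v [vu _]; rewrite -mulmxA (frame_gno lam0 oS oi n1 d0 BB' uB' mB').
  by rewrite !mulmxBr mulmx1 -scalemxAr !row_outer vu scale0r scaler0 subr0 subrK.
- by move=> v _; exact: dot_push.
- move=> eta /(exp_to_chart lam0 oS oi x)[delta delta0 H]; exists delta => //.
  move=> v [vu]; rewrite (bdS_gno lam0 oS oi cK) => -[z zK ze] vd.
  have [a aeta za] := H v z vu vd (esym ze); exists a => //=.
  by rewrite -za addrC subrK.
Qed.

Lemma second_order_ungno (B : 'M[R]_(d.-1, d)) (B' : 'M[R]_(d.-1, d.+1)) S :
  B *m B^T = 1%:M -> n *m B^T = 0 ->
  second_order CS m B' S ->
  second_order CE n B
    ((r * s)^-1^-1 *: ((B *m pull *m B'^T) *m S *m (B *m pull *m B'^T)^T)).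
Proof.
move=> BB nB; apply: second_order_transfer.
- by rewrite invr_gt0 mulr_gt0.
- move=> v _; rewrite -mulmxA (orthonormal_frame1 n1 BB nB).
  by rewrite mulmxBr mulmx1 row_outer subrK.
- by move=> v _; exact: dot_pull.
- move=> eta /(chart_to_exp lam0 oS oi x)[delta delta0 H]; exists delta => //.
  move=> z zK /H[a aeta e]; exists a => //; split.
    by rewrite dotZl dot_pull_gno// mulr0.
  by rewrite e (bdS_gno lam0 oS oi cK); exists (x + z).
Qed.

(** The Hessian becomes (r s)^-1 M S M^T with \det M ^+ 2 = r^(2 d) / s^2, so the determinant is
    multiplied by (r s)^(1 - d) r^(2 d) / s^2 = (r / s)^(d + 1). *)
Lemma curvatureS_gno :
  curvatureS lam (gno @` K) u = (r / s) ^+ d.+1 * curvatureE K x.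
Proof.
have F0 : (r / s) ^+ d.+1 != 0 by rewrite expf_neq0// gt_eqF// divr_gt0.
have detF (B : 'M[R]_(d.-1, d)) (B' : 'M[R]_(d.-1, d.+1)) :
    B *m B^T = 1%:M -> n *m B^T = 0 ->
    B' *m B'^T = 1%:M -> u *m B'^T = 0 -> m *m B'^T = 0 ->
    (r * s)^-1 ^+ d.-1 * \det (B' *m push *m B^T) ^+ 2 = (r / s) ^+ d.+1.
  move=> BB nB BB' uB' mB'.
  rewrite (det_push_frames lam0 oS oi n1 d0 BB nB BB' uB' mB').
  have -> : d.*2 = (d.-1 + d.-1 + 2)%N by rewrite -[in LHS](prednK d0) doubleS addnn addn2.
  have -> : d.+1 = (d.-1 + 2)%N by rewrite -[in LHS](prednK d0) addn2.
  rewrite !exprD !exprVn !exprMn !exprVn.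
  have X0 : r ^+ d.-1 != 0 by rewrite expf_neq0// gt_eqF.
  have Y0 : s ^+ d.-1 != 0 by rewrite expf_neq0// gt_eqF.
  move: (r ^+ d.-1) (s ^+ d.-1) X0 Y0 => X Y X0 Y0.
  by field; rewrite X0 Y0 !gt_eqF.
rewrite /curvatureS /curvatureE (normalS_gno lam0 oS oi reg Hn).
rewrite (normalE_regular reg Hn); apply: xget_scale => //.
- move=> _ [B [S [_ [BB nB] HS ->]]].
  have [B' [BB' uB' mB']] := exists_frame_gno lam0 oS oi x n1 BB nB.
  exists B', ((r * s)^-1 *: ((B' *m push *m B^T) *m S *m (B' *m push *m B^T)^T)).
  split.
  + exact: is_normalS_gno.
  + by split.
  + exact: second_order_gno.
  + rewrite detZ !det_mulmx det_tr -(detF B B')// expr2.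
    by ring.
- move=> _ [B' [S [_ [BB' uB' mB'] HS ->]]].
  have [B [BB nB]] := exists_frame_ungno lam0 oS oi n1 BB' uB' mB'.
  exists B, ((r * s)^-1^-1 *: ((B *m pull *m B'^T) *m S *m (B *m pull *m B'^T)^T)).
  split => //; first exact: second_order_ungno.
  have MM := push_pull_frames lam0 oS oi n1 BB nB BB' uB' mB'.
  have := congr1 determinant MM; rewrite det_mulmx det1 => MM1.
  rewrite detZ !(det_mulmx (_ *m S)) (det_mulmx _ S) det_tr -(detF B B')//.
  set D := \det (B' *m _ *m _) in MM1 *; set D' := \det (B *m _ *m _) in MM1 *.
  have D0 : D != 0.
    by apply/eqP => D0; move/eqP: MM1; rewrite D0 mul0r eq_sym oner_eq0.
  have -> : D' = D^-1 by apply: (mulfI D0); rewrite MM1 mulfV.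
  rewrite !exprVn invrK; have Z0 : (r * s) ^+ d.-1 != 0.
    by rewrite expf_neq0// gt_eqF// mulr_gt0.
  move: (_ ^+ d.-1) Z0 => Z Z0; by field; rewrite D0 Z0.
- move=> _ _ [B1 [S1 [_ [BB1 nB1] H1 ->]]] [B2 [S2 [_ [BB2 nB2] H2 ->]]].
  apply: (@second_order_det_unique _ _ _ CE n B1 B2) => //.
    exact: orthonormal_frame1.
  move=> t tn eta delta eta0 delta0.
  exact: (tangent_approx cK vK K0 Hn xK H1 tn eta0 delta0).
Qed.

End AtPoint.
End CurvatureTransformation.

(** * Comparison of the integrals *)

Section GnomonicComparison.
Context {R : realType} {d : nat}.

(* By AM-GM with weight t = rho_mu(z) / rho_mu(x), the numerator
   rho(x) rho(z) - 1 - lam x.z of [gno_dist] is, up to equality at mu, below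
   the affine function a + lam b with a, b >= 0. *)
Lemma gno_dist_compare (lam mu : R) (o o' : 'rV[R]_d.+1)
    (iota iota' : 'M[R]_(d, d.+1)) (k : R) (x z : 'rV[R]_d) :
  0 < lam -> 0 < mu -> Sp lam o -> identifies_perp o iota ->
  Sp mu o' -> identifies_perp o' iota' -> 1 <= k -> mu <= k * lam ->
  enorm (gno lam o iota x - gno lam o iota z) <=
  k * enorm (gno mu o' iota' x - gno mu o' iota' z).
Proof.
move=> l0 m0 oS oi o'S o'i k1 mk; have k0 : 0 < k by exact: lt_le_trans k1.
rewrite -(@ler_pXn2r _ 2) ?nnegrE ?mulr_ge0 ?enorm_ge0 ?(ltW k0)// exprMn.
rewrite (gno_dist l0 oS oi) (gno_dist m0 o'S o'i).
have [a1 a2] : 0 < rho lam x /\ 0 < rho lam z by rewrite !rho_gt0.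
have [b1 b2] : 0 < rho mu x /\ 0 < rho mu z by rewrite !rho_gt0.
pose q := dot x z; pose t := rho mu z / rho mu x.
have t0 : 0 < t by rewrite divr_gt0.
(* The coefficients a and b of the affine bound; each is a square divided by 2 t. *)
pose alpha := (t + t^-1) / 2 - 1; pose gam := (t * dot x x + dot z z / t) / 2 - q.
have al0 : 0 <= alpha.
  rewrite /alpha (_ : _ - 1 = (t - 1) ^+ 2 / (2 * t)).
    by rewrite divr_ge0 ?sqr_ge0// mulr_ge0// ltW.
  by field; rewrite gt_eqF.
have ga0 : 0 <= gam.
  rewrite /gam (_ : _ - q = dot (t *: x - z) (t *: x - z) / (2 * t)).
    by rewrite divr_ge0 ?dot_ge0// mulr_ge0// ltW.
  rewrite dotBl !dotBr !dotZl !dotZr (dotC z x) -/q.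
  by field; rewrite gt_eqF.
have Emu : rho mu x * rho mu z - (1 + mu * q) = alpha + mu * gam.
  have -> : rho mu x * rho mu z = (t * rho mu x ^+ 2 + rho mu z ^+ 2 / t) / 2.
    by rewrite /t; field; rewrite !gt_eqF.
  by rewrite !sqr_rho// /alpha /gam; field; rewrite gt_eqF.
have Elam : rho lam x * rho lam z - (1 + lam * q) <= alpha + lam * gam.
  have : rho lam x * rho lam z <= (t * rho lam x ^+ 2 + rho lam z ^+ 2 / t) / 2.
    rewrite -subr_ge0 (_ : _ - _ = (t * rho lam x - rho lam z) ^+ 2 / (2 * t)).
      by rewrite divr_ge0 ?sqr_ge0// mulr_ge0// ltW.
    by field; rewrite gt_eqF.
  rewrite !sqr_rho// (_ : (_ + _) / 2 = alpha + lam * gam + (1 + lam * q)).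
    by lra.
  by rewrite /alpha /gam; field; rewrite gt_eqF.
clearbody alpha gam.
have rr y : rho mu y ^+ 2 <= k * rho lam y ^+ 2.
  rewrite !sqr_rho// mulrDr mulr1 lerD// mulrA ler_wpM2r ?dot_ge0//.
have NN : rho mu x * rho mu z <= k * (rho lam x * rho lam z).
  rewrite -(@ler_pXn2r _ 2) ?nnegrE ?mulr_ge0 ?(ltW a1) ?(ltW a2) ?(ltW b1) ?(ltW b2) ?(ltW k0)//.
  rewrite !exprMn (_ : k ^+ 2 * _ = (k * rho lam x ^+ 2) * (k * rho lam z ^+ 2)).
    by rewrite ler_pM// ?sqr_ge0.
  by ring.
rewrite -/q Emu; set N := rho lam x * rho lam z in NN Elam *.
set N' := rho mu x * rho mu z in NN *.
have [N0 N0'] : 0 < N /\ 0 < N' by rewrite !mulr_gt0.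
rewrite ler_pdivrMr ?mulr_gt0// [leRHS]mulrC mulrA mulrA ler_pdivlMr ?mulr_gt0//.
have E0 : 0 <= alpha + mu * gam by rewrite addr_ge0// mulr_ge0// ltW.
(* Of the factor k ^+ 2, one k is spent here on the numerators and the 1 / lam, the other in [NN] on
   the product of the rho. *)
have mE : mu * (alpha + lam * gam) <= k * lam * (alpha + mu * gam).
  rewrite !mulrDr lerD//; first by rewrite ler_wpM2r.
  rewrite !mulrA ler_wpM2r// -!mulrA [mu * lam]mulrC ler_peMl// ?mulr_ge0// ltW//.
apply: (@le_trans _ _ (2 * ((mu * (alpha + lam * gam)) * N'))).
  have -> : 2 * (N - (1 + lam * q)) * (mu * N') =
      2 * ((mu * (N - (1 + lam * q))) * N') by ring.
  by rewrite ler_wpM2l// ler_wpM2r ?(ltW N0')// ler_wpM2l// ltW.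
have -> : lam * N * k ^+ 2 * (2 * (alpha + mu * gam)) =
    2 * ((k * lam * (alpha + mu * gam)) * (k * N)) by ring.
rewrite ler_wpM2l// ler_pM// ?(ltW N0')// mulr_ge0 ?(ltW m0)//.
by rewrite addr_ge0// mulr_ge0// ltW.
Qed.

End GnomonicComparison.

Section BilipschitzIntegral.
Context {R : realType} {m m' k : nat}.

Lemma integral_bilipschitz (X : set 'rV[R]_m) (Y : set 'rV[R]_m') (M : R)
    (T : 'rV[R]_m -> 'rV[R]_m') (T' : 'rV[R]_m' -> 'rV[R]_m)
    (f : 'rV[R]_m -> R) (g : 'rV[R]_m' -> R) (c c' : R) (N : set 'rV[R]_m) :
  closed X -> closed Y -> 0 < M ->
  (forall x, X x -> Y (T x)) -> (forall y, Y y -> X (T' y)) ->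
  (forall x, X x -> T' (T x) = x) -> (forall y, Y y -> T (T' y) = y) ->
  lipschitz_on M X T -> lipschitz_on M Y T' -> (hausdorff k X < +oo)%E ->
  0 < c -> 0 < c' -> (forall x, 0 <= f x) -> (forall y, 0 <= g y) ->
  hausdorff k N = 0%E ->
  (forall x, X x -> ~ N x -> f x <= c * g (T x) /\ g (T x) <= c' * f x) ->
  (\int[hausdorff_measure m k]_(x in X) (f x)%:E <=
   (M ^+ k * c)%:E * \int[hausdorff_measure m' k]_(y in Y) (g y)%:E)%E /\
  (\int[hausdorff_measure m' k]_(y in Y) (g y)%:E <=
   (M ^+ k * c')%:E * \int[hausdorff_measure m k]_(x in X) (f x)%:E)%E.
Proof.
move=> cX cY M0 TX T'Y TK T'K LT LT' Xfin c0 c'0 f0 g0 N0 fg; split.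
  apply: (le_integral_lipschitz cX cY M0 M0 T'Y TX T'K TK LT' LT Xfin c0 f0 g0 N0).
  by move=> y Yy Ny; have [+ _] := fg _ (T'Y _ Yy) Ny; rewrite T'K.
have Yfin : (hausdorff k Y < +oo)%E.
  apply: (@le_lt_trans _ _ ((M ^+ k)%:E * hausdorff k X)%E).
    apply: (hausdorff_lipschitz k M0 _ LT) => y Yy.
    by exists (T' y); [exact: T'Y|exact: T'K].
  by rewrite lte_mul_pinfty// lee_fin exprn_ge0// ltW.
have N0' : hausdorff k (T @` (X `&` N)) = 0%E.
  apply/eqP; rewrite eq_le hausdorff_ge0 andbT.
  apply: (@le_trans _ _ ((M ^+ k)%:E * hausdorff k (X `&` N))%E).
    apply: (hausdorff_lipschitz k M0 (phi := T)) => // x y [Xx _] [Xy _].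
    exact: LT.
  rewrite (_ : hausdorff k (X `&` N) = 0%E) ?mule0//.
  apply/eqP; rewrite eq_le hausdorff_ge0 andbT -N0.
  by apply: le_hausdorff => x [].
apply: (le_integral_lipschitz cY cX M0 M0 TX T'Y TK T'K LT LT' Yfin c'0 g0 f0 N0').
move=> x Xx Nx; apply: (fg x Xx _).2 => xN; apply: Nx.
by exists x.
Qed.

End BilipschitzIntegral.

(** * Two-sided ratio bounds and limits *)

Section Ratios.
Context {R : realType}.
Implicit Types (a b M P q : R).

(** For positive a and b this is |log a - log b| <= log M, so inversion preserves M. *)
Definition within_ratio M a b := a <= M * b /\ b <= M * a.

Lemma within_ratioC M a b : within_ratio M a b -> within_ratio M b a.
Proof. by case. Qed.

Lemma within_ratioM M P a b a' b' : 0 < a -> 0 < b -> 0 < a' -> 0 < b' ->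
  within_ratio M a b -> within_ratio P a' b' ->
  within_ratio (M * P) (a * a') (b * b').
Proof.
by move=> a0 b0 a'0 b'0 [ab ba] [ab' ba']; split; rewrite mulrACA ler_pM// ltW.
Qed.

Lemma within_ratioV M a b : 0 < a -> 0 < b -> within_ratio M a b ->
  within_ratio M a^-1 b^-1.
Proof.
move=> a0 b0 [ab ba]; split.
  by rewrite ler_pdivlMr// mulrC ler_pdivrMr.
by rewrite ler_pdivlMr// mulrC ler_pdivrMr.
Qed.

Lemma within_ratioX M a b n : 0 < a -> 0 < b -> within_ratio M a b ->
  within_ratio (M ^+ n) (a ^+ n) (b ^+ n).
Proof.
move=> a0 b0 [ab ba].
have [Mb Ma] := (le_trans (ltW a0) ab, le_trans (ltW b0) ba).
by split; rewrite -exprMn lerXn2r ?nnegrE ?(ltW a0) ?(ltW b0).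
Qed.

Lemma within_ratio_sqr M a b : 0 < a -> 0 < b -> 1 <= M ->
  within_ratio M (a ^+ 2) (b ^+ 2) -> within_ratio M a b.
Proof.
move=> a0 b0 M1 [ab ba]; have M0 : 0 < M by exact: lt_le_trans M1.
have MM c : 0 < c -> M * c ^+ 2 <= (M * c) ^+ 2.
  move=> c0; rewrite exprMn ler_wpM2r ?sqr_ge0// expr2 -[leLHS]mul1r.
  by rewrite ler_wpM2r// ltW.
by split; rewrite -(@ler_pXn2r _ 2) ?nnegrE ?mulr_ge0 ?(ltW a0) ?(ltW b0) ?(ltW M0)//;
  [apply: le_trans ab _|apply: le_trans ba _]; exact: MM.
Qed.

(** k ranges over all reals: for k < 0 both powers are 1 by the convention of [powR], and for k = 0
    they coincide. A negative q is handled by passing to b^-1, which obeys the same bounds. *)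
Lemma powRM_le (b k P q : R) (N : nat) : 0 < b -> P^-1 <= b <= P -> 1 <= P ->
  `|q| <= N%:R -> (b * k) `^ q <= P ^+ N * k `^ q.
Proof.
move=> b0 /andP[Pb bP] P1 qN; have P0 : 0 < P by exact: lt_le_trans P1.
have PN : 1 <= P ^+ N by exact: exprn_ege1.
have PqN r : r <= N%:R -> P `^ r <= P ^+ N.
  by move=> rN; rewrite -powR_mulrn ?(ltW P0)//; exact: ler_powR.
case: (ltgtP k 0) => [k0|k0|->].
- by rewrite !lt0_powR1 ?mulr1// nmulr_llt0.
- rewrite powRM ?(ltW b0) ?(ltW k0)// ler_wpM2r ?powR_ge0//.
  have [q0|q0] := leP 0 q.
    apply: (@le_trans _ _ (P `^ q)); last by apply: PqN; rewrite -(ger0_norm q0).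
    by apply: (ge0_ler_powR q0) => //; rewrite nnegrE ltW.
  apply: (@le_trans _ _ (P `^ (- q))); last by apply: PqN; rewrite -(ltr0_norm q0).
  have -> : b `^ q = b^-1 `^ (- q).
    by rewrite -powR_inv1 ?(ltW b0)// -powRrM mulN1r opprK.
  have q0' : 0 <= - q by rewrite oppr_ge0 ltW.
  apply: (ge0_ler_powR q0').
  + by rewrite nnegrE invr_ge0 ltW.
  + by rewrite nnegrE ltW.
  + by rewrite -[leRHS]invrK lef_pV2 ?posrE ?invr_gt0.
- by rewrite mulr0 -[leLHS]mul1r ler_wpM2r ?powR_ge0.
Qed.

Lemma powR_ratio_le (kap b b' f f' M P q : R) (N : nat) :
  0 < b -> 0 < b' -> 0 <= f' -> 1 <= P -> within_ratio P b' b -> f' <= M * f ->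
  `|q| <= N%:R ->
  (b' * kap) `^ q * f' <= P ^+ N * M * ((b * kap) `^ q * f).
Proof.
move=> b0 b'0 f'0 P1 [bb bb'] ff qN; have P0 : 0 < P by exact: lt_le_trans P1.
have -> : b' * kap = (b' / b) * (b * kap) by field; rewrite gt_eqF.
rewrite (mulrACA (P ^+ N)) ler_pM ?powR_ge0//; apply: powRM_le => //; first exact: divr_gt0.
apply/andP; split; last by rewrite ler_pdivrMr.
by rewrite ler_pdivlMr// mulrC ler_pdivrMr// mulrC.
Qed.

End Ratios.

Section SqueezeRatio.
Context {R : realType}.
Local Open Scope ereal_scope.

(** If J is infinite, the bound J <= M^N I makes I infinite near the limit, so it is eventually
    constant; otherwise I is squeezed between multiples of J. *)
Lemma cvg_of_ratio (F : set_system R) {FF : ProperFilter F} (I : R -> \bar R)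
    (J : \bar R) (M : R -> R) (N : nat) : 0 <= J -> M @ F --> (1%R : R) ->
  (\forall l \near F, [/\ (0 < M l)%R, 0 <= I l, I l <= (M l ^+ N)%:E * J &
     J <= (M l ^+ N)%:E * I l]) ->
  I @ F --> J.
Proof.
move=> J0 cM HI.
have cMN : (fun l => M l ^+ N)%R @ F --> (1%R : R).
  rewrite -[X in _ --> X](expr1n R N).
  apply: (@cvg_comp _ _ _ M (fun t : R => t ^+ N)%R F (nbhs (1%R : R))) => //.
  exact: exprn_continuous.
have [Joo|Jfin] := eqVneq J +oo.
  apply: cvg_near_cst; apply: filterS HI => l [M0 I0 _].
  rewrite Joo leye_eq => /eqP; case: (I l) I0 => [r|//|//] _.
  by rewrite -EFinM.
have {}Jfin : J \is a fin_num by rewrite ge0_fin_numE// ltey.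
apply: (@squeeze_cvge _ _ _ _ (fun l => ((M l ^+ N)^-1 * fine J)%:E) I
   (fun l => (M l ^+ N * fine J)%:E)).
- apply: filterS HI => l [M0 I0 IJ JI]; apply/andP; split.
    rewrite EFinM fineK// muleC lee_pdivrMr ?exprn_gt0//.
    by rewrite muleC.
  by rewrite EFinM fineK.
- rewrite -[in X in _ --> X](fineK Jfin); apply: cvg_EFin; first exact: nearW.
  rewrite /comp /= -[in X in _ --> X](mul1r (fine J)).
  apply: cvgM; last exact: cvg_cst.
  by rewrite -[in X in _ --> X](@invr1 R); apply: cvgV => //; rewrite oner_neq0.
- rewrite -[in X in _ --> X](fineK Jfin); apply: cvg_EFin; first exact: nearW.
  rewrite /comp /= -[in X in _ --> X](mul1r (fine J)).
  by apply: cvgM => //; exact: cvg_cst.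
Qed.

End SqueezeRatio.

(** * The two limits *)

Section Assembly.
Context {R : realType} {d : nat}.
Variables (p : R) (K : set 'rV[R]_d).
Hypotheses (d0 : (0 < d)%N) (cK : compact K) (vK : convex_set K) (K0 : interior K 0).

Local Notation q := (p / (d%:R + p)).
Local Notation Nq := (Num.truncn `|q|).+1.

Let qN : `|q| <= Nq%:R.
Proof. by have /andP[_ /ltW] := truncn_itv (normr_ge0 q). Qed.

Definition curvature_factor (r s f : R) : R := (r / (s * f)) ^+ d.+1.

(** The common form of the integrands, with h = x.n: (r, s, f) is (rho, sqrt (1 + lam h^2), f) at
    lam, (1, 1, h) in the limit 0 up to the factor d, and (rho, sqrt (1 + h^2), 1) for the floating
    area. *)
Definition weighted_curvature (r s f kap : R) : R :=
  (curvature_factor r s f * kap) `^ q * f.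

Lemma curvature_factor_gt0 r s f : 0 < r -> 0 < s -> 0 < f ->
  0 < curvature_factor r s f.
Proof. by move=> *; rewrite exprn_gt0// divr_gt0// mulr_gt0. Qed.

(** Each of r, s and f costs one M in the base, which is raised to the power d + 1 and then to q
    with |q| <= Nq; the last M is for the factor f outside. *)
Lemma weighted_curvature_le M r s f r' s' f' kap : 1 <= M ->
  0 < r -> 0 < s -> 0 < f -> 0 < r' -> 0 < s' -> 0 < f' ->
  within_ratio M r r' -> within_ratio M s s' -> within_ratio M f f' ->
  weighted_curvature r s f kap <=
  M ^+ (3 * d.+1 * Nq + 1) * weighted_curvature r' s' f' kap.
Proof.
move=> M1 r0 s0 f0 r'0 s'0 f'0 Mr Ms Mf.
have -> : M ^+ (3 * d.+1 * Nq + 1) = ((M * (M * M)) ^+ d.+1) ^+ Nq * M.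
  by rewrite exprD expr1 !exprM.
apply: powR_ratio_le => //; try exact: curvature_factor_gt0.
- exact: ltW.
- by rewrite exprn_ege1// !mulr_ege1.
- apply: within_ratioX; try by rewrite divr_gt0// mulr_gt0.
  apply: within_ratioM => //; rewrite ?invr_gt0 ?mulr_gt0//.
  by apply: within_ratioV; rewrite ?mulr_gt0//; exact: within_ratioM.
- by case: Mf.
Qed.

Lemma exists_regular_normal x : bdE K x -> ~ singular_points K x ->
  exists2 n, is_normalE K x n & regular_point K x.
Proof.
move=> xK ns; have [n Hn] := exists_normalE cK vK xK; exists n => // n1 n2 H1 H2.
by apply/eqP; apply: contrapT => /negP nn; apply: ns; split=> //; exists n1, n2.
Qed.

Lemma compact_bdE : compact (bdE K).
Proof.
have [D D0 KD] := compact_enorm_le cK.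
apply: (@closed_bounded_compact _ _ _ D); last by move=> x /(bdE_sub cK)/KD.
rewrite (_ : bdE K = closure K `&` closure (setT `\` K)).
  by apply: closedI; exact: closed_closure.
by apply/seteqP; split=> x; [case|case].
Qed.

Definition fS_of (lam h : R) : R := Num.sqrt ((lam + h ^+ 2) / (1 + lam * h ^+ 2)).

Definition affine_integrandS lam (o : 'rV[R]_d.+1) (iota : 'M[R]_(d, d.+1)) u : R :=
  let L := gno lam o iota @` K in
  (curvatureS lam L u / fS lam o L u ^+ d.+1) `^ q * fS lam o L u.

Lemma affine_integrandS_ge0 lam o iota u : 0 <= affine_integrandS lam o iota u.
Proof. by rewrite mulr_ge0 ?powR_ge0// sqrtr_ge0. Qed.

Lemma sqr_fS_of lam h : 0 < lam -> fS_of lam h ^+ 2 = (lam + h ^+ 2) / (1 + lam * h ^+ 2).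
Proof.
move=> l0; have [h2 l0'] := (sqr_ge0 h, ltW l0).
rewrite /fS_of sqr_sqrtr//; apply: divr_ge0; apply: addr_ge0 => //.
exact: mulr_ge0.
Qed.

Lemma fS_of_gt0 lam h : 0 < lam -> 0 < fS_of lam h.
Proof.
move=> l0; have [h2 l0'] := (sqr_ge0 h, ltW l0).
rewrite sqrtr_gt0; apply: divr_gt0; apply: ltr_pwDl => //.
exact: mulr_ge0.
Qed.

Lemma affine_integrandSE lam o iota x n : 0 < lam -> Sp lam o ->
  identifies_perp o iota -> bdE K x -> is_normalE K x n -> regular_point K x ->
  affine_integrandS lam o iota (gno lam o iota x) =
  weighted_curvature (rho lam x) (Num.sqrt (1 + lam * dot x n ^+ 2))
    (fS_of lam (dot x n)) (curvatureE K x).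
Proof.
move=> l0 oS oi xK Hn reg; have [r r0 rK] := interior0_ball K0.
have h0 : 0 <= dot x n by rewrite (le_trans (ltW r0))// (normalE_height_ge (ltW r0) rK Hn).
rewrite /affine_integrandS (curvatureS_gno l0 oS oi cK vK K0 d0 xK reg Hn).
rewrite (fS_gno l0 oS oi reg Hn h0) -/(fS_of lam (dot x n)).
rewrite /weighted_curvature /curvature_factor; congr (_ `^ _ * _).
move: (rho lam x) (Num.sqrt _) (fS_of _ _) (curvatureE _ _) => a b c e.
have -> : a / (b * c) = a / b / c by rewrite invfM mulrA.
by rewrite [in RHS](expr_div_n (a / b)) mulrAC.
Qed.

Lemma affine_areaSE lam o iota : 0 < lam -> Sp lam o -> identifies_perp o iota ->
  affine_areaS lam o p (gnomonic_preimage lam o iota K) =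
  (\int[hausdorff_measure d.+1 d.-1]_(u in gno lam o iota @` bdE K)
    (affine_integrandS lam o iota u)%:E)%E.
Proof.
move=> l0 oS oi; rewrite /affine_areaS gnomonic_preimageE//.
by rewrite (bdS_gno l0 oS oi cK).
Qed.

Section SmallCurvature.
Variables (lam D r0 M : R) (o : 'rV[R]_d.+1) (iota : 'M[R]_(d, d.+1)).
Hypotheses (lam0 : 0 < lam) (oS : Sp lam o) (oi : identifies_perp o iota).
Hypotheses (r00 : 0 < r0) (rK : forall y, enorm y <= r0 -> K y).
Hypotheses (D0 : 0 < D) (KD : forall x, K x -> enorm x <= D).
(** lam D^2 controls rho and sqrt (1 + lam h^2), since |x| and h are at most D; lam / r0^2 controls
    (lam + h^2) / h^2, since h >= r0. *)
Hypothesis ME : M = 1 + lam * (D ^+ 2 + (r0 ^+ 2)^-1).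

Let r02 : 0 < (r0 ^+ 2)^-1. Proof. by rewrite invr_gt0 exprn_gt0. Qed.

Let M1 : 1 <= M.
Proof. by rewrite ME lerDl mulr_ge0 ?ltW// addr_gt0// exprn_gt0. Qed.

Let MD : 1 + lam * D ^+ 2 <= M.
Proof. by rewrite ME mulrDr addrA lerDl mulr_ge0// ltW. Qed.

Let near1 (a : R) : 0 <= a -> a <= D ^+ 2 ->
  within_ratio M (Num.sqrt (1 + lam * a)) 1.
Proof.
move=> a0 aD; have l1 : 1 <= 1 + lam * a by rewrite lerDl mulr_ge0// ltW.
apply: within_ratio_sqr => //; first by rewrite sqrtr_gt0 (lt_le_trans ltr01).
rewrite sqr_sqrtr ?(le_trans ler01)// expr1n; split.
  by rewrite mulr1 (le_trans _ MD)// lerD2l ler_wpM2l// ltW.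
by rewrite (le_trans M1)// -[leLHS]mulr1 ler_wpM2l// (le_trans ler01).
Qed.

Lemma affine_integrandS_near0 x n : bdE K x -> is_normalE K x n ->
  regular_point K x ->
  let E := (centro_affine_curvature K x `^ q * (d%:R^-1 * dot x (Defs.normalE K x))) in
  E <= M ^+ (3 * d.+1 * Nq + 1) / d%:R * affine_integrandS lam o iota (gno lam o iota x) /\
  affine_integrandS lam o iota (gno lam o iota x) <= M ^+ (3 * d.+1 * Nq + 1) * d%:R * E.
Proof.
move=> xK Hn reg /=; have xKK := bdE_sub cK xK.
rewrite (affine_integrandSE lam0 oS oi xK Hn reg) /centro_affine_curvature.
rewrite (normalE_regular reg Hn); set h := dot x n.
have hr : r0 <= h by exact: normalE_height_ge (ltW r00) rK Hn.
have h0 : 0 < h by exact: lt_le_trans hr.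
have hD : h <= D.
  by rewrite (le_trans (dot_le_enorm _ _))// (enorm1 Hn.1) mulr1 KD.
have d0' : d%:R != 0 :> R by rewrite pnatr_eq0 -lt0n.
have -> : (curvatureE K x / h ^+ d.+1) `^ q * (d%:R^-1 * h) =
    weighted_curvature 1 1 h (curvatureE K x) / d%:R.
  rewrite /weighted_curvature /curvature_factor !mul1r exprVn [_^-1 * curvatureE _ _]mulrC.
  by rewrite -!mulrA; congr (_ * _); rewrite mulrC.
have hD2 : h ^+ 2 <= D ^+ 2 by rewrite lerXn2r ?nnegrE// ltW.
have xD2 : dot x x <= D ^+ 2.
  by rewrite -sqr_enorm lerXn2r ?nnegrE ?enorm_ge0 ?KD// ltW.
have Mr : within_ratio M (rho lam x) 1 by apply: near1 => //; exact: dot_ge0.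
have Ms : within_ratio M (Num.sqrt (1 + lam * h ^+ 2)) 1.
  by apply: near1 => //; exact: sqr_ge0.
have h20 : 0 < h ^+ 2 by rewrite exprn_gt0.
have lh : 0 < 1 + lam * h ^+ 2 by rewrite ltr_pwDl// mulr_ge0// ltW.
have Mf : within_ratio M (fS_of lam h) h.
  apply: within_ratio_sqr => //; first exact: fS_of_gt0.
  rewrite sqr_fS_of//; split.
    rewrite ler_pdivrMr//; apply: (@le_trans _ _ (M * h ^+ 2)).
      rewrite ME mulrDl mul1r addrC lerD2l -mulrA -[leLHS]mulr1 ler_wpM2l ?(ltW lam0)//.
      rewrite mulrDl; apply: ler_wpDl; first by rewrite mulr_ge0 ?sqr_ge0.
      rewrite -(@mulVf _ (r0 ^+ 2)) ?gt_eqF ?exprn_gt0// ler_wpM2l ?(ltW r02)//.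
      by rewrite lerXn2r ?nnegrE ?(ltW r00) ?(ltW h0).
    rewrite -[leLHS]mulr1; apply: ler_wpM2l.
      by rewrite mulr_ge0 ?(ltW h20) ?(le_trans ler01 M1).
    by rewrite lerDl mulr_ge0// ltW.
  rewrite mulrA ler_pdivlMr// [leRHS]mulrDr.
  apply: (@le_trans _ _ (M * h ^+ 2)).
    rewrite mulrC ler_wpM2r ?(ltW h20)// (le_trans _ MD)// lerD2l.
    by rewrite ler_wpM2l// ltW.
  by rewrite lerDr mulr_ge0 ?(le_trans ler01 M1)// ltW.
have s0 : 0 < Num.sqrt (1 + lam * h ^+ 2) by rewrite sqrtr_gt0.
have [rg fg] := (rho_gt0 lam0 x, fS_of_gt0 h lam0).
split.
  rewrite [leRHS]mulrAC ler_wpM2r ?invr_ge0//.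
  by apply: weighted_curvature_le => //; exact: within_ratioC.
have -> (a b : R) : a * d%:R * (b / d%:R) = a * b by field.
exact: weighted_curvature_le.
Qed.

Lemma affine_areaS_near0 :
  (affine_areaS lam o p (gnomonic_preimage lam o iota K) <=
   (M ^+ (d.-1 + (3 * d.+1 * Nq + 1)))%:E * affine_area p K)%E /\
  (affine_area p K <= (M ^+ (d.-1 + (3 * d.+1 * Nq + 1)))%:E *
   affine_areaS lam o p (gnomonic_preimage lam o iota K))%E.
Proof.
rewrite (affine_areaSE lam0 oS oi) /affine_area.
have M0 : 0 < M := lt_le_trans ltr01 M1.
have d0' : 0 < d%:R :> R by rewrite ltr0n.
set C := M ^+ (3 * d.+1 * Nq + 1); have C0 : 0 < C by rewrite exprn_gt0.
pose E x := centro_affine_curvature K x `^ q * (d%:R^-1 * dot x (Defs.normalE K x)).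
(* E is known to be nonnegative only on the boundary, whereas the comparison of integrals asks for
   integrands nonnegative everywhere. *)
have E0 x : 0 <= Num.max 0 (E x) by rewrite le_max lexx.
have hpos x n : is_normalE K x n -> 0 <= dot x n.
  by move=> Hn; rewrite (le_trans (ltW r00))// (normalE_height_ge (ltW r00) rK Hn).
have EE x : bdE K x -> Num.max 0 (E x) = E x.
  move=> xK; apply/max_idPr; rewrite /E mulr_ge0 ?powR_ge0// mulr_ge0 ?invr_ge0//.
  by apply: (hpos _ (Defs.normalE K x)); apply: getPex; exact: exists_normalE.
have -> : (\int[hausdorff_measure d d.-1]_(x in bdE K) (E x)%:E =
    \int[hausdorff_measure d d.-1]_(x in bdE K) (Num.max 0 (E x))%:E)%E.
  by apply: eq_integral => x /set_mem xK; rewrite EE.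
have cX := compact_closed (@norm_hausdorff _ _) compact_bdE.
have cY : closed (gno lam o iota @` bdE K).
  by apply: compact_closed; [exact: norm_hausdorff|exact: compact_gno compact_bdE].
have TX x : bdE K x -> (gno lam o iota @` bdE K) (gno lam o iota x) by exists x.
have TK x : bdE K x -> ungno lam o iota (gno lam o iota x) = x.
  by move=> _; exact: gnoK.
have T'Y u : (gno lam o iota @` bdE K) u -> bdE K (ungno lam o iota u).
  by move=> [x xK <-]; rewrite TK.
have T'K u : (gno lam o iota @` bdE K) u -> gno lam o iota (ungno lam o iota u) = u.
  by move=> [x xK <-]; rewrite TK.
have LT : lipschitz_on M (bdE K) (gno lam o iota).
  move=> x z _ _; apply: (le_trans (gno_nonexpansive lam0 oS oi x z)).
  by rewrite -[leLHS]mul1r ler_wpM2r ?enorm_ge0.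
have LT' : lipschitz_on M (gno lam o iota @` bdE K) (ungno lam o iota).
  move=> _ _ [x xK <-] [z zK <-]; rewrite !TK//.
  have [xD zD] := (KD (bdE_sub cK xK), KD (bdE_sub cK zK)).
  apply: (le_trans (gno_expansive lam0 oS oi xD zD)).
  by rewrite ler_wpM2r ?enorm_ge0.
have Cd : 0 < C / d%:R by rewrite divr_gt0.
have dC : 0 < C * d%:R by rewrite mulr_gt0.
have [|A B] := integral_bilipschitz cX cY M0 TX T'Y TK T'K LT LT'
  (hausdorff_bdE_lty cK vK d0) Cd dC E0 (affine_integrandS_ge0 lam o iota)
  (hausdorff_singular_points cK K0).
  move=> x xK /(exists_regular_normal xK)[n Hn reg]; rewrite EE//.
  exact: (affine_integrandS_near0 xK Hn reg).
have -> : M ^+ (d.-1 + (3 * d.+1 * Nq + 1)) = M ^+ d.-1 * C by rewrite exprD.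
split.
  by apply: (le_trans B); rewrite muleA -EFinM mulrA.
(* The factor d in front of the integral cancels the 1 / d of the cone volume measure. *)
rewrite -lee_pdivlMl//; apply: (le_trans A).
by rewrite muleA -EFinM mulrA [(_ * d%:R^-1)%R]mulrC.
Qed.

End SmallCurvature.

Section CurvatureNear1.
Variables (lam M : R) (o1 o : 'rV[R]_d.+1) (iota1 iota : 'M[R]_(d, d.+1)).
Hypotheses (oS1 : Sp 1 o1) (oi1 : identifies_perp o1 iota1).
Hypotheses (lam0 : 0 < lam) (oS : Sp lam o) (oi : identifies_perp o iota).
Hypotheses (M1 : 1 <= M) (lamM : lam <= M) (Mlam : 1 <= M * lam).

Local Notation g1 := (gno 1 o1 iota1).
Local Notation g := (gno lam o iota).

Let near1 (a : R) : 0 <= a ->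
  within_ratio M (Num.sqrt (1 + lam * a)) (Num.sqrt (1 + 1 * a)).
Proof.
move=> a0; have [l1 l2] : 1 <= 1 + lam * a /\ 1 <= 1 + 1 * a.
  by rewrite !lerDl !mulr_ge0// ltW.
apply: within_ratio_sqr => //; try by rewrite sqrtr_gt0 (lt_le_trans ltr01).
rewrite !sqr_sqrtr ?(le_trans ler01)//; split; rewrite mulrDr mulr1 lerD//.
  by rewrite mul1r ler_wpM2r.
by rewrite mulrA ler_wpM2r.
Qed.

Lemma floating_integrand_near1 x n : bdE K x -> is_normalE K x n ->
  regular_point K x ->
  let k1 := curvatureS 1 (g1 @` K) (g1 x) `^ q in
  k1 <= M ^+ (3 * d.+1 * Nq + 1) * affine_integrandS lam o iota (g x) /\
  affine_integrandS lam o iota (g x) <= M ^+ (3 * d.+1 * Nq + 1) * k1.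
Proof.
move=> xK Hn reg /=.
rewrite (affine_integrandSE lam0 oS oi xK Hn reg).
rewrite (curvatureS_gno ltr01 oS1 oi1 cK vK K0 d0 xK reg Hn).
set h := dot x n; have h20 : 0 <= h ^+ 2 by exact: sqr_ge0.
have -> : ((rho 1 x / Num.sqrt (1 + 1 * h ^+ 2)) ^+ d.+1 * curvatureE K x) `^ q =
    weighted_curvature (rho 1 x) (Num.sqrt (1 + 1 * h ^+ 2)) 1 (curvatureE K x).
  by rewrite /weighted_curvature /curvature_factor !mulr1.
have Mr : within_ratio M (rho lam x) (rho 1 x) by apply: near1; exact: dot_ge0.
have Ms := near1 h20.
have Mf : within_ratio M (fS_of lam h) 1.
  have lh : 0 < 1 + lam * h ^+ 2 by rewrite ltr_pwDl// mulr_ge0// ltW.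
  apply: within_ratio_sqr => //; first exact: fS_of_gt0.
  (* Numerator and denominator are compared termwise: lam with 1, and h^2 with lam h^2. *)
  rewrite sqr_fS_of// expr1n; split.
    by rewrite mulr1 ler_pdivrMr// mulrDr mulr1 lerD// mulrA ler_peMl.
  rewrite mulrA ler_pdivlMr// mul1r mulrDr lerD//.
  by rewrite ler_wpM2r.
have [s1 s2] : 0 < Num.sqrt (1 + lam * h ^+ 2) /\ 0 < Num.sqrt (1 + 1 * h ^+ 2).
  by rewrite !sqrtr_gt0 !ltr_pwDl// ?mul1r// mulr_ge0// ltW.
have [[rg r1g] fg] := (rho_gt0 lam0 x, rho_gt0 ltr01 x, fS_of_gt0 h lam0).
by split; apply: weighted_curvature_le => //; exact: within_ratioC.
Qed.

Lemma affine_areaS_near1 :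
  (affine_areaS lam o p (gnomonic_preimage lam o iota K) <=
   (M ^+ (d.-1 + (3 * d.+1 * Nq + 1)))%:E *
   floating_area p (gnomonic_preimage 1 o1 iota1 K))%E /\
  (floating_area p (gnomonic_preimage 1 o1 iota1 K) <=
   (M ^+ (d.-1 + (3 * d.+1 * Nq + 1)))%:E *
   affine_areaS lam o p (gnomonic_preimage lam o iota K))%E.
Proof.
rewrite (affine_areaSE lam0 oS oi) /floating_area gnomonic_preimageE//.
rewrite (bdS_gno ltr01 oS1 oi1 cK).
have M0 : 0 < M := lt_le_trans ltr01 M1.
set C := M ^+ (3 * d.+1 * Nq + 1); have C0 : 0 < C by rewrite exprn_gt0.
have -> : M ^+ (d.-1 + (3 * d.+1 * Nq + 1)) = M ^+ d.-1 * C by rewrite exprD.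
have cG l (o' : 'rV[R]_d.+1) (iota' : 'M[R]_(d, d.+1)) : 0 < l -> Sp l o' ->
    identifies_perp o' iota' -> closed (gno l o' iota' @` bdE K).
  move=> l0 o'S o'i; apply: compact_closed; first exact: norm_hausdorff.
  exact: compact_gno compact_bdE.
(* The change of model passes through R^d, where both models share the point x. *)
pose T u := g (ungno 1 o1 iota1 u); pose T' u := g1 (ungno lam o iota u).
have TE x : T (g1 x) = g x by rewrite /T gnoK.
have T'E x : T' (g x) = g1 x by rewrite /T' gnoK.
have TX u : (g1 @` bdE K) u -> (g @` bdE K) (T u).
  by move=> [x xK <-]; rewrite TE; exists x.
have T'Y u : (g @` bdE K) u -> (g1 @` bdE K) (T' u).
  by move=> [x xK <-]; rewrite T'E; exists x.
have TK u : (g1 @` bdE K) u -> T' (T u) = u.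
  by move=> [x xK <-]; rewrite TE T'E.
have T'K u : (g @` bdE K) u -> T (T' u) = u.
  by move=> [x xK <-]; rewrite T'E TE.
have LT : lipschitz_on M (g1 @` bdE K) T.
  move=> _ _ [x xK <-] [z zK <-]; rewrite !TE.
  exact: (gno_dist_compare _ _ lam0 ltr01 oS oi oS1 oi1).
have LT' : lipschitz_on M (g @` bdE K) T'.
  move=> _ _ [x xK <-] [z zK <-]; rewrite !T'E.
  by apply: (gno_dist_compare _ _ ltr01 lam0 oS1 oi1 oS oi) => //; rewrite mulr1.
have img (A : set 'rV[R]_d) :
    (hausdorff d.-1 (g1 @` A) <= (1 ^+ d.-1)%:E * hausdorff d.-1 A)%E.
  apply: (hausdorff_lipschitz d.-1 ltr01 (phi := g1)) => // x z _ _.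
  by rewrite mul1r; exact: gno_nonexpansive.
have Xfin : (hausdorff d.-1 (g1 @` bdE K) < +oo)%E.
  apply: (le_lt_trans (img _)); rewrite expr1n mul1e.
  exact: hausdorff_bdE_lty.
have N0 : hausdorff d.-1 (g1 @` singular_points K) = 0%E.
  apply/eqP; rewrite eq_le hausdorff_ge0 andbT; apply: (le_trans (img _)).
  by rewrite hausdorff_singular_points// mule0.
have f0 u : 0 <= curvatureS 1 (g1 @` K) u `^ q by exact: powR_ge0.
have [|A B] := integral_bilipschitz (cG _ _ _ ltr01 oS1 oi1) (cG _ _ _ lam0 oS oi)
  M0 TX T'Y TK T'K LT LT' Xfin C0 C0 f0 (affine_integrandS_ge0 lam o iota) N0.
  move=> _ [x xK <-] nx; rewrite TE.
  have [n Hn reg] : exists2 n, is_normalE K x n & regular_point K x.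
    by apply: exists_regular_normal => // sx; apply: nx; exists x.
  exact: (floating_integrand_near1 xK Hn reg).
by split.
Qed.

End CurvatureNear1.
End Assembly.

Theorem theorem9p3 (R : realType) (d : nat) (p : R) (Kbar : set 'rV[R]_d)
    (o : R -> 'rV[R]_d.+1) (iota : R -> 'M[R]_(d, d.+1)) :
  (2 <= d)%N ->
  p != - d%:R ->
  convex_body Kbar ->
  interior Kbar 0 ->
  (p < 0 -> class_C2plus Kbar) ->
  (forall lam : R, 0 < lam ->
     Sp lam (o lam) /\ identifies_perp (o lam) (iota lam)) ->
  (affine_areaS lam (o lam) p
     (gnomonic_preimage lam (o lam) (iota lam) Kbar)
     @[lam --> (0 : R)^'+] --> affine_area p Kbar) /\
  (affine_areaS lam (o lam) p
     (gnomonic_preimage lam (o lam) (iota lam) Kbar)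
     @[lam --> (1 : R)^'] -->
   floating_area p (gnomonic_preimage 1 (o 1) (iota 1) Kbar)).
Proof.
move=> d2 _ [cK vK _] K0 _ oiP; have d0 : (0 < d)%N by exact: leq_trans d2.
have [r r0 rK] := interior0_ball K0; have [D D0 KD] := compact_enorm_le cK.
have S0 lam : (0 <= affine_areaS lam (o lam) p
    (gnomonic_preimage lam (o lam) (iota lam) Kbar))%E.
  by apply: integral_ge0 => u _; rewrite lee_fin mulr_ge0 ?powR_ge0 ?sqrtr_ge0.
split.
- pose M lam : R := 1 + lam * (D ^+ 2 + (r ^+ 2)^-1).
  apply: (@cvg_of_ratio _ _ _ _ _ M (d.-1 + (3 * d.+1 * _ + 1))).
  + apply: mule_ge0 => //; apply: integral_ge0 => x xK.
    rewrite lee_fin mulr_ge0 ?powR_ge0// mulr_ge0 ?invr_ge0//.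
    apply: le_trans (ltW r0) _; apply: (normalE_height_ge (ltW r0) rK).
    by apply: getPex; exact: exists_normalE.
  + rewrite -[X in _ --> X]addr0 -[X in _ --> _ + X](mul0r (D ^+ 2 + (r ^+ 2)^-1)).
    apply: cvgD; first exact: cvg_cst.
    apply: cvgM; last exact: cvg_cst.
    exact: cvg_at_right_filter.
  + near=> lam; have lam0 : 0 < lam by near: lam; exact: nbhs_right_gt.
    have [oS oi] := oiP lam lam0.
    have [A B] := affine_areaS_near0 p d0 cK vK K0 lam0 oS oi r0 rK D0 KD erefl.
    split; [|exact: S0|exact: A|exact: B].
    by rewrite /M ltr_pwDl// mulr_ge0 ?(ltW lam0)// addr_ge0 ?sqr_ge0// invr_ge0 sqr_ge0.
(* A continuous majorant of both lam and 1 / lam with value 1 at lam = 1. *)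
- pose M lam : R := 1 + `|lam - 1| + `|lam^-1 - 1|.
  apply: (@cvg_of_ratio _ _ _ _ _ M (d.-1 + (3 * d.+1 * _ + 1))).
  + by apply: integral_ge0 => u _; rewrite lee_fin powR_ge0.
  + have cM : M @ (1 : R) --> (1 : R).
      have M1 : 1 = M 1 by rewrite /M invr1 subrr normr0 !addr0.
      rewrite {2}M1; apply: cvgD; first apply: cvgD; first exact: cvg_cst.
        apply: cvg_norm; apply: cvgB; first exact: cvg_id.
        exact: cvg_cst.
      apply: cvg_norm; apply: cvgB; last exact: cvg_cst.
      by apply: cvgV; [exact: oner_neq0|exact: cvg_id].
    by apply: cvg_trans cM; apply: cvg_app; exact: cvg_within.
  + near=> lam; have lam0 : 0 < lam.
      near: lam; apply: cvg_within.
      exact: lt_nbhsr.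
    have [oS oi] := oiP lam lam0; have [oS1 oi1] := oiP 1 ltr01.
    have nn := normr_ge0 (lam - 1); have nn' := normr_ge0 (lam^-1 - 1).
    have M1 : 1 <= M lam by rewrite /M; lra.
    have lM : lam <= M lam by have := ler_norm (lam - 1); rewrite /M; lra.
    have Ml : 1 <= M lam * lam.
      rewrite -ler_pdivrMr// mul1r; have := ler_norm (lam^-1 - 1); rewrite /M; lra.
    have [A B] := affine_areaS_near1 p d0 cK vK K0 oS1 oi1 lam0 oS oi M1 lM Ml.
    by split; [exact: lt_le_trans M1|exact: S0|exact: A|exact: B].
Unshelve. all: by end_near. Qed.
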